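(* (i) For $0<\Delta\le 1$ and $w,z\in\mathbb{C}$, \[ K_{\mathrm{SO(even)},\pi\Delta}(w,z) = \frac{\sin\pi\Delta(z-\overline{w})}{\pi(z-\overline{w})} - \frac{1}{2 + \Delta} \left(\frac{\sin\pi\Delta z}{\pi z}\right) \left( \frac{\sin\pi\Delta \overline{w} }{\pi \overline{w}}\right). \] (ii) For $1<\Delta\le 2$, define the constants $\tau := e^{(2-\Delta)i/4} + i e^{\Delta i/4}$, $a := e^{\Delta i /4} + i e^{(2-\Delta)i/4} - ie^{ \Delta i/4} + \left( \tfrac{2 - \Delta}{4}\right)\tau$, $b := e^{\Delta i/4} + ie^{(2-\Delta) i/4} - e^{(2- \Delta) i/4} + \left( \tfrac{2 - \Delta}{4}\right)\tau$, and the functions of $w\in\mathbb{C}$ \[ C(w) := \frac{-16\pi^2w^2 -4 \pi i w\,e^{2\pi iw}}{1 - 16 \pi^2w^2},\qquad F(w) := \frac{2\cos(\pi(2-\Delta)w) - 8 \pi w \sin(\pi \Delta w)}{1 - 16 \pi^2 w^2}, \] \[ G(w):=\frac{2\cos(\pi \Delta w)+ 4 \pi i w\, e^{- \pi \Delta i w} - e^{\pi (2 -\Delta)i w} }{1 - 16 \pi^2 w^2} - \frac{\sin(\pi (2 - \Delta)w)}{2\pi w (1 - 16 \pi^2 w^2) } + \left( \frac{2 - \Delta}{4}\right)F(w), \] \[ A(w) := \frac{\overline{a}\,\overline{G(\overline{w})} - \overline{b}\,G(w)}{\overline{a} b - a\overline{b}},\quad B(w) := \frac{b\,G(w) - a\,\overline{G(\overline{w})}}{\overline{a}b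 - a \overline{b}},\quad D(w) := \frac12 \big(\tau A(w) + \overline{\tau} B(w) - F(w)\big). \] Then \begin{align*} K_{\mathrm{SO(even)},\pi\Delta}(w,z) &= \frac{\overline{A(w)} \big(i e^{2\pi i z} - 1\big)\big(e^{-\Delta( \pi i z + i/4)} - e^{-(2-\Delta)(\pi i z + i/4)}\big)}{2\pi i z + i/2} \\ &\quad +\frac{\overline{B(w)}\big( -i e^{2\pi i z} - 1\big)\big(e^{-\Delta( \pi i z - i/4)} - e^{-(2-\Delta)(\pi i z - i/4)}\big)}{2\pi i z - i/2} \\ &\quad + \frac{C(\overline{w})\big( e^{\pi \Delta i (z - \overline{w})} - e^{\pi (2-\Delta) i (z - \overline{w})}\big) + \overline{C(w)}\big(-e^{-\pi \Delta i (z-\overline{w})} + e^{-\pi (2 - \Delta) i (z-\overline{w})}\big)}{2\pi i (z-\overline{w})}\\ &\quad + \frac{\overline{D(w)} \, \sin\big(\pi (2-\Delta) z\big)}{\pi z} + \frac{\sin\big(\pi (2-\Delta) (z - \overline{w})\big)}{\pi(z-\overline{w})}, \end{align*} where at $w=\pm 1/(4\pi)$ the formula is interpreted as the appropriate limit (the map $w\mapsto K_{\mathrm{SO(even)},\pi\Delta}(\overline{w},z)$ being entire).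
   Context: $W_{\mathrm{SO(even)}}(x)=1+\frac{\sin 2\pi x}{2\pi x}$. For $\Delta>0$, $\mathcal{H}_{\mathrm{SO(even)},\pi\Delta}$ is the Hilbert space of entire functions $F$ of exponential type at most $\pi\Delta$ with $\int_{\mathbb{R}}|F(x)|^2W_{\mathrm{SO(even)}}(x)\,dx<\infty$, with inner product $\langle F,H\rangle=\int_{\mathbb{R}}F\overline{H}\,W_{\mathrm{SO(even)}}\,dx$. Its reproducing kernel $K_{\mathrm{SO(even)},\pi\Delta}$ is the unique function on $\mathbb{C}\times\mathbb{C}$ with $K(w,\cdot)$ in the space and $F(w)=\langle F,K(w,\cdot)\rangle$ for all $F$ in the space and all $w\in\mathbb{C}$. Removable singularities (e.g. at $z=0$, $z=\overline{w}$) are interpreted by continuity. *)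

(* Defs.v *)
From Stdlib Require Import Reals.
From Coquelicot Require Import Coquelicot.

Open Scope C_scope.

Definition Cexp (z : C) : C :=
  (exp (Re z) * cos (Im z), exp (Re z) * sin (Im z))%R.
Definition Csin (z : C) : C := (Cexp (Ci * z) - Cexp (- (Ci * z))) / (2 * Ci).
Definition Ccos (z : C) : C := (Cexp (Ci * z) + Cexp (- (Ci * z))) / 2.

Definition piC : C := RtoC PI.

(** The weight W_{SO(even)}(x) = 1 + sin(2 pi x)/(2 pi x), with W(0) = 2
    (value by continuity). *)
Definition W_SOeven (x : R) : R :=
  if Req_EM_T x 0 then 2%R else (1 + sin (2 * PI * x) / (2 * PI * x))%R.

Definition entire (f : C -> C) : Prop :=
  forall z : C, @ex_derive C_AbsRing C_NormedModule f z.

Definition exp_type_le (f : C -> C) (tau : R) : Prop :=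
  forall eps : R, (0 < eps)%R ->
    exists M : R, forall z : C, (Cmod (f z) <= M * exp ((tau + eps) * Cmod z))%R.

Definition in_H_SOeven (Delta : R) (F : C -> C) : Prop :=
  entire F /\ exp_type_le F (PI * Delta) /\
  ex_RInt_gen (fun x : R => (Cmod (F (RtoC x)) ^ 2 * W_SOeven x)%R)
    (Rbar_locally m_infty) (Rbar_locally p_infty).

Definition is_repr_kernel_SOeven (Delta : R) (K : C -> C -> C) : Prop :=
  forall w : C, in_H_SOeven Delta (K w) /\
    forall F : C -> C, in_H_SOeven Delta F ->
      is_RInt_gen
        (fun x : R => F (RtoC x) * Cconj (K w (RtoC x)) * RtoC (W_SOeven x))
        (Rbar_locally m_infty) (Rbar_locally p_infty) (F w).

(** Part (i): the explicit formula (valid off its removable singularities). *)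
Definition K_formula_i (Delta : R) (w z : C) : C :=
  let d := RtoC Delta in
  Csin (piC * d * (z - Cconj w)) / (piC * (z - Cconj w))
  - (1 / (2 + d)) * (Csin (piC * d * z) / (piC * z))
      * (Csin (piC * d * Cconj w) / (piC * Cconj w)).

Definition nonsing_i (w z : C) : Prop :=
  w <> 0 /\ z <> 0 /\ z <> Cconj w.

Section PartII.
Variable Delta : R.
Let d : C := RtoC Delta.
Let e := RtoC ((2 - Delta) / 4).

Definition tau_ii : C :=
  Cexp (RtoC ((2 - Delta) / 4) * Ci) + Ci * Cexp (RtoC (Delta / 4) * Ci).
Definition a_ii : C :=
  Cexp (RtoC (Delta / 4) * Ci) + Ci * Cexp (RtoC ((2 - Delta) / 4) * Ci)
  - Ci * Cexp (RtoC (Delta / 4) * Ci) + e * tau_ii.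
Definition b_ii : C :=
  Cexp (RtoC (Delta / 4) * Ci) + Ci * Cexp (RtoC ((2 - Delta) / 4) * Ci)
  - Cexp (RtoC ((2 - Delta) / 4) * Ci) + e * tau_ii.

Let den (w : C) : C := 1 - RtoC 16 * piC ^ 2 * w ^ 2.

Definition C_ii (w : C) : C :=
  (- (RtoC 16 * piC ^ 2 * w ^ 2) - RtoC 4 * piC * Ci * w * Cexp (2 * piC * Ci * w))
  / den w.
Definition F_ii (w : C) : C :=
  (2 * Ccos (piC * (2 - d) * w) - RtoC 8 * piC * w * Csin (piC * d * w)) / den w.
Definition G_ii (w : C) : C :=
  (2 * Ccos (piC * d * w) + RtoC 4 * piC * Ci * w * Cexp (- (piC * d * Ci * w))
     - Cexp (piC * (2 - d) * Ci * w)) / den w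
  - Csin (piC * (2 - d) * w) / (2 * piC * w * den w)
  + e * F_ii w.
Definition A_ii (w : C) : C :=
  (Cconj a_ii * Cconj (G_ii (Cconj w)) - Cconj b_ii * G_ii w)
  / (Cconj a_ii * b_ii - a_ii * Cconj b_ii).
Definition B_ii (w : C) : C :=
  (b_ii * G_ii w - a_ii * Cconj (G_ii (Cconj w)))
  / (Cconj a_ii * b_ii - a_ii * Cconj b_ii).
Definition D_ii (w : C) : C :=
  (1 / 2) * (tau_ii * A_ii w + Cconj tau_ii * B_ii w - F_ii w).

Definition K_formula_ii (w z : C) : C :=
  let q := RtoC (1 / 4) in
  Cconj (A_ii w) * (Ci * Cexp (2 * piC * Ci * z) - 1)
    * (Cexp (- (d * (piC * Ci * z + Ci * q)))
       - Cexp (- ((2 - d) * (piC * Ci * z + Ci * q))))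
    / (2 * piC * Ci * z + Ci / 2)
  + Cconj (B_ii w) * (- (Ci * Cexp (2 * piC * Ci * z)) - 1)
    * (Cexp (- (d * (piC * Ci * z - Ci * q)))
       - Cexp (- ((2 - d) * (piC * Ci * z - Ci * q))))
    / (2 * piC * Ci * z - Ci / 2)
  + (C_ii (Cconj w) * (Cexp (piC * d * Ci * (z - Cconj w))
                        - Cexp (piC * (2 - d) * Ci * (z - Cconj w)))
     + Cconj (C_ii w) * (- Cexp (- (piC * d * Ci * (z - Cconj w)))
                          + Cexp (- (piC * (2 - d) * Ci * (z - Cconj w)))))
    / (2 * piC * Ci * (z - Cconj w))
  + Cconj (D_ii w) * Csin (piC * (2 - d) * z) / (piC * z)
  + Csin (piC * (2 - d) * (z - Cconj w)) / (piC * (z - Cconj w)).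
End PartII.

(** Points where the formula of part (ii) is literally defined. *)
Definition nonsing_ii (w z : C) : Prop :=
  w <> 0 /\ w <> RtoC (/ (4 * PI)) /\ w <> RtoC (- / (4 * PI)) /\
  z <> 0 /\ z <> RtoC (/ (4 * PI)) /\ z <> RtoC (- / (4 * PI)) /\
  z <> Cconj w.

(** "K equals the formula f, removable singularities interpreted by
    continuity": equality on the nonsingular set, and at every point (w,z)
    K w z is the limit of f along nonsingular points. *)
Definition kernel_given_by (K : C -> C -> C) (f : C -> C -> C)
    (ns : C -> C -> Prop) : Prop :=
  (forall w z, ns w z -> K w z = f w z) /\
  (forall w z,
     filterlim (fun p : C * C => f (fst p) (snd p))
       (within (fun p : C * C => ns (fst p) (snd p)) (locally (w, z)))
       (locally (K w z))).

(* Main.v *)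
Require Import Defs.
From Stdlib Require Import Reals Lra Lia List Classical ClassicalEpsilon.
From Coquelicot Require Import Coquelicot.
Open Scope C_scope.

(** Let [E_{l,c}(z) = (exp (i l (z - c)) - 1) / (z - c)], an entire function.  If [F] is entire of
    exponential type at most [tau] and square integrable on the real line, a contour shift shows
    that [J(l) = int F E_{l,c}] is constant for [l >= tau] and for [l <= -tau], and that the two
    constants differ by [2 pi i F(c)].  The shift needs the growth [exp (t |Im z|)] on horizontal
    strips, which Phragmen-Lindelof gives for functions bounded on the line; averaging [F] over
    short windows makes it bounded, and a slight dilation makes its type strictly smaller than
    [tau].  A product of [E_{l,c}] with [sin (2 pi x) / (2 pi x)] is again a combination of such
    functions, so testing the claimed kernel against [F] becomes linear algebra in the numbers
    [J(l)]: the frequencies below the type of [F] cancel and only [F(w)] remains.  Evaluation at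
    [w] is bounded on the space and continuous in norm with respect to [w]; this makes every
    reproducing kernel jointly continuous, and extends the kernel to the points [w] at which the
    formula of part (ii) has removable singularities. *)

(** The two ranges of [Delta] differ in one respect: [F] times a block of frequency pi Delta has
    type 2 pi Delta. If this is at most 2 pi, the sinc part of the weight sees the product only
    through its value at 0, and the kernel is a rank one correction of the sine kernel. Beyond that,
    shifting the frequency +-pi Delta by 2 pi lands on -+r with r = pi (2 - Delta), strictly inside
    the band, where [J] is not a value of [F]. These unknown numbers are removed with the help of
    blocks of frequency +-r, whose product with [F] has type exactly 2 pi. At a centre c the
    cancellation of J(r) and J(-r) is a 2 by 2 linear system whose determinant 1 - 1/(16 pi^2 c^2)
    explains the denominators: at c = w, against the sine kernel of frequency r, its solution gives
    the function C, and at c = +-1/(4 pi) there are homogeneous solutions, with free coefficients A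
    and B. What is left are the unknowns centred at 0, namely J(r), J(-r) and F(0), and the
    vanishing of their three coefficients determines A, B and D. *)

(** * Elementary inequalities for the modulus *)

Lemma Cmod_eq (z : C) : Cmod z = sqrt (Re z ^ 2 + Im z ^ 2).
Proof. reflexivity. Qed.

Lemma Im_le_Cmod (z : C) : (Rabs (Im z) <= Cmod z)%R.
Proof. apply Rle_trans with (2 := Rmax_Cmod z). apply Rmax_r. Qed.

Lemma Cmod_le_Re_Im (z : C) : (Cmod z <= Rabs (Re z) + Rabs (Im z))%R.
Proof.
  assert (H := Cmod2_alt z). assert (H0 := Cmod_ge_0 z).
  assert (H1 := Rabs_pos (Re z)). assert (H2 := Rabs_pos (Im z)).
  rewrite <- (pow2_abs (Re z)), <- (pow2_abs (Im z)) in H.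
  apply Rsqr_incr_0_var; [ unfold Rsqr; nra | lra ].
Qed.

Lemma Cmod_sym (x y : C) : Cmod (x - y) = Cmod (y - x).
Proof. rewrite <- Cmod_opp. f_equal. ring. Qed.

Lemma Cmod_minus_le (x y : C) : (Cmod (x - y) <= Cmod x + Cmod y)%R.
Proof. unfold Cminus. rewrite <- (Cmod_opp y). apply Cmod_triangle. Qed.

Lemma Cmod_triangle_inv (x y : C) : (Cmod x - Cmod y <= Cmod (x - y))%R.
Proof.
  assert (H := Cmod_triangle (x - y) y).
  replace (x - y + y) with x in H by ring. lra.
Qed.

Lemma Ceq (x y : C) : Re x = Re y -> Im x = Im y -> x = y.
Proof. destruct x, y; simpl; congruence. Qed.

Lemma Cmod_small_eq (x y : C) :
  (forall eps, (0 < eps)%R -> (Cmod (x - y) <= eps)%R) -> x = y.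
Proof.
  intros H. apply Ceq_minus, Cmod_eq_0.
  destruct (Rle_lt_or_eq_dec 0 _ (Cmod_ge_0 (x - y))) as [h|h]; [|easy].
  specialize (H (Cmod (x - y) / 2)%R). lra.
Qed.

(** * Continuity and complex derivatives *)

(** Continuity relative to an arbitrary gap [d], so that the algebra of limits is proved once for
    functions of a complex and of a real variable. *)
Definition econt {T : Type} (d : T -> T -> R) (f : T -> C) (x : T) : Prop :=
  forall eps, (0 < eps)%R -> exists delta, (0 < delta)%R /\
    forall y, (d x y < delta)%R -> (Cmod (f y - f x) < eps)%R.

Definition Cgap (x y : C) : R := Cmod (y - x).
Definition Rgap (x y : R) : R := Rabs (y - x).
Notation ccont := (econt Cgap).
Notation rcont := (econt Rgap).

Section Econt.
Context {T : Type} (d : T -> T -> R).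

Lemma econt_const (c : C) x : econt d (fun _ => c) x.
Proof.
  intros eps He. exists 1%R. split; [lra|]. intros y _.
  replace (c - c) with (RtoC 0) by ring. rewrite Cmod_0. lra.
Qed.

Lemma econt_plus (f g : T -> C) x :
  econt d f x -> econt d g x -> econt d (fun t => f t + g t) x.
Proof.
  intros Hf Hg eps He.
  destruct (Hf (eps / 2)%R ltac:(lra)) as [d1 [Hd1 H1]].
  destruct (Hg (eps / 2)%R ltac:(lra)) as [d2 [Hd2 H2]].
  exists (Rmin d1 d2). split; [now apply Rmin_pos|]. intros y Hy.
  assert (Hy1 := Rlt_le_trans _ _ _ Hy (Rmin_l d1 d2)).
  assert (Hy2 := Rlt_le_trans _ _ _ Hy (Rmin_r d1 d2)).
  specialize (H1 y Hy1). specialize (H2 y Hy2).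
  replace (f y + g y - (f x + g x)) with ((f y - f x) + (g y - g x)) by ring.
  assert (H := Cmod_triangle (f y - f x) (g y - g x)). lra.
Qed.

Lemma econt_mult (f g : T -> C) x :
  econt d f x -> econt d g x -> econt d (fun t => f t * g t) x.
Proof.
  intros Hf Hg eps He.
  set (A := (1 + Cmod (f x) + Cmod (g x))%R).
  assert (HA : (1 <= A)%R)
    by (unfold A; generalize (Cmod_ge_0 (f x)) (Cmod_ge_0 (g x)); lra).
  assert (He' : (0 < Rmin 1 (eps / (2 * A)))%R)
    by (apply Rmin_pos; [lra| apply Rdiv_lt_0_compat; lra]).
  destruct (Hf _ He') as [d1 [Hd1 H1]]. destruct (Hg _ He') as [d2 [Hd2 H2]].
  exists (Rmin d1 d2). split; [now apply Rmin_pos|]. intros y Hy.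
  specialize (H1 y (Rlt_le_trans _ _ _ Hy (Rmin_l d1 d2))).
  specialize (H2 y (Rlt_le_trans _ _ _ Hy (Rmin_r d1 d2))).
  assert (L1 := Rmin_l 1 (eps / (2 * A))). assert (L2 := Rmin_r 1 (eps / (2 * A))).
  replace (f y * g y - f x * g x)
    with ((f y - f x) * (g y - g x) + (f x * (g y - g x) + g x * (f y - f x))) by ring.
  eapply Rle_lt_trans; [apply Cmod_triangle|].
  eapply Rle_lt_trans; [apply Rplus_le_compat_l, Cmod_triangle|].
  rewrite !Cmod_mult.
  set (u := Cmod (f y - f x)) in *. set (v := Cmod (g y - g x)) in *.
  assert (Hu := Cmod_ge_0 (f y - f x)). assert (Hv := Cmod_ge_0 (g y - g x)).
  fold u in Hu. fold v in Hv.
  assert (Hq : (A * (eps / (2 * A)) = eps / 2)%R) by (field; lra).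
  set (q := (eps / (2 * A))%R) in *.
  assert (Fx := Cmod_ge_0 (f x)). assert (Gx := Cmod_ge_0 (g x)).
  assert (u * v <= q)%R by nra.
  assert (Cmod (f x) * v <= Cmod (f x) * q)%R by (apply Rmult_le_compat_l; lra).
  assert (Cmod (g x) * u <= Cmod (g x) * q)%R by (apply Rmult_le_compat_l; lra).
  unfold A in Hq. nra.
Qed.

Lemma econt_ext (f g : T -> C) x :
  (forall y, f y = g y) -> econt d f x -> econt d g x.
Proof.
  intros H Hf eps He. destruct (Hf eps He) as [dl [Hd K]].
  exists dl. split; [easy|]. intros y Hy. rewrite <- !H. auto.
Qed.

Lemma econt_opp (f : T -> C) x : econt d f x -> econt d (fun t => - f t) x.
Proof.
  intros H. apply econt_ext with (fun t => RtoC (-1) * f t); [intros; ring|].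
  apply econt_mult; [apply econt_const|easy].
Qed.

Lemma econt_minus (f g : T -> C) x :
  econt d f x -> econt d g x -> econt d (fun t => f t - g t) x.
Proof. intros Hf Hg. apply econt_plus; [easy|now apply econt_opp]. Qed.

Lemma econt_inv (f : T -> C) x : f x <> 0 -> econt d f x -> econt d (fun t => / f t) x.
Proof.
  intros H0 Hf eps He.
  assert (Hm : (0 < Cmod (f x))%R) by now apply Cmod_gt_0.
  set (m := Cmod (f x)) in *.
  assert (P : (0 < Rmin (m / 2) (eps * m * m / 2))%R).
  { apply Rmin_pos; [lra|]. assert (0 < eps * m * m)%R; [|lra].
    repeat apply Rmult_lt_0_compat; lra. }
  destruct (Hf _ P) as [dl [Hd K]]. exists dl. split; [easy|]. intros y Hy.
  specialize (K y Hy).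
  assert (L1 := Rmin_l (m / 2) (eps * m * m / 2)).
  assert (L2 := Rmin_r (m / 2) (eps * m * m / 2)).
  assert (Hy2 : (m / 2 < Cmod (f y))%R).
  { assert (Q := Cmod_triangle_inv (f x) (f x - f y)).
    replace (f x - (f x - f y)) with (f y) in Q by ring.
    rewrite (Cmod_sym (f x)) in Q. fold m in Q. lra. }
  assert (Hy0 : f y <> 0) by (apply Cmod_gt_0; lra).
  replace (/ f y - / f x) with (- (f y - f x) / (f y * f x)) by (field; auto).
  rewrite Cmod_div, Cmod_opp, Cmod_mult by (now apply Cmult_neq_0). fold m.
  apply Rlt_div_l; [apply Rmult_lt_0_compat; lra|].
  eapply Rlt_le_trans; [exact K|]. eapply Rle_trans; [exact L2|].
  assert (0 < eps * m)%R by (apply Rmult_lt_0_compat; lra). nra.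
Qed.

Lemma econt_conj (f : T -> C) x : econt d f x -> econt d (fun t => Cconj (f t)) x.
Proof.
  intros H eps He. destruct (H eps He) as [dl [Hd K]]. exists dl. split; [easy|].
  intros y Hy. rewrite <- Cminus_conj, Cmod_conj. auto.
Qed.

Lemma econt_comp (h : C -> C) (f : T -> C) x :
  ccont h (f x) -> econt d f x -> econt d (fun t => h (f t)) x.
Proof.
  intros Hh Hf eps He. destruct (Hh eps He) as [e1 [He1 K1]].
  destruct (Hf e1 He1) as [e2 [He2 K2]]. exists e2. split; [easy|].
  intros y Hy. apply K1, K2, Hy.
Qed.
End Econt.

Lemma ccont_id z : ccont (fun x => x) z.
Proof. intros eps He. exists eps. now split. Qed.

(* Caratheodory form of the complex derivative: [q] is the difference quotient. *)
Definition hasd (f : C -> C) (z l : C) : Prop :=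
  exists q, q z = l /\ ccont q z /\ forall y, f y = f z + (y - z) * q y.

Definition holo (f : C -> C) (z : C) : Prop := exists l, hasd f z l.

Lemma hasd_ext (f g : C -> C) z l : (forall y, f y = g y) -> hasd f z l -> hasd g z l.
Proof. intros H [q [H1 [H2 H3]]]. exists q. repeat split; auto. intros y. rewrite <- !H. auto. Qed.

Lemma hasd_ccont f z l : hasd f z l -> ccont f z.
Proof.
  intros [q [H1 [H2 H3]]].
  apply econt_ext with (fun y => f z + (y - z) * q y); [auto|].
  apply econt_plus; [apply econt_const|]. apply econt_mult; [|easy].
  apply econt_minus; [apply ccont_id|apply econt_const].
Qed.

Lemma holo_ccont (f : C -> C) z : holo f z -> ccont f z.
Proof. intros [l H]. eapply hasd_ccont; eauto. Qed.

Lemma hasd_const c z : hasd (fun _ => c) z 0.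
Proof.
  exists (fun _ => RtoC 0). split; [easy|]. split; [apply econt_const|]. intros; ring.
Qed.

Lemma hasd_id z : hasd (fun x => x) z 1.
Proof.
  exists (fun _ => RtoC 1). split; [easy|]. split; [apply econt_const|]. intros; ring.
Qed.

Lemma hasd_plus (f g : C -> C) z l m : hasd f z l -> hasd g z m -> hasd (fun y => f y + g y) z (l + m).
Proof.
  intros [q [H1 [H2 H3]]] [r [K1 [K2 K3]]]. exists (fun y => q y + r y).
  split; [congruence|]. split; [now apply econt_plus|].
  intros y. rewrite (H3 y), (K3 y). ring.
Qed.

Lemma hasd_mult (f g : C -> C) z l m :
  hasd f z l -> hasd g z m -> hasd (fun y => f y * g y) z (l * g z + f z * m).
Proof.
  intros Hf [r [K1 [K2 K3]]]. pose proof (hasd_ccont _ _ _ Hf) as Cf.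
  destruct Hf as [q [H1 [H2 H3]]].
  exists (fun y => q y * g z + f y * r y).
  split; [congruence|]. split.
  - apply econt_plus; apply econt_mult; auto. apply econt_const.
  - intros y. rewrite (K3 y), (H3 y). ring.
Qed.

Lemma hasd_comp (f g : C -> C) z l m : hasd f (g z) l -> hasd g z m -> hasd (fun y => f (g y)) z (l * m).
Proof.
  intros [q [H1 [H2 H3]]] Hg. pose proof (hasd_ccont _ _ _ Hg) as Cg.
  destruct Hg as [r [K1 [K2 K3]]].
  exists (fun y => q (g y) * r y). split; [congruence|]. split.
  - apply econt_mult; auto. now apply (econt_comp Cgap q g).
  - intros y. rewrite (H3 (g y)). rewrite (K3 y) at 1. ring.
Qed.

(** [hasd] asks for a factorisation on all of [C], but only the continuity of the quotient at [z]
    matters: the quotient of [f] is kept on the disc and replaced elsewhere by the plain difference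
    quotient of [g]. *)
Lemma hasd_local (f g : C -> C) z l : (exists d, (0 < d)%R /\ forall y, (Cmod (y - z) < d)%R -> f y = g y) ->
  hasd f z l -> hasd g z l.
Proof.
  intros [d [Hd E]] [q [H1 [H2 H3]]].
  exists (fun y => if Rlt_dec (Cmod (y - z)) d then q y else (g y - g z) / (y - z)).
  assert (Z : (Cmod (z - z) < d)%R) by (replace (z - z) with (RtoC 0) by ring; now rewrite Cmod_0).
  split; [destruct (Rlt_dec (Cmod (z - z)) d); easy|]. split.
  - intros eps He. destruct (H2 eps He) as [d2 [Hd2 K]].
    exists (Rmin d d2). split; [now apply Rmin_pos|]. intros y Hy. unfold Cgap in *.
    destruct (Rlt_dec (Cmod (y - z)) d) as [h|h].
    2: { generalize (Rmin_l d d2). lra. }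
    destruct (Rlt_dec (Cmod (z - z)) d); [|easy]. apply K.
    generalize (Rmin_r d d2). unfold Cgap. lra.
  - intros y. destruct (Rlt_dec (Cmod (y - z)) d) as [h|h].
    + rewrite <- !E by easy. apply H3.
    + field. intros K. apply h. rewrite K, Cmod_0. easy.
Qed.

Lemma hasd_inv (f : C -> C) z l : f z <> 0 -> hasd f z l -> hasd (fun y => / f y) z (- l / (f z * f z)).
Proof.
  intros H0 Hf. pose proof (hasd_ccont _ _ _ Hf) as Cf.
  pose proof Hf as [q [H1 [H2 H3]]].
  destruct (Cf (Cmod (f z)) (proj1 (Cmod_gt_0 _) H0)) as [d [Hd K]].
  (* [f] may vanish away from [z], so [/ f] is compared with a function that has the required
     factorisation by construction and agrees with it where [f] stays nonzero. *)
  apply hasd_local with (fun y => / f z + (y - z) * (- q y * (/ f z * / f y))).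
  - exists d. split; [easy|]. intros y Hy.
    assert (f y <> 0). { intros E. specialize (K y Hy). rewrite E in K.
      replace (0 - f z) with (- f z) in K by ring. rewrite Cmod_opp in K. lra. }
    assert (E : (y - z) * q y = f y - f z) by (rewrite (H3 y); ring).
    replace ((y - z) * (- q y * (/ f z * / f y))) with (- ((y - z) * q y) * (/ f z * / f y)) by ring.
    rewrite E. field. auto.
  - exists (fun y => - q y * (/ f z * / f y)). split; [rewrite H1; field; auto|]. split.
    + apply econt_mult; [now apply econt_opp|]. apply econt_mult; [apply econt_const|].
      now apply econt_inv.
    + intros y. ring.
Qed.

Lemma holo_const c z : holo (fun _ => c) z.
Proof. eexists. apply hasd_const. Qed.
Lemma holo_id z : holo (fun x => x) z.
Proof. eexists. apply hasd_id. Qed.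
Lemma holo_plus (f g : C -> C) z : holo f z -> holo g z -> holo (fun y => f y + g y) z.
Proof. intros [l H] [m K]. eexists. apply hasd_plus; eauto. Qed.
Lemma holo_mult (f g : C -> C) z : holo f z -> holo g z -> holo (fun y => f y * g y) z.
Proof. intros [l H] [m K]. eexists. apply hasd_mult; eauto. Qed.
Lemma holo_comp (f g : C -> C) z : holo f (g z) -> holo g z -> holo (fun y => f (g y)) z.
Proof. intros [l H] [m K]. eexists. apply hasd_comp; eauto. Qed.
Lemma holo_ext (f g : C -> C) z : (forall y, f y = g y) -> holo f z -> holo g z.
Proof. intros E [l H]. exists l. eapply hasd_ext; eauto. Qed.
Lemma holo_opp (f : C -> C) z : holo f z -> holo (fun y => - f y) z.
Proof.
  intros H. apply holo_ext with (fun y => RtoC (-1) * f y); [intros; ring|].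
  apply holo_mult; [apply holo_const|easy].
Qed.
Lemma holo_minus (f g : C -> C) z : holo f z -> holo g z -> holo (fun y => f y - g y) z.
Proof. intros H K. apply holo_plus; [easy|now apply holo_opp]. Qed.
Lemma holo_inv (f : C -> C) z : f z <> 0 -> holo f z -> holo (fun y => / f y) z.
Proof. intros H0 [l H]. eexists. apply hasd_inv; eauto. Qed.
Lemma holo_pow (f : C -> C) n z : holo f z -> holo (fun y => f y ^ n) z.
Proof. intros H. induction n; simpl; [apply holo_const|now apply holo_mult]. Qed.

Lemma hasd_eps f z l :
  hasd f z l <-> forall eps, (0 < eps)%R -> exists delta, (0 < delta)%R /\
    forall y, (Cmod (y - z) < delta)%R ->
      (Cmod (f y - f z - (y - z) * l) <= eps * Cmod (y - z))%R.
Proof.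
  split.
  - intros [q [H1 [H2 H3]]] eps He. destruct (H2 eps He) as [d [Hd K]].
    exists d. split; [easy|]. intros y Hy. specialize (K y Hy).
    rewrite (H3 y), <- H1.
    replace (f z + (y - z) * q y - f z - (y - z) * q z) with ((y - z) * (q y - q z)) by ring.
    rewrite Cmod_mult, Rmult_comm. apply Rmult_le_compat_r; [apply Cmod_ge_0|lra].
  - intros H. exists (fun y => if excluded_middle_informative (y = z) then l else (f y - f z) / (y - z)).
    split; [destruct (excluded_middle_informative (z = z)); easy|]. split.
    + intros eps He. destruct (H (eps / 2)%R ltac:(lra)) as [d [Hd K]].
      exists d. split; [easy|]. intros y Hy.
      destruct (excluded_middle_informative (z = z)) as [_|n]; [|easy].
      destruct (excluded_middle_informative (y = z)) as [e|n].
      * replace (l - l) with (RtoC 0) by ring. rewrite Cmod_0. lra.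
      * specialize (K y Hy).
        assert (N : y - z <> 0) by now apply Cminus_eq_contra.
        assert (P := proj1 (Cmod_gt_0 _) N).
        replace ((f y - f z) / (y - z) - l) with ((f y - f z - (y - z) * l) / (y - z)) by (field; easy).
        rewrite Cmod_div by easy. apply Rle_lt_trans with (eps / 2)%R; [|lra].
        apply Rle_div_l; lra.
    + intros y. destruct (excluded_middle_informative (y = z)) as [e|n].
      * subst. ring.
      * field. now apply Cminus_eq_contra.
Qed.

(** The bridge from the factorised derivative to the one used in [entire]. *)
Lemma hasd_is_derive f z l :
  hasd f z l <-> @is_derive C_AbsRing C_NormedModule f z l.
Proof.
  rewrite hasd_eps. split.
  - intros H. split.
    + apply is_linear_scal_l.
    + intros x Hx eps.
      apply (@is_filter_lim_locally_unique C_AbsRing (AbsRing_NormedModule C_AbsRing)) in Hx. subst x.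
      destruct (H eps (cond_pos eps)) as [d [Hd K]]. exists (mkposreal d Hd).
      intros y Hy. apply K. apply Hy.
  - intros [_ H] eps He.
    destruct (H z (fun P HP => HP) (mkposreal eps He)) as [d Hd].
    exists d. split; [apply cond_pos|]. intros y Hy. apply (Hd y Hy).
Qed.

Lemma entire_holo f : entire f <-> forall z, holo f z.
Proof.
  split; intros H z; destruct (H z) as [l Hl]; exists l; now apply hasd_is_derive.
Qed.

Lemma holo_conj_conj f z : holo f (Cconj z) -> holo (fun y => Cconj (f (Cconj y))) z.
Proof.
  intros [l H]. exists (Cconj l). apply hasd_eps. intros eps He.
  destruct (proj1 (hasd_eps f (Cconj z) l) H eps He) as [d [Hd K]].
  exists d. split; [easy|]. intros y Hy. specialize (K (Cconj y)).
  rewrite <- Cminus_conj, Cmod_conj in K. specialize (K Hy).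
  rewrite <- (Cmod_conj (f (Cconj y) - _ - _)) in K.
  rewrite !Cminus_conj, Cmult_conj, !Cminus_conj, !Cconj_conj in K. exact K.
Qed.

(** * The complex exponential *)

Lemma Cexp_0 : Cexp 0 = 1.
Proof. unfold Cexp; simpl. rewrite exp_0, cos_0, sin_0. apply Ceq; simpl; ring. Qed.

Lemma Cexp_plus x y : Cexp (x + y) = Cexp x * Cexp y.
Proof.
  unfold Cexp; simpl. destruct x as [a b], y as [c d]; simpl.
  rewrite exp_plus, cos_plus, sin_plus. apply Ceq; simpl; ring.
Qed.

Lemma Cexp_opp_l x : Cexp (- x) * Cexp x = 1.
Proof. rewrite <- Cexp_plus, <- Cexp_0. f_equal. ring. Qed.

Lemma Cexp_nz x : Cexp x <> 0.
Proof. intros H. apply C1_nz. rewrite <- (Cexp_opp_l x), H. ring. Qed.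

Lemma Cexp_opp x : Cexp (- x) = / Cexp x.
Proof.
  assert (H := Cexp_nz x). rewrite <- (Cmult_1_l (/ Cexp x)), <- (Cexp_opp_l x). field. easy.
Qed.

Lemma Cmod_Cexp z : Cmod (Cexp z) = exp (Re z).
Proof.
  rewrite Cmod_eq. set (x := Re z). set (y := Im z).
  change (sqrt ((exp x * cos y) ^ 2 + (exp x * sin y) ^ 2) = exp x).
  assert (H := sin2_cos2 y). unfold Rsqr in H.
  replace ((exp x * cos y) ^ 2 + (exp x * sin y) ^ 2)%R
    with (exp x * exp x * (sin y * sin y + cos y * cos y))%R by ring.
  rewrite H, Rmult_1_r. apply sqrt_square, Rlt_le, exp_pos.
Qed.

Lemma Cconj_Cexp z : Cconj (Cexp z) = Cexp (Cconj z).
Proof.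
  destruct z as [x y]. unfold Cexp, Cconj; simpl. rewrite cos_neg, sin_neg. apply Ceq; simpl; ring.
Qed.

Lemma derivable_pt_lim_0_eps f l : derivable_pt_lim f 0 l ->
  forall eps, (0 < eps)%R -> exists d, (0 < d)%R /\
   forall x, (Rabs x < d)%R -> (Rabs (f x - f 0 - l * x) <= eps * Rabs x)%R.
Proof.
  intros H eps He. destruct (H eps He) as [d K]. exists d. split; [apply cond_pos|].
  intros x Hx. destruct (Req_dec x 0) as [->|N].
  - replace (f 0 - f 0 - l * 0)%R with 0%R by ring. rewrite Rabs_R0. lra.
  - specialize (K x N Hx). rewrite Rplus_0_l in K.
    replace (f x - f 0 - l * x)%R with (((f x - f 0) / x - l) * x)%R by (field; easy).
    rewrite Rabs_mult. apply Rmult_le_compat_r; [apply Rabs_pos|lra].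
Qed.

(** Differentiability of [Cexp] at 0, drawn from the real derivatives of exp, cos and sin at 0; the
    addition formula then carries it to every point. *)
Lemma Cexp_small eps : (0 < eps)%R -> exists d, (0 < d)%R /\
  forall h, (Cmod h < d)%R -> (Cmod (Cexp h - 1 - h) <= eps * Cmod h)%R.
Proof.
  (* The real part of the error costs [3 * e * r] and the imaginary part [5 * e * r], whence the
     8. *)
  intros He. set (e := Rmin 1 (eps / 8)).
  assert (Pe : (0 < e)%R) by (apply Rmin_pos; lra).
  assert (E1 : (e <= 1)%R) by apply Rmin_l. assert (E2 : (e <= eps / 8)%R) by apply Rmin_r.
  clearbody e.
  destruct (derivable_pt_lim_0_eps exp _ (derivable_pt_lim_exp 0) e Pe) as [d1 [D1 H1]].
  destruct (derivable_pt_lim_0_eps cos _ (derivable_pt_lim_cos 0) e Pe) as [d2 [D2 H2]].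
  destruct (derivable_pt_lim_0_eps sin _ (derivable_pt_lim_sin 0) e Pe) as [d3 [D3 H3]].
  rewrite exp_0 in H1. rewrite cos_0, sin_0 in H2. rewrite sin_0, cos_0 in H3.
  exists (Rmin (Rmin d1 e) (Rmin d2 d3)). split; [repeat apply Rmin_pos; easy|].
  intros [x y] Hh.
  assert (Hx := re_le_Cmod (x, y)). assert (Hy := Im_le_Cmod (x, y)). simpl in Hx, Hy.
  assert (M1 := Rmin_l (Rmin d1 e) (Rmin d2 d3)). assert (M2 := Rmin_r (Rmin d1 e) (Rmin d2 d3)).
  assert (M3 := Rmin_l d1 e). assert (M4 := Rmin_r d1 e).
  assert (M5 := Rmin_l d2 d3). assert (M6 := Rmin_r d2 d3).
  specialize (H1 x ltac:(lra)). specialize (H2 y ltac:(lra)). specialize (H3 y ltac:(lra)).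
  set (r := Cmod (x, y)) in *.
  assert (Cb := COS_bound y).
  eapply Rle_trans; [apply Cmod_le_Re_Im|]. unfold Cexp; simpl.
  assert (A1 := Rabs_pos x). assert (A2 := Rabs_pos y).
  assert (K1 : (Rabs (exp x * cos y + - (1) + - x) <= 3 * e * r)%R).
  { replace (exp x * cos y + - (1) + - x)%R
      with ((exp x - 1 - 1 * x) * cos y + (1 + x) * (cos y - 1 - - 0 * y))%R by ring.
    eapply Rle_trans; [apply Rabs_triang|]. rewrite !Rabs_mult.
    assert (Rabs (cos y) <= 1)%R by (apply Rabs_le; lra).
    assert (Rabs (1 + x) <= 2)%R.
    { eapply Rle_trans; [apply Rabs_triang|]. rewrite Rabs_R1. lra. }
    assert (Rabs (exp x - 1 - 1 * x) * Rabs (cos y) <= e * r * 1)%R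
      by (apply Rmult_le_compat; try apply Rabs_pos; nra).
    assert (Rabs (1 + x) * Rabs (cos y - 1 - - 0 * y) <= 2 * (e * r))%R
      by (apply Rmult_le_compat; try apply Rabs_pos; nra).
    lra. }
  assert (K2 : (Rabs (exp x * sin y + - 0 + - y) <= 5 * e * r)%R).
  { replace (exp x * sin y + - 0 + - y)%R
      with ((exp x - 1) * sin y + (sin y - 0 - 1 * y))%R by ring.
    eapply Rle_trans; [apply Rabs_triang|]. rewrite Rabs_mult.
    assert (Rabs (exp x - 1) <= 2 * e)%R.
    { replace (exp x - 1)%R with ((exp x - 1 - 1 * x) + x)%R by ring.
      eapply Rle_trans; [apply Rabs_triang|]. nra. }
    assert (Rabs (sin y) <= 2 * r)%R.
    { replace (sin y)%R with ((sin y - 0 - 1 * y) + y)%R by ring.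
      eapply Rle_trans; [apply Rabs_triang|]. nra. }
    assert (Rabs (exp x - 1) * Rabs (sin y) <= 2 * e * (2 * r))%R
      by (apply Rmult_le_compat; try apply Rabs_pos; easy).
    nra. }
  assert (0 <= r)%R by apply Cmod_ge_0. nra.
Qed.

Lemma hasd_Cexp z : hasd Cexp z (Cexp z).
Proof.
  apply hasd_eps. intros eps He.
  assert (P := proj1 (Cmod_gt_0 _) (Cexp_nz z)).
  destruct (Cexp_small (eps / Cmod (Cexp z))) as [d [Hd K]]; [now apply Rdiv_lt_0_compat|].
  exists d. split; [easy|]. intros y Hy. specialize (K _ Hy).
  replace (Cexp y) with (Cexp z * Cexp (y - z)) by (rewrite <- Cexp_plus; f_equal; ring).
  replace (Cexp z * Cexp (y - z) - Cexp z - (y - z) * Cexp z)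
    with (Cexp z * (Cexp (y - z) - 1 - (y - z))) by ring.
  rewrite Cmod_mult.
  apply Rle_trans with (Cmod (Cexp z) * (eps / Cmod (Cexp z) * Cmod (y - z)))%R.
  - apply Rmult_le_compat_l; [apply Cmod_ge_0|easy].
  - right. field. lra.
Qed.

Lemma holo_Cexp z : holo Cexp z.
Proof. eexists. apply hasd_Cexp. Qed.

(** * Riemann integrals of complex-valued functions *)

Lemma rcont_continuous (f : R -> C) x :
  rcont f x -> @continuous R_UniformSpace C_R_NormedModule f x.
Proof.
  intros H P [e He]. destruct (H e (cond_pos e)) as [d [Hd K]].
  exists (mkposreal d Hd). intros y Hy. apply He.
  specialize (K y Hy). split.
  - eapply Rle_lt_trans; [apply (re_le_Cmod (f y - f x))|exact K].
  - eapply Rle_lt_trans; [apply (Im_le_Cmod (f y - f x))|exact K].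
Qed.

Lemma rcont_Re (f : R -> C) x : rcont f x -> continuous (fun t => Re (f t)) x.
Proof.
  intros H. apply (continuous_comp f fst); [now apply rcont_continuous|apply continuous_fst].
Qed.

Lemma rcont_Im (f : R -> C) x : rcont f x -> continuous (fun t => Im (f t)) x.
Proof.
  intros H. apply (continuous_comp f snd); [now apply rcont_continuous|apply continuous_snd].
Qed.

Lemma rcont_Cmod (f : R -> C) x : rcont f x -> continuous (fun t => Cmod (f t)) x.
Proof.
  intros H P [e He]. destruct (H e (cond_pos e)) as [d [Hd K]].
  exists (mkposreal d Hd). intros y Hy. apply He.
  specialize (K y Hy). apply Rabs_def1.
  - eapply Rle_lt_trans; [apply Cmod_triangle_inv|easy].
  - rewrite Cmod_sym in K. assert (Q := Cmod_triangle_inv (f x) (f y)).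
    change (- e < Cmod (f y) - Cmod (f x))%R. lra.
Qed.

Lemma rcont_RtoC_cont (g : R -> R) x : continuous g x -> rcont (fun t => RtoC (g t)) x.
Proof.
  intros H eps He.
  destruct (H (fun y => Rabs (y - g x) < eps)%R) as [d Hd].
  { exists (mkposreal eps He). intros y Hy. exact Hy. }
  exists d. split; [apply cond_pos|]. intros y Hy.
  rewrite <- RtoC_minus, Cmod_R. apply Hd. exact Hy.
Qed.

Definition CI (f : R -> C) (a b : R) : C := @RInt C_R_CompleteNormedModule f a b.

(** Continuity on the whole line rather than on the interval of integration, so that integrability
    never has to be tracked. *)
Definition allc (f : R -> C) : Prop := forall x, rcont f x.

Lemma CI_ex f a b : allc f -> @ex_RInt C_R_CompleteNormedModule f a b.
Proof.
  intros H. apply (@ex_RInt_continuous C_R_CompleteNormedModule).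
  intros x _. apply rcont_continuous, H.
Qed.

Lemma CI_correct f a b : allc f -> @is_RInt C_R_CompleteNormedModule f a b (CI f a b).
Proof. intros H. apply (@RInt_correct C_R_CompleteNormedModule). now apply CI_ex. Qed.

Lemma CI_unique f a b l : @is_RInt C_R_NormedModule f a b l -> CI f a b = l.
Proof. intros H. apply (@is_RInt_unique C_R_CompleteNormedModule). exact H. Qed.

Lemma is_RInt_pair (f : R -> C) a b (u v : R) :
  is_RInt (fun t => Re (f t)) a b u -> is_RInt (fun t => Im (f t)) a b v ->
  @is_RInt C_R_NormedModule f a b (u, v).
Proof.
  intros H K. apply (@is_RInt_fct_extend_pair R_NormedModule R_NormedModule f a b u v H K).
Qed.

Lemma ex_RInt_allR (g : R -> R) a b : (forall x, continuous g x) -> ex_RInt g a b.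
Proof. intros H. apply (@ex_RInt_continuous R_CompleteNormedModule). intros x _. apply H. Qed.

Lemma CI_pair f a b : allc f ->
  CI f a b = (RInt (fun t => Re (f t)) a b, RInt (fun t => Im (f t)) a b).
Proof.
  intros H. apply CI_unique, is_RInt_pair; apply (@RInt_correct R_CompleteNormedModule), ex_RInt_allR;
    intros x; [apply rcont_Re|apply rcont_Im]; apply H.
Qed.

Lemma CI_ext f g a b :
  (forall x, (Rmin a b < x < Rmax a b)%R -> f x = g x) -> CI f a b = CI g a b.
Proof. apply (@RInt_ext C_R_CompleteNormedModule). Qed.

Lemma CI_plus f g a b : allc f -> allc g -> CI (fun t => f t + g t) a b = CI f a b + CI g a b.
Proof. intros Hf Hg. apply (@RInt_plus C_R_CompleteNormedModule); now apply CI_ex. Qed.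

Lemma allc_scal c f : allc f -> allc (fun t => c * f t).
Proof. intros H x. apply econt_mult; [apply econt_const|apply H]. Qed.

(** The scalar is complex while the integral lives in a real module, so linearity is checked on real
    and imaginary parts. *)
Lemma CI_scal c f a b : allc f -> CI (fun t => c * f t) a b = c * CI f a b.
Proof.
  intros H. destruct c as [u v].
  assert (R1 : ex_RInt (fun t => Re (f t)) a b) by (apply ex_RInt_allR; intros x; apply rcont_Re, H).
  assert (R2 : ex_RInt (fun t => Im (f t)) a b) by (apply ex_RInt_allR; intros x; apply rcont_Im, H).
  rewrite (CI_pair f) by easy. apply CI_unique, is_RInt_pair; simpl.
  - apply (is_RInt_minus (V := R_NormedModule)); apply (is_RInt_scal (V := R_NormedModule));
      now apply (@RInt_correct R_CompleteNormedModule).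
  - apply (is_RInt_plus (V := R_NormedModule)); apply (is_RInt_scal (V := R_NormedModule));
      now apply (@RInt_correct R_CompleteNormedModule).
Qed.

Lemma CI_opp f a b : allc f -> CI (fun t => - f t) a b = - CI f a b.
Proof.
  intros H. replace (- CI f a b) with (RtoC (-1) * CI f a b) by ring. rewrite <- CI_scal by easy.
  apply CI_ext. intros; ring.
Qed.

Lemma CI_minus f g a b : allc f -> allc g -> CI (fun t => f t - g t) a b = CI f a b - CI g a b.
Proof.
  intros Hf Hg. unfold Cminus. rewrite <- CI_opp, <- CI_plus; try easy.
  intros x. apply econt_opp, Hg.
Qed.

Lemma CI_const c a b : CI (fun _ => c) a b = RtoC (b - a) * c.
Proof.
  apply CI_unique. destruct c as [u v].
  replace (RtoC (b - a) * (u, v)) with (((b - a) * u)%R, ((b - a) * v)%R)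
    by (apply Ceq; simpl; ring).
  apply is_RInt_pair; simpl; apply (@is_RInt_const R_NormedModule).
Qed.

Lemma CI_Chasles f a b c : allc f -> CI f a b + CI f b c = CI f a c.
Proof. intros H. apply (@RInt_Chasles C_R_CompleteNormedModule); now apply CI_ex. Qed.

Lemma CI_point f a : CI f a a = 0.
Proof. apply (@RInt_point C_R_CompleteNormedModule). Qed.

Lemma CI_swap f a b : allc f -> CI f b a = - CI f a b.
Proof.
  intros H. assert (E := CI_Chasles f a b a H). rewrite CI_point in E.
  replace (CI f b a) with (CI f a b + CI f b a - CI f a b) by ring. rewrite E. ring.
Qed.

Lemma CI_norm f (g : R -> R) a b : (a <= b)%R -> allc f -> (forall x, continuous g x) ->
  (forall x, (a <= x <= b)%R -> (Cmod (f x) <= g x)%R) -> (Cmod (CI f a b) <= RInt g a b)%R.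
Proof.
  intros Hab Hf Hg H. rewrite Cmod_norm.
  apply (@norm_RInt_le C_R_NormedModule f g a b); try easy.
  - intros x Hx. specialize (H x Hx). rewrite Cmod_norm in H. exact H.
  - now apply CI_correct.
  - apply (@RInt_correct R_CompleteNormedModule). now apply ex_RInt_allR.
Qed.

Lemma CI_bound f M a b : (a <= b)%R -> allc f ->
  (forall x, (a <= x <= b)%R -> (Cmod (f x) <= M)%R) -> (Cmod (CI f a b) <= M * (b - a))%R.
Proof.
  intros Hab Hf H. eapply Rle_trans.
  - apply (CI_norm f (fun _ => M)); try easy. intros x. apply continuous_const.
  - rewrite (@RInt_const R_CompleteNormedModule). unfold scal; simpl. unfold mult; simpl. lra.
Qed.

Lemma CI_bound_any f M a b : allc f ->
  (forall x, (Rmin a b <= x <= Rmax a b)%R -> (Cmod (f x) <= M)%R) ->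
  (Cmod (CI f a b) <= M * Rabs (b - a))%R.
Proof.
  intros Hf H. destruct (Rle_dec a b) as [h|h].
  - rewrite Rmin_left, Rmax_right in H by easy. rewrite Rabs_pos_eq by lra. now apply CI_bound.
  - rewrite Rmin_right, Rmax_left in H by lra. rewrite Rabs_minus_sym, Rabs_pos_eq by lra.
    rewrite CI_swap, Cmod_opp by easy. apply CI_bound; auto. lra.
Qed.

Lemma allc_lin f u v : allc f -> allc (fun t => f (u * t + v)%R).
Proof.
  intros H x eps He. destruct (H (u * x + v)%R eps He) as [d [Hd K]].
  assert (P : (0 < 1 + Rabs u)%R) by (generalize (Rabs_pos u); lra).
  exists (d / (1 + Rabs u))%R. split; [now apply Rdiv_lt_0_compat|].
  intros y Hy. apply K. unfold Rgap in *.
  replace (u * y + v - (u * x + v))%R with (u * (y - x))%R by ring. rewrite Rabs_mult.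
  apply Rlt_div_r in Hy; [|easy]. generalize (Rabs_pos u) (Rabs_pos (y - x)). nra.
Qed.

Lemma CI_comp_lin f u v a b : allc f ->
  CI (fun t => RtoC u * f (u * t + v)%R) a b = CI f (u * a + v) (u * b + v).
Proof.
  intros H. transitivity (@RInt C_R_CompleteNormedModule
    (fun y => @scal R_Ring C_R_CompleteNormedModule u (f (u * y + v)%R)) a b).
  - apply CI_ext. intros x _. now rewrite <- scal_R_Cmult.
  - apply (@RInt_comp_lin C_R_CompleteNormedModule). now apply CI_ex.
Qed.

Lemma CI_conj f a b : allc f -> CI (fun t => Cconj (f t)) a b = Cconj (CI f a b).
Proof.
  intros H. rewrite (CI_pair f) by easy. apply CI_unique.
  change (Cconj (RInt (fun t => Re (f t)) a b, RInt (fun t => Im (f t)) a b))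
    with (RInt (fun t => Re (f t)) a b, opp (RInt (fun t => Im (f t)) a b)).
  apply is_RInt_pair; simpl.
  - apply (@RInt_correct R_CompleteNormedModule), ex_RInt_allR. intros x. apply rcont_Re, H.
  - apply (@is_RInt_opp R_NormedModule).
    apply (@RInt_correct R_CompleteNormedModule), ex_RInt_allR. intros x. apply rcont_Im, H.
Qed.

Lemma CI_RtoC (g : R -> R) a b : (forall x, continuous g x) ->
  CI (fun t => RtoC (g t)) a b = RtoC (RInt g a b).
Proof.
  intros H. apply CI_unique, is_RInt_pair; simpl.
  - now apply (@RInt_correct R_CompleteNormedModule), ex_RInt_allR.
  - assert (K := @is_RInt_const R_NormedModule a b 0%R).
    rewrite (@scal_zero_r R_Ring R_ModuleSpace) in K. exact K.
Qed.

Definition cline (p v : C) (t : R) : C := p + RtoC t * v.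

Lemma cline_cont p v : allc (cline p v).
Proof.
  intros x. unfold cline. apply econt_plus; [apply econt_const|].
  apply econt_mult; [|apply econt_const]. apply rcont_RtoC_cont, continuous_id.
Qed.

Lemma allc_comp (f : C -> C) (g : R -> C) : (forall z, ccont f z) -> allc g -> allc (fun t => f (g t)).
Proof. intros Hf Hg x. apply econt_comp; auto. Qed.

(** Chain rule along a line. It serves with [v] equal to 1 or [Ci] for the sides of rectangles, and
    with a general [v] for the mean value inequality. *)
Lemma CI_FTC (g g' : C -> C) p v a b :
  (forall z, hasd g z (g' z)) -> (forall z, ccont g' z) ->
  CI (fun t => v * g' (cline p v t)) a b = g (cline p v b) - g (cline p v a).
Proof.
  intros Hg Hc. apply CI_unique.
  apply (@is_RInt_derive C_R_CompleteNormedModule (fun t => g (cline p v t))).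
  - intros x _. split; [apply is_linear_scal_l|].
    intros y Hy eps. apply (@is_filter_lim_locally_unique R_AbsRing R_NormedModule) in Hy. subst y.
    assert (P : (0 < 1 + Cmod v)%R) by (generalize (Cmod_ge_0 v); lra).
    assert (He : (0 < eps / (1 + Cmod v))%R) by (apply Rdiv_lt_0_compat; [apply cond_pos|easy]).
    destruct (proj1 (hasd_eps _ _ _) (Hg (cline p v x)) _ He) as [d [Hd K]].
    assert (Hd' : (0 < d / (1 + Cmod v))%R) by now apply Rdiv_lt_0_compat.
    exists (mkposreal _ Hd'). intros y Hy.
    assert (Hy' : (Rabs (y - x) < d / (1 + Cmod v))%R) by exact Hy. clear Hy.
    assert (E : cline p v y - cline p v x = RtoC (y - x) * v)
      by (unfold cline; rewrite RtoC_minus; ring).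
    assert (Em : Cmod (cline p v y - cline p v x) = (Rabs (y - x) * Cmod v)%R)
      by (rewrite E, Cmod_mult, Cmod_R; easy).
    assert (Q : (Rabs (y - x) * Cmod v <= Rabs (y - x) * (1 + Cmod v))%R)
      by (apply Rmult_le_compat_l; [apply Rabs_pos|lra]).
    specialize (K (cline p v y)). rewrite Em in K.
    apply Rlt_div_r in Hy'; [|easy]. specialize (K ltac:(lra)).
    match goal with |- (norm ?t <= _)%R =>
      replace (norm t) with (Cmod (g (cline p v y) - g (cline p v x)
         - (cline p v y - cline p v x) * g' (cline p v x))) end.
    + eapply Rle_trans; [exact K|].
      change (norm (minus y x)) with (Rabs (y - x)).
      apply Rle_trans with (eps / (1 + Cmod v) * (Rabs (y - x) * (1 + Cmod v)))%R.
      * apply Rmult_le_compat_l; lra.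
      * right. field. lra.
    + rewrite Cmod_norm. f_equal. rewrite E.
      rewrite (scal_R_Cmult (minus y x)).
      change (g (cline p v y) - g (cline p v x) - RtoC (y - x) * v * g' (cline p v x)
        = g (cline p v y) - g (cline p v x) - RtoC (y - x) * (v * g' (cline p v x))).
      ring.
  - intros x _. apply rcont_continuous. apply econt_mult; [apply econt_const|].
    apply econt_comp; [apply Hc|apply cline_cont].
Qed.

Ltac holo_tac :=
  cbv beta;
  lazymatch goal with
  | |- holo (fun _ => ?c) _ => apply holo_const
  | |- holo (fun z => z) _ => apply holo_id
  | |- holo (fun z => Cplus (@?f z) (@?g z)) _ => apply (holo_plus f g); holo_tac
  | |- holo (fun z => Cminus (@?f z) (@?g z)) _ => apply (holo_minus f g); holo_tac
  | |- holo (fun z => Cmult (@?f z) (@?g z)) _ => apply (holo_mult f g); holo_tac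
  | |- holo (fun z => Copp (@?f z)) _ => apply (holo_opp f); holo_tac
  | |- holo (fun z => Cexp (@?g z)) _ => apply (holo_comp Cexp g); [apply holo_Cexp|holo_tac]
  | |- _ => auto
  end.

(** * Cauchy's theorem on rectangles *)

Definition hedge (f : C -> C) (y : R) (x0 x1 : R) : C := CI (fun x => f (x, y)) x0 x1.
Definition vedge (f : C -> C) (x : R) (y0 y1 : R) : C := CI (fun y => f (x, y)) y0 y1.
(** The contour integral, counterclockwise when [x0 <= x1] and [y0 <= y1]. The corners may come in
    any order, which affects only the sign. *)
Definition rect (f : C -> C) (x0 x1 y0 y1 : R) : C :=
  hedge f y0 x0 x1 + Ci * vedge f x1 y0 y1 - hedge f y1 x0 x1 - Ci * vedge f x0 y0 y1.

Definition centire (f : C -> C) : Prop := forall z, ccont f z.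

Lemma hpoint_cont y : allc (fun x => (x, y)).
Proof.
  intros x. apply econt_ext with (cline (0%R, y) 1 );
    [intros t; unfold cline; apply Ceq; simpl; ring|apply cline_cont].
Qed.

Lemma vpoint_cont x : allc (fun y => (x, y)).
Proof.
  intros y. apply econt_ext with (cline (x, 0%R) Ci );
    [intros t; unfold cline; apply Ceq; simpl; ring|apply cline_cont].
Qed.

Lemma allc_h f y : centire f -> allc (fun x => f (x, y)).
Proof. intros H. apply (allc_comp f (fun x => (x, y))); [easy|apply hpoint_cont]. Qed.

Lemma allc_v f x : centire f -> allc (fun y => f (x, y)).
Proof. intros H. apply (allc_comp f (fun y => (x, y))); [easy|apply vpoint_cont]. Qed.

Lemma rect_split_x f x0 x1 x2 y0 y1 : centire f ->
  rect f x0 x2 y0 y1 = rect f x0 x1 y0 y1 + rect f x1 x2 y0 y1.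
Proof.
  intros H. unfold rect, hedge, vedge.
  rewrite <- (CI_Chasles (fun x => f (x, y0)) x0 x1 x2) by now apply allc_h.
  rewrite <- (CI_Chasles (fun x => f (x, y1)) x0 x1 x2) by now apply allc_h. ring.
Qed.

Lemma rect_split_y f x0 x1 y0 y1 y2 : centire f ->
  rect f x0 x1 y0 y2 = rect f x0 x1 y0 y1 + rect f x0 x1 y1 y2.
Proof.
  intros H. unfold rect, hedge, vedge.
  rewrite <- (CI_Chasles (fun y => f (x0, y)) y0 y1 y2) by now apply allc_v.
  rewrite <- (CI_Chasles (fun y => f (x1, y)) y0 y1 y2) by now apply allc_v. ring.
Qed.

Lemma rect_swap_x f x0 x1 y0 y1 : centire f -> rect f x1 x0 y0 y1 = - rect f x0 x1 y0 y1.
Proof.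
  intros H. unfold rect, hedge, vedge.
  rewrite (CI_swap (fun x => f (x, y0)) x0 x1) by now apply allc_h.
  rewrite (CI_swap (fun x => f (x, y1)) x0 x1) by now apply allc_h. ring.
Qed.

Lemma rect_swap_y f x0 x1 y0 y1 : centire f -> rect f x0 x1 y1 y0 = - rect f x0 x1 y0 y1.
Proof.
  intros H. unfold rect, hedge, vedge.
  rewrite (CI_swap (fun y => f (x0, y)) y0 y1) by now apply allc_v.
  rewrite (CI_swap (fun y => f (x1, y)) y0 y1) by now apply allc_v. ring.
Qed.

Lemma rect_minus f g x0 x1 y0 y1 : centire f -> centire g ->
  rect (fun z => f z - g z) x0 x1 y0 y1 = rect f x0 x1 y0 y1 - rect g x0 x1 y0 y1.
Proof.
  intros Hf Hg. unfold rect, hedge, vedge.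
  rewrite !(CI_minus (fun x => f (x, _)) (fun x => g (x, _))) by now apply allc_h.
  rewrite !(CI_minus (fun y => f (_, y)) (fun y => g (_, y))) by now apply allc_v. ring.
Qed.

Lemma rect_prim g f x0 x1 y0 y1 : (forall z, hasd g z (f z)) -> centire f ->
  rect f x0 x1 y0 y1 = 0.
Proof.
  intros Hg Hf.
  assert (Hh : forall y a b, hedge f y a b = g (b, y) - g (a, y)).
  { intros y a b. transitivity (CI (fun t => 1 * f (cline (0%R, y) 1 t)) a b).
    - apply CI_ext. intros x _. rewrite Cmult_1_l. f_equal. apply Ceq; simpl; ring.
    - rewrite (CI_FTC g f) by easy. f_equal; [|f_equal]; f_equal; apply Ceq; simpl; ring. }
  assert (Hv : forall x a b, Ci * vedge f x a b = g (x, b) - g (x, a)).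
  { intros x a b. unfold vedge. rewrite <- CI_scal by now apply allc_v.
    transitivity (CI (fun t => Ci * f (cline (x, 0%R) Ci t)) a b).
    - apply CI_ext. intros y _. f_equal. f_equal. apply Ceq; simpl; ring.
    - rewrite (CI_FTC g f) by easy. f_equal; [|f_equal]; f_equal; apply Ceq; simpl; ring. }
  unfold rect. rewrite !Hh, !Hv. ring.
Qed.

(** An affine function has a quadratic primitive; this is the part of [f] that Goursat's argument
    subtracts. *)
Lemma rect_affine al be p x0 x1 y0 y1 : rect (fun z => al + (z - p) * be) x0 x1 y0 y1 = 0.
Proof.
  apply (rect_prim (fun z => al * z + be / 2 * ((z - p) * (z - p)))).
  - intros z.
    replace (al + (z - p) * be) with
      ((0 * z + al * 1) +
         (0 * ((z - p) * (z - p)) + be / 2 * ((1 + 0) * (z - p) + (z - p) * (1 + 0))))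
      by (field; intros H; apply (f_equal Re) in H; simpl in H; lra).
    assert (L : hasd (fun z => z - p) z (1 + 0))
      by (apply (hasd_plus (fun z => z) (fun _ => - p)); [apply hasd_id|apply hasd_const]).
    apply (hasd_plus (fun z => al * z) (fun z => be / 2 * ((z - p) * (z - p)))).
    + apply (hasd_mult (fun _ => al) (fun z => z)); [apply hasd_const|apply hasd_id].
    + apply (hasd_mult (fun _ => be / 2) (fun z => (z - p) * (z - p))); [apply hasd_const|].
      now apply (hasd_mult (fun z => z - p) (fun z => z - p)).
  - intros z. apply econt_plus; [apply econt_const|]. apply econt_mult; [|apply econt_const].
    apply econt_minus; [apply ccont_id|apply econt_const].
Qed.

Lemma rect_bound_edges f M x0 x1 y0 y1 :
  allc (fun x => f (x, y0)) -> allc (fun x => f (x, y1)) ->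
  allc (fun y => f (x0, y)) -> allc (fun y => f (x1, y)) ->
  (forall x, (Rmin x0 x1 <= x <= Rmax x0 x1)%R ->
     (Cmod (f (x, y0)) <= M)%R /\ (Cmod (f (x, y1)) <= M)%R) ->
  (forall y, (Rmin y0 y1 <= y <= Rmax y0 y1)%R ->
     (Cmod (f (x0, y)) <= M)%R /\ (Cmod (f (x1, y)) <= M)%R) ->
  (Cmod (rect f x0 x1 y0 y1) <= M * (2 * Rabs (x1 - x0) + 2 * Rabs (y1 - y0)))%R.
Proof.
  intros F1 F2 F3 F4 H K.
  assert (A1 : (Cmod (hedge f y0 x0 x1) <= M * Rabs (x1 - x0))%R)
    by (apply CI_bound_any; [easy|intros x Hx; now apply H]).
  assert (A2 : (Cmod (hedge f y1 x0 x1) <= M * Rabs (x1 - x0))%R)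
    by (apply CI_bound_any; [easy|intros x Hx; now apply H]).
  assert (A3 : (Cmod (vedge f x0 y0 y1) <= M * Rabs (y1 - y0))%R)
    by (apply CI_bound_any; [easy|intros x Hx; now apply K]).
  assert (A4 : (Cmod (vedge f x1 y0 y1) <= M * Rabs (y1 - y0))%R)
    by (apply CI_bound_any; [easy|intros x Hx; now apply K]).
  unfold rect. eapply Rle_trans; [apply Cmod_minus_le|].
  eapply Rle_trans; [apply Rplus_le_compat_r, Cmod_minus_le|].
  eapply Rle_trans; [apply Rplus_le_compat_r, Rplus_le_compat_r, Cmod_triangle|].
  rewrite !Cmod_mult, Cmod_Ci. lra.
Qed.

Lemma rect_bound f M x0 x1 y0 y1 : centire f ->
  (forall x y, (Rmin x0 x1 <= x <= Rmax x0 x1)%R -> (Rmin y0 y1 <= y <= Rmax y0 y1)%R ->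
     (Cmod (f (x, y)) <= M)%R) ->
  (Cmod (rect f x0 x1 y0 y1) <= M * (2 * Rabs (x1 - x0) + 2 * Rabs (y1 - y0)))%R.
Proof.
  intros Hf H.
  assert (X0 := conj (Rmin_l x0 x1) (Rmax_l x0 x1)). assert (X1 := conj (Rmin_r x0 x1) (Rmax_r x0 x1)).
  assert (Y0 := conj (Rmin_l y0 y1) (Rmax_l y0 y1)). assert (Y1 := conj (Rmin_r y0 y1) (Rmax_r y0 y1)).
  apply rect_bound_edges; try (now apply allc_h); try (now apply allc_v); auto.
Qed.

(** * Goursat's subdivision argument *)

Section Goursat.
Variables (f : C -> C) (x0 y0 a b : R).
Hypothesis (Ha : (0 < a)%R) (Hb : (0 < b)%R) (Hf : centire f).
Hypothesis Hd : forall x y, (x0 <= x <= x0 + a)%R -> (y0 <= y <= y0 + b)%R -> holo f (x, y).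

Let eta := Cmod (rect f x0 (x0 + a) y0 (y0 + b)).
Let sub (n : nat) (p : C) : C :=
  rect f (Re p) (Re p + a / 2 ^ n) (Im p) (Im p + b / 2 ^ n).
Let big (n : nat) (p : C) : Prop := (eta / 4 ^ n <= Cmod (sub n p))%R.

(** The integral is the sum over four quarters, so one of them keeps at least a quarter of its
    modulus. *)
Lemma goursat_step n p : big n p -> exists p', big (S n) p' /\
  (Re p <= Re p' <= Re p + a / 2 ^ S n)%R /\ (Im p <= Im p' <= Im p + b / 2 ^ S n)%R.
Proof.
  intros H. assert (P2 : (0 < 2 ^ S n)%R) by (apply pow_lt; lra).
  assert (P4 : (0 < 4 ^ S n)%R) by (apply pow_lt; lra).
  assert (Pa : (0 < a / 2 ^ S n)%R) by now apply Rdiv_lt_0_compat.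
  assert (Pb : (0 < b / 2 ^ S n)%R) by now apply Rdiv_lt_0_compat.
  set (ha := (a / 2 ^ S n)%R) in *. set (hb := (b / 2 ^ S n)%R) in *.
  assert (Ea : (a / 2 ^ n = ha + ha)%R) by (unfold ha; simpl; field; apply pow_nonzero; lra).
  assert (Eb : (b / 2 ^ n = hb + hb)%R) by (unfold hb; simpl; field; apply pow_nonzero; lra).
  assert (E4 : (eta / 4 ^ n = 4 * (eta / 4 ^ S n))%R) by (simpl; field; apply pow_nonzero; lra).
  unfold big, sub in H. rewrite Ea, Eb, E4 in H.
  destruct p as [x y]; simpl Re in *; simpl Im in *.
  rewrite (rect_split_x f x (x + ha)) in H by easy.
  rewrite (rect_split_y f x (x + ha) y (y + hb)) in H by easy.
  rewrite (rect_split_y f (x + ha) (x + (ha + ha)) y (y + hb)) in H by easy.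
  replace (x + (ha + ha))%R with (x + ha + ha)%R in H by ring.
  replace (y + (hb + hb))%R with (y + hb + hb)%R in H by ring.
  set (r1 := rect f x (x + ha) y (y + hb)) in *.
  set (r2 := rect f x (x + ha) (y + hb) (y + hb + hb)) in *.
  set (r3 := rect f (x + ha) (x + ha + ha) y (y + hb)) in *.
  set (r4 := rect f (x + ha) (x + ha + ha) (y + hb) (y + hb + hb)) in *.
  assert (T1 := Cmod_triangle (r1 + r2) (r3 + r4)).
  assert (T2 := Cmod_triangle r1 r2). assert (T3 := Cmod_triangle r3 r4).
  unfold big, sub. fold ha hb.
  destruct (Rle_dec (eta / 4 ^ S n) (Cmod r1)) as [h|h1].
  { exists (x, y). split; [exact h|]. simpl. lra. }
  destruct (Rle_dec (eta / 4 ^ S n) (Cmod r2)) as [h|h2].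
  { exists (x, (y + hb)%R). split; [exact h|]. simpl. lra. }
  destruct (Rle_dec (eta / 4 ^ S n) (Cmod r3)) as [h|h3].
  { exists ((x + ha)%R, y). split; [exact h|]. simpl. lra. }
  exists ((x + ha)%R, (y + hb)%R). split; [|simpl; lra]. simpl Re. simpl Im. fold r4. lra.
Qed.

Lemma big_0 : big 0 (x0, y0).
Proof.
  unfold big, sub, eta. simpl Re. simpl Im. simpl pow.
  replace (a / 1)%R with a by field. replace (b / 1)%R with b by field. lra.
Qed.

(** Each chosen corner carries the lower bound in its type, since the next choice depends on that
    bound. *)
Fixpoint gseq (n : nat) : {p | big n p} :=
  match n with
  | O => exist _ (x0, y0) big_0
  | S m => let s := gseq m in
      let t := constructive_indefinite_description _ (goursat_step m (proj1_sig s) (proj2_sig s)) in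
      exist _ (proj1_sig t) (proj1 (proj2_sig t))
  end.

Lemma gseq_step n : let p := proj1_sig (gseq n) in let p' := proj1_sig (gseq (S n)) in
  (Re p <= Re p' <= Re p + a / 2 ^ S n)%R /\ (Im p <= Im p' <= Im p + b / 2 ^ S n)%R.
Proof.
  simpl. destruct (constructive_indefinite_description _ _) as [p' [H1 H2]]. exact H2.
Qed.

(** The left ends [u n] increase while the right ends [u n + c / 2 ^ n] decrease, so the supremum of
    the left ends lies in every interval. *)
Lemma nested_limit (u : nat -> R) (c : R) :
  (forall n, (u n <= u (S n) <= u n + c / 2 ^ S n)%R) ->
  exists l, forall n, (u n <= l <= u n + c / 2 ^ n)%R.
Proof.
  intros H.
  assert (I : forall n k, (u n <= u (n + k)%nat)%R).
  { intros n k. induction k; [rewrite Nat.add_0_r; lra|].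
    rewrite Nat.add_succ_r. specialize (H (n + k)%nat). lra. }
  assert (D : forall n k, (u (n + k)%nat + c / 2 ^ (n + k) <= u n + c / 2 ^ n)%R).
  { intros n k. induction k; [rewrite Nat.add_0_r; lra|].
    rewrite Nat.add_succ_r. specialize (H (n + k)%nat).
    assert (c / 2 ^ (n + k) = 2 * (c / 2 ^ S (n + k)))%R by (simpl; field; apply pow_nonzero; lra).
    lra. }
  assert (Hc : (0 <= c)%R).
  { specialize (H 0%nat). simpl in H. lra. }
  assert (Pn : forall n, (0 <= c / 2 ^ n)%R).
  { intros n. apply Rcomplements.Rdiv_le_0_compat; [easy|apply pow_lt; lra]. }
  destruct (completeness (fun r => exists n, r = u n)) as [l [L1 L2]].
  - exists (u 0%nat + c / 2 ^ 0)%R. intros r [n ->]. specialize (D 0%nat n). specialize (Pn n).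
    simpl Nat.add in D. lra.
  - exists (u 0%nat). now exists 0%nat.
  - exists l. intros n. split; [apply L1; now exists n|].
    apply L2. intros r [m ->]. destruct (Nat.le_ge_cases n m) as [h|h].
    + replace m with (n + (m - n))%nat by lia. specialize (D n (m - n)%nat).
      specialize (Pn (n + (m - n))%nat). lra.
    + specialize (I m (n - m)%nat). replace (m + (n - m))%nat with n in I by lia.
      specialize (Pn n). lra.
Qed.

Lemma pow2_large (M : R) : exists n, (M < 2 ^ n)%R.
Proof.
  destruct (Pow_x_infinity 2 ltac:(rewrite Rabs_pos_eq; lra) (M + 1)%R) as [n Hn].
  exists n. specialize (Hn n (Nat.le_refl n)).
  rewrite Rabs_pos_eq in Hn by (apply pow_le; lra). lra.
Qed.

Lemma goursat_aux : rect f x0 (x0 + a) y0 (y0 + b) = 0.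
Proof.
  apply Cmod_eq_0. fold eta.
  destruct (nested_limit (fun n => Re (proj1_sig (gseq n))) a) as [X HX];
    [intros n; apply (gseq_step n)|].
  destruct (nested_limit (fun n => Im (proj1_sig (gseq n))) b) as [Y HY];
    [intros n; apply (gseq_step n)|].
  assert (HX0 := HX 0%nat). assert (HY0 := HY 0%nat). simpl in HX0, HY0.
  destruct (Hd X Y ltac:(lra) ltac:(lra)) as [l Hl].
  assert (He0 : (0 <= eta)%R) by apply Cmod_ge_0.
  destruct (Rle_lt_or_eq_dec _ _ He0) as [Hpos|]; [exfalso|easy].
  (* This choice makes the upper bound on the [n]-th rectangle equal to half of [eta / 4 ^ n] for
     every [n], against the lower bound kept by [gseq]. *)
  set (eps := (eta / (4 * (a + b) ^ 2))%R).
  assert (Pe : (0 < eps)%R) by (apply Rdiv_lt_0_compat; nra).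
  destruct (proj1 (hasd_eps _ _ _) Hl eps Pe) as [d [Pd K]].
  destruct (pow2_large ((a + b) / d)) as [n Hn].
  assert (Q : (0 < 2 ^ n)%R) by (apply pow_lt; lra).
  assert (Hn' : ((a + b) / 2 ^ n < d)%R).
  { apply Rlt_div_l; [easy|]. apply Rlt_div_l in Hn; [|easy]. lra. }
  specialize (HX n). specialize (HY n).
  assert (B : (eta / 4 ^ n <= Cmod (sub n (proj1_sig (gseq n))))%R) by exact (proj2_sig (gseq n)).
  cbv beta in HX, HY.
  set (p := proj1_sig (gseq n)) in *. clearbody p.
  assert (Pa : (0 < a / 2 ^ n)%R) by now apply Rdiv_lt_0_compat.
  assert (Pb : (0 < b / 2 ^ n)%R) by now apply Rdiv_lt_0_compat.
  assert (Eab : ((a + b) / 2 ^ n = a / 2 ^ n + b / 2 ^ n)%R) by (field; lra).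
  assert (S4 : (4 ^ n = 2 ^ n * 2 ^ n)%R) by (rewrite <- Rpow_mult_distr; f_equal; ring).
  set (aff := fun z : C => f (X, Y) + (z - (X, Y)) * l).
  assert (Haff : centire aff).
  { intros z. apply econt_plus; [apply econt_const|]. apply econt_mult; [|apply econt_const].
    apply econt_minus; [apply ccont_id|apply econt_const]. }
  assert (E : sub n p = rect (fun z => f z - aff z) (Re p) (Re p + a / 2 ^ n) (Im p) (Im p + b / 2 ^ n)).
  { unfold sub. rewrite rect_minus by easy. unfold aff. rewrite rect_affine. ring. }
  assert (Bd : (Cmod (sub n p) <= eps * ((a + b) / 2 ^ n) * (2 * ((a + b) / 2 ^ n)))%R).
  { rewrite E. eapply Rle_trans.
    - apply rect_bound with (M := (eps * ((a + b) / 2 ^ n))%R).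
      + intros z. apply econt_minus; [apply Hf|apply Haff].
      + intros x y Hx Hy.
        rewrite Rmin_left, Rmax_right in Hx by lra. rewrite Rmin_left, Rmax_right in Hy by lra.
        assert (Dz : (Cmod ((x, y) - (X, Y)) <= (a + b) / 2 ^ n)%R).
        { eapply Rle_trans; [apply Cmod_le_Re_Im|]. simpl. rewrite Eab.
          apply Rplus_le_compat; apply Rabs_le; lra. }
        specialize (K (x, y) ltac:(lra)). unfold aff.
        replace (f (x, y) - (f (X, Y) + ((x, y) - (X, Y)) * l))
          with (f (x, y) - f (X, Y) - ((x, y) - (X, Y)) * l) by ring.
        eapply Rle_trans; [exact K|]. apply Rmult_le_compat_l; lra.
    - right. replace (Re p + a / 2 ^ n - Re p)%R with (a / 2 ^ n)%R by ring.
      replace (Im p + b / 2 ^ n - Im p)%R with (b / 2 ^ n)%R by ring.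
      rewrite !Rabs_pos_eq by lra. rewrite Eab. ring. }
  assert (F : (eps * ((a + b) / 2 ^ n) * (2 * ((a + b) / 2 ^ n)) = eta / 4 ^ n / 2)%R).
  { unfold eps. rewrite S4. field. split; lra. }
  assert (0 < eta / 4 ^ n)%R by (apply Rdiv_lt_0_compat; [easy|apply pow_lt; lra]).
  lra.
Qed.
End Goursat.

Lemma rect_point_x f x y0 y1 : rect f x x y0 y1 = 0.
Proof. unfold rect, hedge. rewrite !CI_point. ring. Qed.

Lemma rect_point_y f x0 x1 y : rect f x0 x1 y y = 0.
Proof. unfold rect, vedge. rewrite !CI_point. ring. Qed.

Lemma goursat f x0 x1 y0 y1 : centire f ->
  (forall x y, (Rmin x0 x1 <= x <= Rmax x0 x1)%R -> (Rmin y0 y1 <= y <= Rmax y0 y1)%R -> holo f (x, y)) ->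
  rect f x0 x1 y0 y1 = 0.
Proof.
  intros Hf.
  assert (Main : forall x0 x1 y0 y1, (x0 < x1)%R -> (y0 < y1)%R ->
    (forall x y, (x0 <= x <= x1)%R -> (y0 <= y <= y1)%R -> holo f (x, y)) -> rect f x0 x1 y0 y1 = 0).
  { clear x0 x1 y0 y1. intros x0 x1 y0 y1 Hx Hy H.
    assert (E := goursat_aux f x0 y0 (x1 - x0) (y1 - y0) ltac:(lra) ltac:(lra) Hf).
    replace (x0 + (x1 - x0))%R with x1 in E by ring. replace (y0 + (y1 - y0))%R with y1 in E by ring.
    now apply E. }
  assert (Main2 : forall x0 x1 y0 y1, (x0 < x1)%R ->
    (forall x y, (x0 <= x <= x1)%R -> (Rmin y0 y1 <= y <= Rmax y0 y1)%R -> holo f (x, y)) ->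
    rect f x0 x1 y0 y1 = 0).
  { clear x0 x1 y0 y1. intros x0 x1 y0 y1 Hx H.
    destruct (Rtotal_order y0 y1) as [h|[->|h]].
    - rewrite Rmin_left, Rmax_right in H by lra. now apply Main.
    - apply rect_point_y.
    - rewrite Rmin_right, Rmax_left in H by lra.
      rewrite rect_swap_y, Main by easy. ring. }
  intros H. destruct (Rtotal_order x0 x1) as [h|[->|h]].
  - rewrite Rmin_left, Rmax_right in H by lra. now apply Main2.
  - apply rect_point_x.
  - rewrite Rmin_right, Rmax_left in H by lra.
    rewrite rect_swap_x, Main2 by easy. ring.
Qed.

Lemma Rbetween_pos_part u d s : (0 < s <= 1)%R -> d <> 0%R ->
  forall x, (Rmin (u + s * d) (u + d) <= x <= Rmax (u + s * d) (u + d))%R -> x <> u.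
Proof.
  intros Hs Hd x Hx ->.
  destruct (Rlt_dec 0 d) as [h|h].
  - assert (u < Rmin (u + s * d) (u + d))%R by (apply Rmin_glb_lt; nra). lra.
  - assert (Rmax (u + s * d) (u + d) < u)%R by (apply Rmax_lub_lt; nra). lra.
Qed.

(** Everything outside a small rectangle at the corner [p] is covered by [goursat], and on the small
    rectangle [f] is bounded by continuity while the perimeter tends to 0. *)
Lemma goursat_corner f p dx dy : centire f -> (forall z, z <> p -> holo f z) ->
  rect f (Re p) (Re p + dx) (Im p) (Im p + dy) = 0.
Proof.
  intros Hf Hh. destruct p as [u v]; simpl Re; simpl Im.
  destruct (Req_dec dx 0) as [->|Nx]; [rewrite Rplus_0_r; apply rect_point_x|].
  destruct (Req_dec dy 0) as [->|Ny]; [rewrite Rplus_0_r; apply rect_point_y|].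
  assert (Shrink : forall s, (0 < s <= 1)%R ->
    rect f u (u + dx) v (v + dy) = rect f u (u + s * dx) v (v + s * dy)).
  { intros s Hs. rewrite (rect_split_x f u (u + s * dx)) by easy.
    rewrite (rect_split_y f u (u + s * dx) v (v + s * dy)) by easy.
    rewrite (goursat f u _ (v + s * dy)), (goursat f (u + s * dx)); try easy; [ring| |].
    - intros x y Hx Hy. apply Hh. intros E. injection E as -> ->.
      now apply (Rbetween_pos_part u dx s Hs Nx u).
    - intros x y Hx Hy. apply Hh. intros E. injection E as -> ->.
      now apply (Rbetween_pos_part v dy s Hs Ny v). }
  apply Cmod_small_eq. intros eps He.
  replace (rect f u (u + dx) v (v + dy) - 0) with (rect f u (u + dx) v (v + dy)) by ring.
  destruct (Hf (u, v) 1%R ltac:(lra)) as [d [Pd K]].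
  set (B := (Cmod (f (u, v)) + 1)%R). set (A := (Rabs dx + Rabs dy)%R).
  assert (PB : (1 <= B)%R) by (unfold B; generalize (Cmod_ge_0 (f (u, v))); lra).
  assert (PA : (0 < A)%R) by (unfold A; generalize (Rabs_pos_lt dx Nx) (Rabs_pos dy); lra).
  set (s := Rmin 1 (Rmin (d / (2 * A)) (eps / (2 * A * B)))).
  assert (Ps : (0 < s)%R).
  { repeat apply Rmin_pos; [lra| |]; apply Rdiv_lt_0_compat; try easy; nra. }
  assert (S1 : (s <= 1)%R) by apply Rmin_l.
  assert (S2 : (s <= d / (2 * A))%R) by (eapply Rle_trans; [apply Rmin_r|apply Rmin_l]).
  assert (S3 : (s <= eps / (2 * A * B))%R) by (eapply Rle_trans; [apply Rmin_r|apply Rmin_r]).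
  clearbody s. apply Rle_div_r in S2; [|lra]. apply Rle_div_r in S3; [|nra].
  rewrite (Shrink s) by lra. eapply Rle_trans.
  - apply rect_bound with (M := B); [easy|]. intros x y Hx Hy.
    assert (Dz : (Cmod ((x, y) - (u, v)) < d)%R).
    { eapply Rle_lt_trans; [apply Cmod_le_Re_Im|]. simpl.
      assert (Rabs (x + - u) <= s * Rabs dx)%R.
      { rewrite <- (Rabs_pos_eq s), <- Rabs_mult by lra. unfold Rmin, Rmax in Hx.
        destruct (Rle_dec u (u + s * dx)); [rewrite !Rabs_pos_eq|rewrite !Rabs_left1]; lra. }
      assert (Rabs (y + - v) <= s * Rabs dy)%R.
      { rewrite <- (Rabs_pos_eq s), <- Rabs_mult by lra. unfold Rmin, Rmax in Hy.
        destruct (Rle_dec v (v + s * dy)); [rewrite !Rabs_pos_eq|rewrite !Rabs_left1]; lra. }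
      unfold A in S2, PA. nra. }
    specialize (K (x, y) Dz). unfold B.
    assert (Q := Cmod_triangle_inv (f (x, y)) (f (u, v))). lra.
  - replace (u + s * dx - u)%R with (s * dx)%R by ring.
    replace (v + s * dy - v)%R with (s * dy)%R by ring. rewrite !Rabs_mult, !(Rabs_pos_eq s) by lra.
    unfold A in S3. nra.
Qed.

(** Cutting at [p] leaves rectangles with a corner at [p]; as corners come in any order, [p] may lie
    inside or outside. One exceptional point is what the difference quotient in Cauchy's formula
    requires. *)
Theorem cauchy_rect f p x0 x1 y0 y1 : centire f -> (forall z, z <> p -> holo f z) ->
  rect f x0 x1 y0 y1 = 0.
Proof.
  intros Hf Hh.
  assert (Cor : forall X Y, rect f (Re p) X (Im p) Y = 0).
  { intros X Y. assert (E := goursat_corner f p (X - Re p) (Y - Im p) Hf Hh).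
    replace (Re p + (X - Re p))%R with X in E by ring.
    now replace (Im p + (Y - Im p))%R with Y in E by ring. }
  rewrite (rect_split_x f x0 (Re p)) by easy.
  rewrite (rect_split_y f x0 (Re p) y0 (Im p)) by easy.
  rewrite (rect_split_y f (Re p) x1 y0 (Im p)) by easy.
  rewrite (rect_swap_x f (Re p) x0) by easy. rewrite (rect_swap_x f (Re p) x0) by easy.
  rewrite (rect_swap_y f (Re p) x0 (Im p) y0) by easy.
  rewrite (rect_swap_y f (Re p) x1 (Im p) y0) by easy. rewrite !Cor. ring.
Qed.

Definition hentire (f : C -> C) : Prop := forall z, holo f z.

Lemma hentire_centire f : hentire f -> centire f.
Proof. intros H z. apply holo_ccont, H. Qed.

Lemma cauchy_rect_entire f x0 x1 y0 y1 : hentire f -> rect f x0 x1 y0 y1 = 0.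
Proof. intros H. apply (cauchy_rect f 0); [now apply hentire_centire|auto]. Qed.

(** * Cauchy's formula and the maximum principle *)

(** Continuity along the four full lines carrying the sides: it meets the requirement of [allc] and
    holds for [/ (z - p)], which is not continuous everywhere. *)
Definition oncont (f : C -> C) (x0 x1 y0 y1 : R) : Prop :=
  allc (fun x => f (x, y0)) /\ allc (fun x => f (x, y1)) /\
  allc (fun y => f (x0, y)) /\ allc (fun y => f (x1, y)).

Definition inside (p : C) (x0 x1 y0 y1 : R) : Prop :=
  (x0 < Re p < x1)%R /\ (y0 < Im p < y1)%R.

Lemma oncont_centire f x0 x1 y0 y1 : centire f -> oncont f x0 x1 y0 y1.
Proof. intros H. repeat split; first [now apply allc_h|now apply allc_v]. Qed.

Lemma oncont_mult f g x0 x1 y0 y1 : oncont f x0 x1 y0 y1 -> oncont g x0 x1 y0 y1 ->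
  oncont (fun z => f z * g z) x0 x1 y0 y1.
Proof.
  intros [A1 [A2 [A3 A4]]] [B1 [B2 [B3 B4]]].
  repeat split; intros t; apply econt_mult; auto.
Qed.

Lemma oncont_inv p x0 x1 y0 y1 : inside p x0 x1 y0 y1 ->
  oncont (fun z => / (z - p)) x0 x1 y0 y1.
Proof.
  intros [Hx Hy].
  assert (D : forall z, ccont (fun z => z - p) z)
    by (intros z; apply econt_minus; [apply ccont_id|apply econt_const]).
  repeat split; intros t; apply econt_inv;
    try (apply (allc_h (fun z => z - p)); exact D); try (apply (allc_v (fun z => z - p)); exact D);
    intros E; [apply (f_equal Im) in E|apply (f_equal Im) in E|apply (f_equal Re) in E|apply (f_equal Re) in E];
    simpl in E; unfold Re, Im in *; lra.
Qed.

Lemma rect_minus_on f g x0 x1 y0 y1 : oncont f x0 x1 y0 y1 -> oncont g x0 x1 y0 y1 ->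
  rect (fun z => f z - g z) x0 x1 y0 y1 = rect f x0 x1 y0 y1 - rect g x0 x1 y0 y1.
Proof.
  intros [A1 [A2 [A3 A4]]] [B1 [B2 [B3 B4]]]. unfold rect, hedge, vedge.
  rewrite (CI_minus (fun x => f (x, y0)) (fun x => g (x, y0))) by easy.
  rewrite (CI_minus (fun x => f (x, y1)) (fun x => g (x, y1))) by easy.
  rewrite (CI_minus (fun y => f (x0, y)) (fun y => g (x0, y))) by easy.
  rewrite (CI_minus (fun y => f (x1, y)) (fun y => g (x1, y))) by easy. ring.
Qed.

Lemma rect_scal_on c f x0 x1 y0 y1 : oncont f x0 x1 y0 y1 ->
  rect (fun z => c * f z) x0 x1 y0 y1 = c * rect f x0 x1 y0 y1.
Proof.
  intros [A1 [A2 [A3 A4]]]. unfold rect, hedge, vedge.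
  rewrite (CI_scal c (fun x => f (x, y0))) by easy.
  rewrite (CI_scal c (fun x => f (x, y1))) by easy.
  rewrite (CI_scal c (fun y => f (x0, y))) by easy.
  rewrite (CI_scal c (fun y => f (x1, y))) by easy. ring.
Qed.

Definition onedge (z : C) (x0 x1 y0 y1 : R) : Prop :=
  ((x0 <= Re z <= x1)%R /\ (Im z = y0 \/ Im z = y1)) \/
  ((y0 <= Im z <= y1)%R /\ (Re z = x0 \/ Re z = x1)).

Lemma rect_ext_on f g x0 x1 y0 y1 : (x0 <= x1)%R -> (y0 <= y1)%R ->
  (forall z, onedge z x0 x1 y0 y1 -> f z = g z) -> rect f x0 x1 y0 y1 = rect g x0 x1 y0 y1.
Proof.
  intros Hx Hy H. unfold rect, hedge, vedge.
  rewrite (CI_ext (fun x => f (x, y0)) (fun x => g (x, y0))),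
    (CI_ext (fun x => f (x, y1)) (fun x => g (x, y1))),
    (CI_ext (fun y => f (x0, y)) (fun y => g (x0, y))),
    (CI_ext (fun y => f (x1, y)) (fun y => g (x1, y))); [easy| | | |];
    intros t Ht; rewrite Rmin_left, Rmax_right in Ht by easy; apply H; unfold onedge; simpl; lra.
Qed.

Lemma rect_bound_on f M x0 x1 y0 y1 : (x0 <= x1)%R -> (y0 <= y1)%R -> oncont f x0 x1 y0 y1 ->
  (forall z, onedge z x0 x1 y0 y1 -> (Cmod (f z) <= M)%R) ->
  (Cmod (rect f x0 x1 y0 y1) <= M * (2 * (x1 - x0) + 2 * (y1 - y0)))%R.
Proof.
  intros Hx Hy [A1 [A2 [A3 A4]]] H.
  rewrite <- (Rabs_pos_eq (x1 - x0)), <- (Rabs_pos_eq (y1 - y0)) by lra.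
  apply rect_bound_edges; try easy; rewrite Rmin_left, Rmax_right by easy;
    intros t Ht; split; apply H; unfold onedge; simpl; lra.
Qed.

Lemma inside_dist p x0 x1 y0 y1 : inside p x0 x1 y0 y1 -> exists d, (0 < d)%R /\
  forall z, onedge z x0 x1 y0 y1 -> (d <= Cmod (z - p))%R.
Proof.
  intros [Hx Hy].
  exists (Rmin (Rmin (Re p - x0) (x1 - Re p)) (Rmin (Im p - y0) (y1 - Im p))).
  split; [repeat apply Rmin_pos; lra|]. intros z Hz.
  assert (A := re_le_Cmod (z - p)). assert (B := Im_le_Cmod (z - p)).
  change (Re (z - p)) with (Re z - Re p)%R in A. change (Im (z - p)) with (Im z - Im p)%R in B.
  set (m := Rmin _ _).
  assert (M1 : (m <= Re p - x0)%R) by (eapply Rle_trans; [apply Rmin_l|apply Rmin_l]).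
  assert (M2 : (m <= x1 - Re p)%R) by (eapply Rle_trans; [apply Rmin_l|apply Rmin_r]).
  assert (M3 : (m <= Im p - y0)%R) by (eapply Rle_trans; [apply Rmin_r|apply Rmin_l]).
  assert (M4 : (m <= y1 - Im p)%R) by (eapply Rle_trans; [apply Rmin_r|apply Rmin_r]).
  destruct Hz as [[_ [E|E]]|[_ [E|E]]]; rewrite E in *.
  - rewrite Rabs_left in B by lra. lra.
  - rewrite Rabs_pos_eq in B by lra. lra.
  - rewrite Rabs_left in A by lra. lra.
  - rewrite Rabs_pos_eq in A by lra. lra.
Qed.

Lemma inside_le p x0 x1 y0 y1 : inside p x0 x1 y0 y1 -> (x0 <= x1)%R /\ (y0 <= y1)%R.
Proof. unfold inside. lra. Qed.

Lemma onedge_neq p z x0 x1 y0 y1 : inside p x0 x1 y0 y1 -> onedge z x0 x1 y0 y1 -> z - p <> 0.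
Proof.
  intros Hp Hz. destruct (inside_dist _ _ _ _ _ Hp) as [d [Hd K]].
  apply Cmod_gt_0. specialize (K z Hz). lra.
Qed.

(** The difference quotient of [f] at [p] is continuous everywhere and holomorphic off [p], so its
    contour integral vanishes. The integral of [/ (z - p)] is left unevaluated, because most
    applications need only that it is nonzero. *)
Theorem cauchy_formula f p x0 x1 y0 y1 : hentire f -> inside p x0 x1 y0 y1 ->
  rect (fun z => f z * / (z - p)) x0 x1 y0 y1 = f p * rect (fun z => / (z - p)) x0 x1 y0 y1.
Proof.
  intros Hf Hp. destruct (Hf p) as [l [q [H1 [H2 H3]]]].
  assert (Hq : forall z, z <> p -> holo q z).
  { intros z Hz.
    assert (K : holo (fun y => (f y - f p) * / (y - p)) z).
    { apply holo_mult; [apply holo_minus; [apply Hf|apply holo_const]|].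
      apply holo_inv; [now apply Cminus_eq_contra|]. apply holo_minus; [apply holo_id|apply holo_const]. }
    destruct K as [m K]. exists m. revert K. apply hasd_local.
    exists (Cmod (z - p)). split; [apply Cmod_gt_0; now apply Cminus_eq_contra|].
    intros y Hy.
    assert (y - p <> 0).
    { intros E. replace (y - z) with ((y - p) - (z - p)) in Hy by ring.
      rewrite E in Hy. replace (0 - (z - p)) with (- (z - p)) in Hy by ring.
      rewrite Cmod_opp in Hy. lra. }
    rewrite (H3 y). field. easy. }
  assert (Cq : centire q).
  { intros z. destruct (excluded_middle_informative (z = p)) as [->|N]; [easy|].
    apply holo_ccont. auto. }
  destruct (inside_le _ _ _ _ _ Hp) as [Hx Hy].
  assert (Oi := oncont_inv p x0 x1 y0 y1 Hp).
  assert (Of := oncont_centire f x0 x1 y0 y1 (hentire_centire f Hf)).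
  assert (E := cauchy_rect q p x0 x1 y0 y1 Cq Hq).
  rewrite (rect_ext_on q (fun z => f z * / (z - p) - f p * / (z - p))) in E; try easy.
  2: { intros z Hz. rewrite (H3 z). field. now apply (onedge_neq p z x0 x1 y0 y1). }
  rewrite (rect_minus_on (fun z => f z * / (z - p)) (fun z => f p * / (z - p))) in E.
  2: now apply oncont_mult.
  2: { apply (oncont_mult (fun _ => f p)); [|easy]. apply oncont_centire. intros z. apply econt_const. }
  rewrite rect_scal_on in E by easy.
  now apply Ceq_minus in E.
Qed.

Lemma sum_sq_pos (a b : R) : (a <> 0 \/ b <> 0)%R -> (0 < a * (a * 1) + b * (b * 1))%R.
Proof. intros [H|H]; apply Rsqr_pos_lt in H; unfold Rsqr in H; nra. Qed.

(** Each of the four sides contributes a positive amount, by the sign of its integrand. This avoids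
    computing the integral for a general rectangle; its value is found only for squares. *)
Lemma winding_pos p x0 x1 y0 y1 : inside p x0 x1 y0 y1 ->
  (0 < Im (rect (fun z => (/ (z - p))%C) x0 x1 y0 y1))%R.
Proof.
  intros Hp. assert (O := oncont_inv _ _ _ _ _ Hp). destruct O as [O1 [O2 [O3 O4]]].
  destruct p as [u v]. destruct Hp as [Hx Hy]; simpl in Hx, Hy.
  unfold rect, hedge, vedge.
  rewrite !CI_pair by easy.
  set (A := RInt (fun t => Im (Cinv ((t, y0) - (u, v)))) x0 x1).
  set (B := RInt (fun t => Re (Cinv ((x1, t) - (u, v)))) y0 y1).
  set (A' := RInt (fun t => Im (Cinv ((t, y1) - (u, v)))) x0 x1).
  set (B' := RInt (fun t => Re (Cinv ((x0, t) - (u, v)))) y0 y1).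
  assert (PA : (0 < A)%R).
  { apply RInt_gt_0; [lra| |intros; apply rcont_Im, O1].
    intros x _. simpl. apply Rdiv_lt_0_compat; [lra|apply sum_sq_pos; lra]. }
  assert (PB : (0 < B)%R).
  { apply RInt_gt_0; [lra| |intros; apply rcont_Re, O4].
    intros x _. simpl. apply Rdiv_lt_0_compat; [lra|apply sum_sq_pos; lra]. }
  assert (PA' : (A' < 0)%R).
  { cut (0 < - A')%R; [lra|]. unfold A'. rewrite <- (@RInt_opp R_CompleteNormedModule)
      by (apply ex_RInt_allR; intros; apply rcont_Im, O2).
    apply RInt_gt_0; [lra| |intros; apply (@continuous_opp R_UniformSpace R_AbsRing R_NormedModule), rcont_Im, O2].
    intros x _. unfold opp; simpl. rewrite Rdiv_opp_l, Ropp_involutive.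
    apply Rdiv_lt_0_compat; [lra|apply sum_sq_pos; lra]. }
  assert (PB' : (B' < 0)%R).
  { cut (0 < - B')%R; [lra|]. unfold B'. rewrite <- (@RInt_opp R_CompleteNormedModule)
      by (apply ex_RInt_allR; intros; apply rcont_Re, O3).
    apply RInt_gt_0; [lra| |intros; apply (@continuous_opp R_UniformSpace R_AbsRing R_NormedModule), rcont_Re, O3].
    intros x _. unfold opp; simpl. rewrite <- Rdiv_opp_l.
    apply Rdiv_lt_0_compat; [lra|apply sum_sq_pos; lra]. }
  simpl. lra.
Qed.

Lemma winding_nz p x0 x1 y0 y1 : inside p x0 x1 y0 y1 ->
  rect (fun z => / (z - p)) x0 x1 y0 y1 <> 0.
Proof. intros H E. assert (P := winding_pos _ _ _ _ _ H). rewrite E in P. simpl in P. lra. Qed.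

Lemma bounded_powers (r K : R) : (forall n, (r ^ n <= K)%R) -> (r <= 1)%R.
Proof.
  intros H. destruct (Rle_lt_dec r 1) as [|h]; [easy|exfalso].
  destruct (Pow_x_infinity r ltac:(rewrite Rabs_pos_eq; lra) (K + 1)%R) as [n Hn].
  specialize (Hn n (Nat.le_refl n)). specialize (H n).
  rewrite Rabs_pos_eq in Hn by (apply pow_le; lra). lra.
Qed.

(* Applying Cauchy's formula to the powers of [f] makes the constant in the trivial
   estimate disappear. *)
Theorem maximum_modulus f M p x0 x1 y0 y1 : hentire f -> inside p x0 x1 y0 y1 -> (0 < M)%R ->
  (forall z, onedge z x0 x1 y0 y1 -> (Cmod (f z) <= M)%R) -> (Cmod (f p) <= M)%R.
Proof.
  intros Hf Hp HM H.
  destruct (inside_dist _ _ _ _ _ Hp) as [d [Hd K]].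
  destruct (inside_le _ _ _ _ _ Hp) as [Hx Hy].
  set (I := rect (fun z => / (z - p)) x0 x1 y0 y1).
  assert (PosI : (0 < Cmod I)%R) by (apply Cmod_gt_0; now apply winding_nz).
  set (L := (2 * (x1 - x0) + 2 * (y1 - y0))%R).
  assert (Hr : (Cmod (f p) / M <= 1)%R).
  { apply bounded_powers with (/ d * L / Cmod I)%R. intros n.
    assert (Hn : hentire (fun z => f z ^ n)) by (intros z; apply holo_pow, Hf).
    assert (E := cauchy_formula _ p x0 x1 y0 y1 Hn Hp). fold I in E. cbv beta in E.
    assert (B : (Cmod (f p ^ n * I) <= M ^ n * / d * L)%R).
    { rewrite <- E. apply rect_bound_on; try easy.
      - apply oncont_mult; [apply oncont_centire; now apply hentire_centire|now apply oncont_inv].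
      - intros z Hz. assert (N := onedge_neq _ _ _ _ _ _ Hp Hz).
        rewrite Cmod_mult, Cmod_pow, Cmod_inv by easy.
        apply Rmult_le_compat.
        + apply pow_le, Cmod_ge_0.
        + apply Rlt_le, Rinv_0_lt_compat. now apply Cmod_gt_0.
        + apply pow_incr. split; [apply Cmod_ge_0|auto].
        + apply Rinv_le_contravar; auto. }
    rewrite Cmod_mult, Cmod_pow in B.
    assert (PM : (0 < M ^ n)%R) by now apply pow_lt.
    replace ((Cmod (f p) / M) ^ n)%R with (Cmod (f p) ^ n * / M ^ n)%R
      by (unfold Rdiv; rewrite Rpow_mult_distr, pow_inv; ring).
    apply (proj1 (Rle_div_r _ _ _ PosI)). apply (Rmult_le_reg_l (M ^ n)); [easy|].
    replace (M ^ n * (Cmod (f p) ^ n * / M ^ n * Cmod I))%R with (Cmod (f p) ^ n * Cmod I)%R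
      by (field; lra). lra. }
  apply Rle_div_l in Hr; lra.
Qed.

Lemma atan_RInt u r : (0 < r)%R ->
  RInt (fun x => 2 * r / (r * r + (x - u) * (x - u)))%R (u - r) (u + r) = PI.
Proof.
  intros Hr. apply (@is_RInt_unique R_CompleteNormedModule).
  replace PI with (minus (2 * atan ((u + r - u) / r)) (2 * atan ((u - r - u) / r)))%R.
  2: { replace ((u + r - u) / r)%R with 1%R by (field; lra).
       replace ((u - r - u) / r)%R with (-(1))%R by (field; lra).
       rewrite atan_opp, atan_1. unfold minus, plus, opp; simpl. field. }
  apply (is_RInt_derive (V := R_CompleteNormedModule) (fun x => 2 * atan ((x - u) / r))%R).
  - intros x _. auto_derive; [easy|]. assert (Q := Rle_0_sqr (x - u)). unfold Rsqr in Q. field. split; nra.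
  - intros x _. apply (ex_derive_continuous (V := R_NormedModule)). auto_derive.
    assert (Q := Rle_0_sqr (x - u)). unfold Rsqr in Q. nra.
Qed.

(** For a square centred at [p] the two pairs of opposite sides combine into the same arctangent
    integral, whose value is pi. *)
Lemma winding_square p r : (0 < r)%R ->
  rect (fun z => / (z - p)) (Re p - r) (Re p + r) (Im p - r) (Im p + r) = 2 * piC * Ci.
Proof.
  intros Hr. destruct p as [u v]; simpl Re; simpl Im.
  assert (Hp : inside (u, v) (u - r) (u + r) (v - r) (v + r)) by (unfold inside; simpl; lra).
  destruct (oncont_inv _ _ _ _ _ Hp) as [O1 [O2 [O3 O4]]].
  assert (Cc : forall w x, continuous (fun x => 2 * r / (r * r + (x - w) * (x - w)))%R x).
  { intros w x. apply (ex_derive_continuous (V := R_NormedModule)). auto_derive.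
    assert (Q := Rle_0_sqr (x - w)). unfold Rsqr in Q. nra. }
  assert (H1 : hedge (fun z => / (z - (u, v))) (v - r) (u - r) (u + r)
               - hedge (fun z => / (z - (u, v))) (v + r) (u - r) (u + r) = Ci * piC).
  { unfold hedge. rewrite <- CI_minus by easy.
    transitivity (CI (fun x => Ci * RtoC (2 * r / (r * r + (x - u) * (x - u)))) (u - r) (u + r)).
    - apply CI_ext. intros x _. assert (Q := Rle_0_sqr (x - u)). unfold Rsqr in Q. apply Ceq; simpl; field; repeat split; nra.
    - rewrite CI_scal by (intros x; apply rcont_RtoC_cont, Cc).
      rewrite CI_RtoC by apply Cc. now rewrite atan_RInt. }
  assert (H2 : vedge (fun z => / (z - (u, v))) (u + r) (v - r) (v + r)
               - vedge (fun z => / (z - (u, v))) (u - r) (v - r) (v + r) = piC).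
  { unfold vedge. rewrite <- CI_minus by easy.
    transitivity (CI (fun x => RtoC (2 * r / (r * r + (x - v) * (x - v)))) (v - r) (v + r)).
    - apply CI_ext. intros x _. assert (Q := Rle_0_sqr (x - v)). unfold Rsqr in Q. apply Ceq; simpl; field; repeat split; nra.
    - rewrite CI_RtoC by apply Cc. now rewrite atan_RInt. }
  unfold rect.
  match goal with |- ?a + Ci * ?b - ?c - Ci * ?e = _ =>
    replace (a + Ci * b - c - Ci * e) with ((a - c) + Ci * (b - e)) by ring end.
  rewrite H1, H2. ring.
Qed.

(** * Primitives and locally uniform limits *)

(** The integral along the path from 0 that runs first horizontally and then vertically. It is the
    primitive through which averages of [F] over windows are seen to be entire. *)
Definition prim (f : C -> C) (z : C) : C :=
  hedge f 0 0 (Re z) + Ci * vedge f (Re z) 0 (Im z).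

(** Cauchy's theorem on the rectangle between the real axis and height [Im z] replaces the two paths
    from 0 by a short one from [z] to [z']. *)
Lemma prim_diff f z z' : hentire f ->
  prim f z' - prim f z = hedge f (Im z) (Re z) (Re z') + Ci * vedge f (Re z') (Im z) (Im z').
Proof.
  intros Hf. assert (Cf := hentire_centire f Hf).
  assert (E := cauchy_rect_entire f (Re z) (Re z') 0 (Im z) Hf).
  unfold rect in E. unfold prim.
  assert (E1 : hedge f 0 0 (Re z') = hedge f 0 0 (Re z) + hedge f 0 (Re z) (Re z')).
  { unfold hedge. symmetry. apply CI_Chasles. now apply allc_h. }
  assert (E2 : vedge f (Re z') 0 (Im z') = vedge f (Re z') 0 (Im z) + vedge f (Re z') (Im z) (Im z')).
  { unfold vedge. symmetry. apply CI_Chasles. now apply allc_v. }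
  rewrite E1, E2.
  match goal with |- ?l = ?r => replace l with (l - 0) by ring; rewrite <- E end. ring.
Qed.

Lemma hasd_prim f z : hentire f -> hasd (prim f) z (f z).
Proof.
  intros Hf. assert (Cf := hentire_centire f Hf). apply hasd_eps. intros eps He.
  destruct (Cf z (eps / 2)%R ltac:(lra)) as [d [Hd K]].
  exists (d / 2)%R. split; [lra|]. intros z' Hz'. rewrite prim_diff by easy.
  assert (A := re_le_Cmod (z' - z)). assert (B := Im_le_Cmod (z' - z)).
  change (Re (z' - z)) with (Re z' - Re z)%R in A. change (Im (z' - z)) with (Im z' - Im z)%R in B.
  assert (Near : forall w, (Rabs (Re w - Re z) + Rabs (Im w - Im z) < d)%R ->
    (Cmod (f w - f z) <= eps / 2)%R).
  { intros w Hw. apply Rlt_le, K. unfold Cgap. eapply Rle_lt_trans; [apply Cmod_le_Re_Im|]. exact Hw. }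
  assert (Btw : forall s t x, (Rmin s t <= x <= Rmax s t)%R -> (Rabs (x - s) <= Rabs (t - s))%R).
  { intros s t x. unfold Rmin, Rmax. destruct (Rle_dec s t); intros H;
      [rewrite !Rabs_pos_eq|rewrite !Rabs_left1]; lra. }
  replace (hedge f (Im z) (Re z) (Re z') + Ci * vedge f (Re z') (Im z) (Im z') - (z' - z) * f z)
    with (CI (fun x => f (x, Im z) - f z) (Re z) (Re z')
          + Ci * CI (fun y => f (Re z', y) - f z) (Im z) (Im z')).
  - eapply Rle_trans; [apply Cmod_triangle|]. rewrite Cmod_mult, Cmod_Ci, Rmult_1_l.
    assert (P1 : (Cmod (CI (fun x => (f (x, Im z) - f z)%C) (Re z) (Re z')) <= eps / 2 * Rabs (Re z' - Re z))%R).
    { apply CI_bound_any.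
      - intros x. apply econt_minus; [now apply (allc_h f)|apply econt_const].
      - intros x Hx. apply Btw in Hx. apply Near. simpl. rewrite (Rminus_diag (Im z)), Rabs_R0. lra. }
    assert (P2 : (Cmod (CI (fun y => (f (Re z', y) - f z)%C) (Im z) (Im z')) <= eps / 2 * Rabs (Im z' - Im z))%R).
    { apply CI_bound_any.
      - intros x. apply econt_minus; [now apply (allc_v f)|apply econt_const].
      - intros x Hx. apply Btw in Hx. apply Near. simpl. lra. }
    nra.
  - rewrite (CI_minus (fun x => f (x, Im z)) (fun _ => f z)), (CI_minus (fun y => f (Re z', y)) (fun _ => f z));
      try (now apply allc_h); try (now apply allc_v); try (intros x; apply econt_const).
    rewrite !CI_const. unfold hedge, vedge.
    replace (z' - z) with (RtoC (Re z' - Re z) + Ci * RtoC (Im z' - Im z))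
      by (apply Ceq; simpl; unfold Re, Im; ring). ring.
Qed.

Lemma inside_near p x0 x1 y0 y1 : inside p x0 x1 y0 y1 -> exists d, (0 < d)%R /\
  forall p', (Cmod (p' - p) < d)%R -> inside p' x0 x1 y0 y1 /\
    forall z, onedge z x0 x1 y0 y1 -> (d <= Cmod (z - p'))%R /\ (d <= Cmod (z - p))%R.
Proof.
  intros Hp. destruct (inside_dist _ _ _ _ _ Hp) as [d [Hd K]]. destruct Hp as [Hx Hy].
  set (m := Rmin (Rmin (Re p - x0) (x1 - Re p)) (Rmin (Im p - y0) (y1 - Im p))).
  assert (Pm : (0 < m)%R) by (repeat apply Rmin_pos; lra).
  assert (M1 : (m <= Re p - x0)%R) by (eapply Rle_trans; [apply Rmin_l|apply Rmin_l]).
  assert (M2 : (m <= x1 - Re p)%R) by (eapply Rle_trans; [apply Rmin_l|apply Rmin_r]).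
  assert (M3 : (m <= Im p - y0)%R) by (eapply Rle_trans; [apply Rmin_r|apply Rmin_l]).
  assert (M4 : (m <= y1 - Im p)%R) by (eapply Rle_trans; [apply Rmin_r|apply Rmin_r]).
  clearbody m.
  exists (Rmin m (d / 2)). split; [apply Rmin_pos; lra|]. intros p' Hp'.
  assert (N1 := Rmin_l m (d / 2)). assert (N2 := Rmin_r m (d / 2)).
  split.
  - assert (A := re_le_Cmod (p' - p)). assert (B := Im_le_Cmod (p' - p)).
    change (Re (p' - p)) with (Re p' - Re p)%R in A. change (Im (p' - p)) with (Im p' - Im p)%R in B.
    assert (A' : (Rabs (Re p' - Re p) < m)%R) by lra. assert (B' : (Rabs (Im p' - Im p) < m)%R) by lra.
    apply Rabs_def2 in A'. apply Rabs_def2 in B'. unfold inside. lra.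
  - intros z Hz. specialize (K z Hz). split; [|lra].
    assert (T := Cmod_triangle_inv (z - p) (p' - p)).
    replace (z - p - (p' - p)) with (z - p') in T by ring. lra.
Qed.

(** Differentiation under the integral: the first order expansion of 1/(z - p) at [p] has the exact
    error (p' - p)^2 / ((z - p)^2 (z - p')), which is uniformly of second order on the edges. *)
Lemma cauchy_integral_holo g p x0 x1 y0 y1 : centire g -> inside p x0 x1 y0 y1 ->
  (exists M, forall z, onedge z x0 x1 y0 y1 -> (Cmod (g z) <= M)%R) ->
  holo (fun p => rect (fun z => g z * / (z - p)) x0 x1 y0 y1) p.
Proof.
  intros Hg Hp [M HM]. destruct (inside_near _ _ _ _ _ Hp) as [d [Hd K]].
  destruct (inside_le _ _ _ _ _ Hp) as [Hx Hy].
  assert (Og := oncont_centire g x0 x1 y0 y1 Hg). assert (Oi := oncont_inv _ _ _ _ _ Hp).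
  exists (rect (fun z => g z * / (z - p) * / (z - p)) x0 x1 y0 y1).
  apply hasd_eps. intros eps He.
  set (B := (Rabs M * / d * / d * / d)%R). set (L := (2 * (x1 - x0) + 2 * (y1 - y0))%R).
  assert (PB : (0 <= B)%R).
  { assert (0 < / d)%R by now apply Rinv_0_lt_compat.
    unfold B. repeat apply Rmult_le_pos; try lra. apply Rabs_pos. }
  assert (PL : (0 <= L)%R) by (unfold L; lra).
  assert (P1 : (0 < 1 + B * L)%R) by nra.
  exists (Rmin d (eps / (1 + B * L))). split; [apply Rmin_pos; [easy|now apply Rdiv_lt_0_compat]|].
  intros p' Hp'. assert (N1 := Rmin_l d (eps / (1 + B * L))). assert (N2 := Rmin_r d (eps / (1 + B * L))).
  destruct (K p' ltac:(lra)) as [Ip' Kd]. assert (Oi' := oncont_inv _ _ _ _ _ Ip').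
  assert (E : rect (fun z => g z * / (z - p')) x0 x1 y0 y1 - rect (fun z => g z * / (z - p)) x0 x1 y0 y1
     - (p' - p) * rect (fun z => g z * / (z - p) * / (z - p)) x0 x1 y0 y1
     = (p' - p) * (p' - p) * rect (fun z => g z * / (z - p) * / (z - p) * / (z - p')) x0 x1 y0 y1).
  { rewrite <- !rect_scal_on, <- !rect_minus_on; repeat apply oncont_mult; try easy;
      try (apply oncont_centire; intros z; apply econt_const).
    - apply rect_ext_on; try easy. intros z Hz. field.
      split; eapply onedge_neq; eauto.
    - repeat split; intros t; apply econt_minus; apply econt_mult; first [apply Og|apply Oi'|apply Oi]. }
  rewrite E, !Cmod_mult.
  assert (Bd : (Cmod (rect (fun z => (g z * / (z - p) * / (z - p) * / (z - p'))%C) x0 x1 y0 y1) <= B * L)%R).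
  { apply rect_bound_on; try easy; [repeat apply oncont_mult; easy|].
    intros z Hz. destruct (Kd z Hz) as [D1 D2].
    rewrite !Cmod_mult, !Cmod_inv by (apply Cmod_gt_0; lra). unfold B.
    assert (0 < / Cmod (z - p))%R by (apply Rinv_0_lt_compat; lra).
    assert (0 < / Cmod (z - p'))%R by (apply Rinv_0_lt_compat; lra).
    assert (/ Cmod (z - p) <= / d)%R by (apply Rinv_le_contravar; lra).
    assert (/ Cmod (z - p') <= / d)%R by (apply Rinv_le_contravar; lra).
    assert (Cmod (g z) <= Rabs M)%R by (eapply Rle_trans; [now apply HM|apply Rle_abs]).
    assert (0 <= Cmod (g z))%R by apply Cmod_ge_0.
    repeat apply Rmult_le_compat; try lra; repeat apply Rmult_le_pos; lra. }
  assert (Hs : (Cmod (p' - p) <= eps / (1 + B * L))%R) by lra.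
  apply Rle_div_r in Hs; [|easy].
  assert (C0 := Cmod_ge_0 (p' - p)). set (c := Cmod (p' - p)) in *.
  assert (c * c * Cmod (rect (fun z => (g z * / (z - p) * / (z - p) * / (z - p'))%C) x0 x1 y0 y1) <= c * c * (B * L))%R
    by (apply Rmult_le_compat_l; [nra|easy]).
  assert (c * (c * (B * L)) <= c * eps)%R by (apply Rmult_le_compat_l; nra). lra.
Qed.

Definition lunif (fn : nat -> C -> C) (f : C -> C) : Prop :=
  forall r eps, (0 < eps)%R -> exists N, forall n z, (N <= n)%nat -> (Cmod z <= r)%R ->
    (Cmod (fn n z - f z) <= eps)%R.

Lemma lunif_centire fn f : (forall n, centire (fn n)) -> lunif fn f -> centire f.
Proof.
  intros Hn Hl z eps He. destruct (Hl (Cmod z + 1)%R (eps / 4)%R ltac:(lra)) as [N HN].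
  destruct (Hn N z (eps / 4)%R ltac:(lra)) as [d [Hd K]].
  exists (Rmin d 1). split; [apply Rmin_pos; lra|]. intros y Hy. unfold Cgap in Hy.
  assert (N1 := Rmin_l d 1). assert (N2 := Rmin_r d 1).
  assert (Cmod y <= Cmod z + 1)%R by (assert (T := Cmod_triangle_inv y z); lra).
  assert (A := HN N y (Nat.le_refl N) ltac:(lra)). assert (B := HN N z (Nat.le_refl N) ltac:(lra)).
  specialize (K y ltac:(unfold Cgap; lra)).
  replace (f y - f z) with ((fn N y - fn N z) - (fn N y - f y) + (fn N z - f z)) by ring.
  assert (T1 := Cmod_triangle ((fn N y - fn N z) - (fn N y - f y)) (fn N z - f z)).
  assert (T2 := Cmod_minus_le (fn N y - fn N z) (fn N y - f y)). lra.
Qed.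

(** Cauchy's formula survives the limit, so near [z0] the limit is the quotient of two Cauchy
    integrals, both holomorphic in [p]. Dividing by the integral of 1/(z - p) avoids knowing that it
    is constant. *)
Theorem lunif_hentire fn f : (forall n, hentire (fn n)) -> lunif fn f -> hentire f.
Proof.
  intros Hn Hl z0.
  assert (Cf : centire f) by (apply (lunif_centire fn); [intros n; now apply hentire_centire|easy]).
  set (x0 := (Re z0 - 1)%R). set (x1 := (Re z0 + 1)%R). set (y0 := (Im z0 - 1)%R). set (y1 := (Im z0 + 1)%R).
  assert (H0 : inside z0 x0 x1 y0 y1) by (unfold inside, x0, x1, y0, y1; lra).
  assert (Hx : (x0 <= x1)%R) by (unfold x0, x1; lra). assert (Hy : (y0 <= y1)%R) by (unfold y0, y1; lra).
  assert (Rb : forall z, onedge z x0 x1 y0 y1 -> (Cmod z <= Cmod z0 + 2)%R).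
  { intros z Hz. assert (T := Cmod_triangle_inv z z0). assert (T2 := Cmod_le_Re_Im (z - z0)).
    change (Re (z - z0)) with (Re z - Re z0)%R in T2. change (Im (z - z0)) with (Im z - Im z0)%R in T2.
    assert (Rabs (Re z - Re z0) <= 1 /\ Rabs (Im z - Im z0) <= 1)%R.
    { unfold onedge, x0, x1, y0, y1 in Hz. split; apply Rabs_le; lra. }
    lra. }
  assert (Form : forall p, inside p x0 x1 y0 y1 ->
    rect (fun z => f z * / (z - p)) x0 x1 y0 y1 = f p * rect (fun z => / (z - p)) x0 x1 y0 y1).
  { intros p Hp. destruct (inside_dist _ _ _ _ _ Hp) as [d [Hd K]].
    assert (Oi := oncont_inv _ _ _ _ _ Hp).
    set (I := rect (fun z => / (z - p)) x0 x1 y0 y1). apply Cmod_small_eq. intros eps He.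
    set (A := (/ d * (2 * (x1 - x0) + 2 * (y1 - y0)) + Cmod I)%R).
    assert (PA : (0 <= A)%R).
    { unfold A. assert (0 < / d)%R by now apply Rinv_0_lt_compat. generalize (Cmod_ge_0 I). nra. }
    destruct (Hl (Cmod z0 + 2 + Cmod p)%R (eps / (1 + A))%R) as [N HN]; [apply Rdiv_lt_0_compat; lra|].
    assert (E := cauchy_formula (fn N) p x0 x1 y0 y1 (Hn N) Hp). fold I in E.
    assert (Cn := hentire_centire _ (Hn N)).
    replace (rect (fun z => f z * / (z - p)) x0 x1 y0 y1 - f p * I)
      with ((fn N p - f p) * I - (rect (fun z => fn N z * / (z - p)) x0 x1 y0 y1
              - rect (fun z => f z * / (z - p)) x0 x1 y0 y1)) by (rewrite E; ring).
    rewrite <- rect_minus_on by (apply oncont_mult; [now apply oncont_centire|easy]).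
    eapply Rle_trans; [apply Cmod_minus_le|]. rewrite Cmod_mult.
    assert (B1 : (Cmod (fn N p - f p) <= eps / (1 + A))%R).
    { apply HN; [lia|]. generalize (Cmod_ge_0 z0); lra. }
    assert (B2 : (Cmod (rect (fun z => (fn N z * / (z - p) - f z * / (z - p))%C) x0 x1 y0 y1)
                  <= eps / (1 + A) * / d * (2 * (x1 - x0) + 2 * (y1 - y0)))%R).
    { apply rect_bound_on; try easy.
      - destruct (oncont_centire _ x0 x1 y0 y1 Cn) as [C1 [C2 [C3 C4]]].
        destruct (oncont_centire _ x0 x1 y0 y1 Cf) as [D1 [D2 [D3 D4]]].
        destruct Oi as [O1 [O2 [O3 O4]]].
        repeat split; intros t; apply econt_minus; apply econt_mult; auto.
      - intros z Hz. replace (fn N z * / (z - p) - f z * / (z - p)) with ((fn N z - f z) * / (z - p)) by ring.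
        assert (Nz := onedge_neq _ _ _ _ _ _ Hp Hz). rewrite Cmod_mult, Cmod_inv by easy.
        apply Rmult_le_compat; [apply Cmod_ge_0| | |].
        + apply Rlt_le, Rinv_0_lt_compat. now apply Cmod_gt_0.
        + apply HN; [lia|]. specialize (Rb z Hz). generalize (Cmod_ge_0 p). lra.
        + apply Rinv_le_contravar; auto. }
    assert (P0 : (0 < eps / (1 + A))%R) by (apply Rdiv_lt_0_compat; lra).
    assert (B3 : (Cmod (fn N p - f p) * Cmod I <= eps / (1 + A) * Cmod I)%R)
      by (apply Rmult_le_compat_r; [apply Cmod_ge_0|easy]).
    apply Rle_trans with (eps / (1 + A) * A)%R; [unfold A at 2; lra|].
    apply Rle_trans with (eps / (1 + A) * (1 + A))%R; [apply Rmult_le_compat_l; lra|].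
    right. field. lra. }
  destruct (inside_near _ _ _ _ _ H0) as [d [Hd K]].
  assert (Bf : exists M, forall z, onedge z x0 x1 y0 y1 -> (Cmod (f z) <= M)%R).
  { destruct (Hl (Cmod z0 + 2)%R 1%R ltac:(lra)) as [N HN].
    assert (Cn : centire (fn N)) by now apply hentire_centire.
    assert (Bh : forall y, exists M, forall x, (x0 <= x <= x1)%R -> (Cmod (fn N (x, y)) <= M)%R).
    { intros y. destruct (continuity_ab_maj (fun x => Cmod (fn N (x, y))) x0 x1 Hx) as [m [Hm _]].
      - intros c _. apply continuity_pt_filterlim. apply (rcont_Cmod (fun x => fn N (x, y))). now apply allc_h.
      - eexists. intros x Hx'. apply Hm. exact Hx'. }
    assert (Bv : forall x, exists M, forall y, (y0 <= y <= y1)%R -> (Cmod (fn N (x, y)) <= M)%R).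
    { intros x. destruct (continuity_ab_maj (fun y => Cmod (fn N (x, y))) y0 y1 Hy) as [m [Hm _]].
      - intros c _. apply continuity_pt_filterlim. apply (rcont_Cmod (fun y => fn N (x, y))). now apply allc_v.
      - eexists. intros y Hy'. apply Hm. exact Hy'. }
    destruct (Bh y0) as [M1 H1]. destruct (Bh y1) as [M2 H2]. destruct (Bv x0) as [M3 H3]. destruct (Bv x1) as [M4 H4].
    exists (1 + Rabs M1 + Rabs M2 + Rabs M3 + Rabs M4)%R. intros z Hz.
    assert (B := HN N z (Nat.le_refl N) (Rb z Hz)). rewrite Cmod_sym in B.
    assert (T := Cmod_triangle_inv (f z) (fn N z)).
    assert (Cmod (fn N z) <= Rabs M1 + Rabs M2 + Rabs M3 + Rabs M4)%R; [|lra].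
    assert (A1 := Rle_abs M1). assert (A2 := Rle_abs M2). assert (A3 := Rle_abs M3). assert (A4 := Rle_abs M4).
    assert (Q1 := Rabs_pos M1). assert (Q2 := Rabs_pos M2). assert (Q3 := Rabs_pos M3). assert (Q4 := Rabs_pos M4).
    destruct z as [x y]. destruct Hz as [[Hr [E|E]]|[Hr [E|E]]]; simpl in Hr, E; subst.
    - specialize (H1 x Hr). lra.
    - specialize (H2 x Hr). lra.
    - specialize (H3 y Hr). lra.
    - specialize (H4 y Hr). lra. }
  assert (HI : holo (fun p => / rect (fun z => 1 * / (z - p)) x0 x1 y0 y1) z0).
  { apply holo_inv.
    - rewrite (rect_ext_on _ (fun z => / (z - z0))) by (try easy; intros; ring). now apply winding_nz.
    - apply (cauchy_integral_holo (fun _ => 1)); try easy; [intros z; apply econt_const|].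
      exists 1%R. intros z _. rewrite Cmod_1. lra. }
  assert (HH := holo_mult _ _ z0 (cauchy_integral_holo f z0 x0 x1 y0 y1 Cf H0 Bf) HI).
  destruct HH as [l HH]. exists l. revert HH. apply hasd_local. exists d. split; [easy|].
  intros p Hp. destruct (K p Hp) as [Ip _]. cbv beta. rewrite (Form p Ip).
  rewrite (rect_ext_on (fun z => 1 * / (z - p)) (fun z => / (z - p))) by (try easy; intros; ring).
  field. now apply winding_nz.
Qed.

(** * A Phragmen-Lindelof principle *)

Lemma exp_le x y : (x <= y)%R -> (exp x <= exp y)%R.
Proof. intros [H|H]; [left; now apply exp_increasing|right; now f_equal]. Qed.

(** On the closed quadrant the angle [3 / 2 * (t - PI / 4)] stays within 3 pi / 8 of 0, which gives
    the damping factor below a positive rate up to the boundary. *)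
Lemma cos_lower t : (0 <= t <= PI / 2)%R ->
  (0 < cos (3 * PI / 8) <= cos (3 / 2 * (t - PI / 4)))%R.
Proof.
  intros Ht. assert (P := PI_RGT_0). split.
  - apply cos_gt_0; lra.
  - destruct (Rle_dec t (PI / 4)).
    + rewrite <- (cos_neg (3 / 2 * _)). apply cos_decr_1; lra.
    + apply cos_decr_1; lra.
Qed.

(** Removes a damping factor at a fixed point: as [eps] tends to 0,
    [1 - eps * K <= exp (- (eps * K))] tends to 1. *)
Lemma exp_eps_le (a M K : R) : (0 <= a)%R -> (0 <= K)%R ->
  (forall eps, (0 < eps)%R -> (a * exp (- (eps * K)) <= M + eps)%R) -> (a <= M)%R.
Proof.
  intros Ha HK H. apply Rnot_lt_le. intros h.
  set (eps := ((a - M) / (2 * (1 + a * K)))%R).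
  assert (PK : (0 <= a * K)%R) by now apply Rmult_le_pos.
  assert (Pe : (0 < eps)%R) by (apply Rdiv_lt_0_compat; lra).
  specialize (H eps Pe). assert (E := exp_ineq1_le (- (eps * K))).
  assert (a * (1 + - (eps * K)) <= a * exp (- (eps * K)))%R by (apply Rmult_le_compat_l; lra).
  assert (Q : (eps * (2 * (1 + a * K)) = a - M)%R) by (unfold eps; field; lra).
  nra.
Qed.

(* The substitution [z = exp s] turns the quadrant into a strip, so that the maximum
   principle is only needed on rectangles; [exp (-eps z^(3/2))] kills the growth. *)
Lemma phragmen_lindelof_quadrant f M M' A : hentire f -> (0 < M)%R -> (0 <= A)%R ->
  (forall z, (Cmod (f z) <= M' * exp (A * Cmod z))%R) ->
  (forall x, (0 <= x)%R -> (Cmod (f (x, 0%R)) <= M)%R) ->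
  (forall y, (0 <= y)%R -> (Cmod (f (0%R, y)) <= M)%R) ->
  forall x y, (0 < x)%R -> (0 < y)%R -> (Cmod (f (x, y)) <= M)%R.
Proof.
  intros Hf HM HA Hgr Hre Him x y Hx Hy.
  assert (PI0 := PI_RGT_0).
  (* The logarithm of the given point, in polar form. *)
  set (s0 := (ln (Cmod (x, y)), atan (y / x)) : C).
  assert (Hr : (0 < Cmod (x, y))%R).
  { assert (T := re_le_Cmod (x, y)). simpl in T. rewrite Rabs_pos_eq in T; lra. }
  assert (Hth : (0 < atan (y / x) < PI / 2)%R).
  { split; [|apply atan_bound]. rewrite <- atan_0. apply atan_increasing. now apply Rdiv_lt_0_compat. }
  assert (Es0 : Cexp s0 = (x, y)).
  { unfold Cexp, s0. simpl Re. simpl Im. rewrite exp_ln by easy.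
    rewrite cos_atan, sin_atan.
    assert (S : (Cmod (x, y) = x * sqrt (1 + Rsqr (y / x)))%R).
    { rewrite Cmod_eq. simpl Re. simpl Im.
      rewrite <- (sqrt_Rsqr x) at 2 by lra. rewrite <- sqrt_mult.
      - f_equal. unfold Rsqr. field. lra.
      - apply Rle_0_sqr.
      - generalize (Rle_0_sqr (y / x)). lra. }
    assert (Sp : (0 < sqrt (1 + Rsqr (y / x)))%R)
      by (apply sqrt_lt_R0; generalize (Rle_0_sqr (y / x)); lra).
    rewrite S. apply Ceq; simpl; field; repeat split; lra. }
  rewrite <- Es0. apply exp_eps_le with (exp (3 / 2 * Re s0)); [apply Cmod_ge_0|apply Rlt_le, exp_pos|].
  intros eps He.
  (* With [z = exp s] this is exp (-eps u^(3/2)) for u = z e^(-i pi/4): the rotation puts the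
     bisector of the quadrant on the positive axis, and 3/2 exceeds the order 1 of [f] while staying
     below 2, the critical order of a quadrant. *)
  set (h := fun s : C => Cexp (- (RtoC eps * Cexp (RtoC (3 / 2) * (s - (0%R, (PI / 4)%R)))))).
  set (g := fun s => f (Cexp s) * h s).
  assert (Hg : hentire g).
  { intros s. unfold g, h. apply (holo_mult (fun s => f (Cexp s))); [|holo_tac].
    apply (holo_comp f Cexp); [apply Hf|apply holo_Cexp]. }
  assert (Hh : forall s, Cmod (h s) = exp (- (eps * (exp (3 / 2 * Re s) * cos (3 / 2 * (Im s - PI / 4)))))).
  { intros s. unfold h. rewrite Cmod_Cexp. f_equal. destruct s as [u v]. unfold Cexp. simpl.
    replace (3 / 2 * (u + - 0) - 0 * (v + - (PI / 4)))%R with (3 / 2 * u)%R by ring.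
    replace (3 / 2 * (v + - (PI / 4)) + 0 * (u + - 0))%R with (3 / 2 * (v - PI / 4))%R by ring. ring. }
  assert (Hlow : (Cmod (f (Cexp s0)) * exp (- (eps * exp (3 / 2 * Re s0))) <= Cmod (g s0))%R).
  { unfold g. rewrite Cmod_mult, Hh. apply Rmult_le_compat_l; [apply Cmod_ge_0|].
    assert (Cb := COS_bound (3 / 2 * (Im s0 - PI / 4))). assert (Ep := exp_pos (3 / 2 * Re s0)).
    assert (Le : (- (eps * exp (3 / 2 * Re s0)) <= - (eps * (exp (3 / 2 * Re s0) * cos (3 / 2 * (Im s0 - PI / 4)))))%R).
    { apply Ropp_le_contravar. apply Rmult_le_compat_l; [lra|]. nra. }
    destruct Le as [Le|Le]; [left; now apply exp_increasing|right; now f_equal]. }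
  eapply Rle_trans; [exact Hlow|].
  (* left edge: continuity of [f] at [0] *)
  assert (f0 : (Cmod (f 0) <= M)%R) by (apply (Hre 0%R); lra).
  destruct (hentire_centire f Hf 0 eps He) as [d [Hd Kd]].
  set (L1 := (Rmin (ln d) (Re s0) - 1)%R).
  assert (N1 : (L1 <= ln d - 1)%R) by (unfold L1; generalize (Rmin_l (ln d) (Re s0)); lra).
  assert (N2 : (L1 <= Re s0 - 1)%R) by (unfold L1; generalize (Rmin_r (ln d) (Re s0)); lra).
  clearbody L1.
  (* right edge: [eps c e^(3/2 t)] dominates the growth [A e^t] of [f] *)
  set (c := cos (3 * PI / 8)). assert (Pc : (0 < c)%R) by (apply (cos_lower 0); lra).
  set (B := ((A + Rabs (ln (1 + Rabs M' / M))) / (eps * c))%R).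
  assert (Pec : (0 < eps * c)%R) by nra.
  assert (PB : (0 <= B)%R).
  { apply Rcomplements.Rdiv_le_0_compat; [|easy]. generalize (Rabs_pos (ln (1 + Rabs M' / M))). lra. }
  set (L2 := (Rmax 0 (Rmax (2 * ln (B + 1)) (Re s0)) + 1)%R).
  assert (N3 : (1 <= L2)%R) by (unfold L2; generalize (Rmax_l 0 (Rmax (2 * ln (B + 1)) (Re s0))); lra).
  assert (N4 : (2 * ln (B + 1) <= L2)%R).
  { unfold L2. generalize (Rmax_r 0 (Rmax (2 * ln (B + 1)) (Re s0))) (Rmax_l (2 * ln (B + 1)) (Re s0)). lra. }
  assert (N5 : (Re s0 + 1 <= L2)%R).
  { unfold L2. generalize (Rmax_r 0 (Rmax (2 * ln (B + 1)) (Re s0))) (Rmax_r (2 * ln (B + 1)) (Re s0)). lra. }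
  clearbody L2.
  assert (Hin : inside s0 L1 L2 0 (PI / 2)) by (unfold inside; simpl Im; lra).
  assert (Hh1 : forall s, (0 <= Im s <= PI / 2)%R -> (Cmod (h s) <= 1)%R).
  { intros s Hs. rewrite Hh. rewrite <- exp_0.
    assert (Q := cos_lower (Im s) Hs). assert (Ep := exp_pos (3 / 2 * Re s)).
    assert (T : (0 < exp (3 / 2 * Re s) * cos (3 / 2 * (Im s - PI / 4)))%R) by (apply Rmult_lt_0_compat; lra).
    left. apply exp_increasing. nra. }
  apply (maximum_modulus g (M + eps) s0 L1 L2 0 (PI / 2)); try easy; [lra|].
  intros s Hs. unfold g. rewrite Cmod_mult.
  destruct s as [u v]. destruct Hs as [[Hv [E|E]]|[Hv [E|E]]]; simpl in Hv, E; subst.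
  - assert (Ce : Cexp (u, 0%R) = (exp u, 0%R)).
    { unfold Cexp; simpl. rewrite cos_0, sin_0. apply Ceq; simpl; ring. }
    rewrite Ce. assert (T := Hre (exp u) (Rlt_le _ _ (exp_pos u))).
    assert (T2 := Hh1 (u, 0%R) ltac:(simpl; lra)).
    assert (Z := Cmod_ge_0 (f (exp u, 0%R))). assert (Z2 := Cmod_ge_0 (h (u, 0%R))). nra.
  - assert (Ce : Cexp (u, (PI / 2)%R) = (0%R, exp u)).
    { unfold Cexp; simpl. rewrite cos_PI2, sin_PI2. apply Ceq; simpl; ring. }
    rewrite Ce. assert (T := Him (exp u) (Rlt_le _ _ (exp_pos u))).
    assert (T2 := Hh1 (u, (PI / 2)%R) ltac:(simpl; lra)).
    assert (Z := Cmod_ge_0 (f (0%R, exp u))). assert (Z2 := Cmod_ge_0 (h (u, (PI / 2)%R))). nra.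
  - assert (T2 := Hh1 (L1, v) Hv).
    assert (Cmod (Cexp (L1, v)) < d)%R.
    { rewrite Cmod_Cexp. simpl Re. rewrite <- (exp_ln d) by easy. apply exp_increasing. lra. }
    assert (T : (Cmod (f (Cexp (L1, v)) - f 0) < eps)%R).
    { apply Kd. unfold Cgap. replace (Cexp (L1, v) - 0) with (Cexp (L1, v)) by ring. easy. }
    assert (T3 := Cmod_triangle_inv (f (Cexp (L1, v))) (f 0)).
    assert (Z := Cmod_ge_0 (f (Cexp (L1, v)))). assert (Z2 := Cmod_ge_0 (h (L1, v))). nra.
  - rewrite Hh. simpl Re. simpl Im. assert (Q := cos_lower v Hv). fold c in Q.
    assert (G := Hgr (Cexp (L2, v))). rewrite Cmod_Cexp in G. simpl Re in G.
    set (E := exp L2) in *.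
    assert (E1 : (1 <= E)%R).
    { unfold E. rewrite <- exp_0. left. apply exp_increasing. lra. }
    assert (E2 : exp (3 / 2 * L2) = (E * exp (L2 / 2))%R) by (unfold E; rewrite <- exp_plus; f_equal; field).
    assert (E3 : (B + 1 <= exp (L2 / 2))%R).
    { rewrite <- (exp_ln (B + 1)) at 1 by lra.
      destruct (Rle_lt_or_eq_dec (ln (B + 1)) (L2 / 2)) as [l|l]; [lra|left; now apply exp_increasing|right; rewrite l; reflexivity]. }
    assert (E4 : (A * E + Rabs (ln (1 + Rabs M' / M)) <= eps * (exp (3 / 2 * L2) * cos (3 / 2 * (v - PI / 4))))%R).
    { rewrite E2. assert (Qb : (eps * c * B = A + Rabs (ln (1 + Rabs M' / M)))%R) by (unfold B; field; lra).
      assert (R0 := Rabs_pos (ln (1 + Rabs M' / M))).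
      assert (Step1 : (A + Rabs (ln (1 + Rabs M' / M)) <= eps * c * exp (L2 / 2))%R).
      { rewrite <- Qb. apply Rmult_le_compat_l; lra. }
      assert (Step2 : (eps * c * exp (L2 / 2) * E <= eps * (E * exp (L2 / 2) * cos (3 / 2 * (v - PI / 4))))%R).
      { replace (eps * c * exp (L2 / 2) * E)%R with (eps * (E * exp (L2 / 2) * c))%R by ring.
        apply Rmult_le_compat_l; [lra|]. apply Rmult_le_compat_l; [|lra].
        generalize (exp_pos (L2 / 2)). nra. }
      nra. }
    assert (PM : (0 <= Rabs M' / M)%R) by (apply Rcomplements.Rdiv_le_0_compat; [apply Rabs_pos|easy]).
    assert (G2 : (Cmod (f (Cexp (L2, v))) <= M * exp (Rabs (ln (1 + Rabs M' / M))) * exp (A * E))%R).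
    { eapply Rle_trans; [exact G|]. apply Rmult_le_compat_r; [apply Rlt_le, exp_pos|].
      assert (exp (ln (1 + Rabs M' / M)) <= exp (Rabs (ln (1 + Rabs M' / M))))%R.
      { destruct (Rle_abs (ln (1 + Rabs M' / M))) as [l|l]; [left; now apply exp_increasing|right; now f_equal]. }
      rewrite exp_ln in H by lra.
      apply Rle_trans with (M * (1 + Rabs M' / M))%R.
      - replace (M * (1 + Rabs M' / M))%R with (M + Rabs M')%R by (field; lra). generalize (Rle_abs M'). lra.
      - apply Rmult_le_compat_l; lra. }
    set (D := (eps * (exp (3 / 2 * L2) * cos (3 / 2 * (v - PI / 4))))%R) in *.
    apply Rle_trans with (M * exp (Rabs (ln (1 + Rabs M' / M))) * exp (A * E) * exp (- D))%R.
    + apply Rmult_le_compat_r; [apply Rlt_le, exp_pos|easy].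
    + rewrite !Rmult_assoc, <- !exp_plus.
      assert (exp (Rabs (ln (1 + Rabs M' / M)) + (A * E + - D)) <= 1)%R.
      { eapply Rle_trans; [apply (exp_le _ 0); lra|rewrite exp_0; lra]. }
      nra.
Qed.

Lemma hentire_conj f : hentire f -> hentire (fun z => Cconj (f (Cconj z))).
Proof. intros H z. apply holo_conj_conj, H. Qed.

Lemma hentire_reflect f : hentire f -> hentire (fun z => f (- z)).
Proof. intros H z. apply (holo_comp f (fun z => - z)); [apply H|]. holo_tac. Qed.

(** The factor exp (i t z) has modulus 1 on the real axis and cancels exactly the growth allowed to
    [F] on the positive imaginary axis, so the product is bounded on both sides of the quadrant.
    This is why the growth bound must hold with the exponent [t] itself. *)
Lemma strip_growth_quadrant F M M' t : hentire F -> (0 <= t)%R ->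
  (forall z, (Cmod (F z) <= M' * exp (t * Cmod z))%R) ->
  (forall x : R, (Cmod (F x) <= M)%R) ->
  forall z, (0 <= Re z)%R -> (0 <= Im z)%R ->
    (Cmod (F z) <= (1 + Rabs M + Rabs M') * exp (t * Im z))%R.
Proof.
  intros HF Ht Hgr Hre z Hz1 Hz2.
  set (M0 := (1 + Rabs M + Rabs M')%R).
  assert (B1 := Rle_abs M). assert (B2 := Rle_abs M').
  assert (B3 := Rabs_pos M). assert (B4 := Rabs_pos M').
  set (f := fun z => F z * Cexp (Ci * RtoC t * z)).
  assert (Hmod : forall z, Cmod (f z) = (Cmod (F z) * exp (- (t * Im z)))%R).
  { intros w. unfold f. rewrite Cmod_mult, Cmod_Cexp. f_equal. f_equal. destruct w; simpl; ring. }
  assert (Hf : hentire f).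
  { intros w. unfold f. holo_tac. }
  assert (Kre : forall x, (0 <= x)%R -> (Cmod (f (x, 0%R)) <= M0)%R).
  { intros x _. rewrite Hmod. simpl Im. rewrite Rmult_0_r, Ropp_0, exp_0.
    assert (T := Hre x). unfold RtoC in T. unfold M0. lra. }
  assert (Kim : forall y, (0 <= y)%R -> (Cmod (f (0%R, y)) <= M0)%R).
  { intros y Hy. rewrite Hmod. simpl Im.
    assert (T := Hgr (0%R, y)).
    assert (E : Cmod (0%R, y) = y).
    { rewrite Cmod_eq. simpl Re; simpl Im. replace (0 ^ 2 + y ^ 2)%R with (y * y)%R by ring. now apply sqrt_square. }
    rewrite E in T.
    apply Rle_trans with (M' * exp (t * y) * exp (- (t * y)))%R.
    - apply Rmult_le_compat_r; [apply Rlt_le, exp_pos|easy].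
    - rewrite Rmult_assoc, <- exp_plus, Rplus_opp_r, exp_0. unfold M0. lra. }
  assert (Main : (Cmod (f z) <= M0)%R).
  { destruct z as [x y]; simpl in Hz1, Hz2.
    destruct (Rle_lt_or_eq_dec _ _ Hz1) as [Hx|Hx]; [|rewrite <- Hx; now apply Kim].
    destruct (Rle_lt_or_eq_dec _ _ Hz2) as [Hy|Hy]; [|rewrite <- Hy; now apply Kre].
    apply (phragmen_lindelof_quadrant f M0 (Rabs M') (t + t)); try easy; [unfold M0; lra|lra|].
    intros w. rewrite Hmod.
    apply Rle_trans with (Rabs M' * exp (t * Cmod w) * exp (t * Cmod w))%R.
    - apply Rmult_le_compat; [apply Cmod_ge_0|apply Rlt_le, exp_pos| |].
      + eapply Rle_trans; [apply Hgr|]. apply Rmult_le_compat_r; [apply Rlt_le, exp_pos|easy].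
      + apply exp_le. assert (T := Im_le_Cmod w). assert (T2 := Rle_abs (- Im w)).
        rewrite Rabs_Ropp in T2. nra.
    - rewrite Rmult_assoc, <- exp_plus. right. f_equal. f_equal. ring. }
  rewrite Hmod in Main.
  apply (Rmult_le_compat_r (exp (t * Im z))) in Main; [|apply Rlt_le, exp_pos].
  rewrite Rmult_assoc, <- exp_plus, Rplus_opp_l, exp_0, Rmult_1_r in Main. exact Main.
Qed.

(** The other three quadrants are reached through the symmetries [z -> Cconj z] and [z -> - z]. *)
Theorem strip_growth F M M' t : hentire F -> (0 <= t)%R ->
  (forall z, (Cmod (F z) <= M' * exp (t * Cmod z))%R) ->
  (forall x : R, (Cmod (F x) <= M)%R) ->
  forall z, (Cmod (F z) <= (1 + Rabs M + Rabs M') * exp (t * Rabs (Im z)))%R.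
Proof.
  intros HF Ht Hgr Hre.
  assert (Right : forall F, hentire F -> (forall z, (Cmod (F z) <= M' * exp (t * Cmod z))%R) ->
    (forall x : R, (Cmod (F x) <= M)%R) -> forall z, (0 <= Re z)%R ->
    (Cmod (F z) <= (1 + Rabs M + Rabs M') * exp (t * Rabs (Im z)))%R).
  { clear F HF Hgr Hre. intros F HF Hgr Hre z Hz.
    destruct (Rle_dec 0 (Im z)) as [h|h].
    - rewrite (Rabs_pos_eq (Im z)) by exact h. now apply strip_growth_quadrant.
    - rewrite (Rabs_left (Im z)) by lra.
      assert (T := strip_growth_quadrant (fun z => Cconj (F (Cconj z))) M M' t).
      specialize (T (hentire_conj F HF) Ht). cbv beta in T.
      assert (G1 : forall w, (Cmod (Cconj (F (Cconj w))) <= M' * exp (t * Cmod w))%R)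
        by (intros w; rewrite Cmod_conj, <- (Cmod_conj w); apply Hgr).
      assert (G2 : forall x : R, (Cmod (Cconj (F (Cconj x))) <= M)%R).
      { intros x. rewrite Cmod_conj. replace (Cconj (RtoC x)) with (RtoC x)
          by (apply Ceq; simpl; ring). apply Hre. }
      specialize (T G1 G2 (Cconj z)).
      rewrite Cconj_conj, Cmod_conj, re_conj, im_conj in T. apply T; lra. }
  intros z. destruct (Rle_dec 0 (Re z)) as [h|h]; [now apply Right|].
  assert (T := Right (fun z => F (- z)) (hentire_reflect F HF)). cbv beta in T.
  assert (G1 : forall w, (Cmod (F (- w)%C) <= M' * exp (t * Cmod w))%R)
    by (intros w; rewrite <- (Cmod_opp w); apply Hgr).
  assert (G2 : forall x : R, (Cmod (F (- x)%C) <= M)%R)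
    by (intros x; rewrite <- RtoC_opp; apply Hre).
  specialize (T G1 G2 (- z)). replace (- - z) with z in T by ring.
  change (Re (- z)) with (- Re z)%R in T. change (Im (- z)) with (- Im z)%R in T.
  rewrite Rabs_Ropp in T. apply T. lra.
Qed.

(** * The entire functions [(exp (i l (z - c)) - 1) / (z - c)] *)

Lemma Cmvt g g' u B : (forall z, hasd g z (g' z)) -> centire g' ->
  (forall t, (0 <= t <= 1)%R -> (Cmod (g' (RtoC t * u)%C) <= B)%R) ->
  (Cmod (g u - g 0) <= B * Cmod u)%R.
Proof.
  intros Hg Hc HB. assert (E := CI_FTC g g' 0 u 0 1 Hg Hc).
  replace (cline 0 u 1) with u in E by (unfold cline; ring).
  replace (cline 0 u 0) with (RtoC 0) in E by (unfold cline; ring).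
  rewrite <- E. replace (B * Cmod u)%R with (B * Cmod u * (1 - 0))%R by ring.
  apply CI_bound; [lra| |].
  - apply allc_scal, (allc_comp g'); [easy|apply cline_cont].
  - intros t Ht. rewrite Cmod_mult, Rmult_comm. apply Rmult_le_compat_r; [apply Cmod_ge_0|].
    unfold cline. rewrite Cplus_0_l. auto.
Qed.

Lemma Cexp_minus_1_le u : (Cmod (Cexp u - 1) <= exp (Rabs (Re u)) * Cmod u)%R.
Proof.
  rewrite <- Cexp_0. apply (Cmvt Cexp Cexp).
  - apply hasd_Cexp.
  - intros z. apply holo_ccont, holo_Cexp.
  - intros t Ht. rewrite Cmod_Cexp, re_scal_l. apply exp_le.
    assert (A := Rle_abs (t * Re u)). rewrite Rabs_mult, (Rabs_pos_eq t) in A by lra.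
    generalize (Rabs_pos (Re u)). nra.
Qed.

Lemma Cmod_scal_le t u : (0 <= t <= 1)%R -> (Cmod (RtoC t * u) <= Cmod u)%R.
Proof.
  intros Ht. rewrite Cmod_mult, Cmod_R, Rabs_pos_eq by lra. generalize (Cmod_ge_0 u). nra.
Qed.

(** Each Taylor remainder of exp is the derivative of the next one, so [Cmvt] raises the order by
    one. The constants are crude; only the power of [Cmod u] matters. *)
Lemma Cexp_taylor1 u : (Cmod (Cexp u - 1 - u) <= exp (Cmod u) * Cmod u * Cmod u)%R.
Proof.
  replace (Cexp u - 1 - u) with ((Cexp u - u) - (Cexp 0 - 0)) by (rewrite Cexp_0; ring).
  apply (Cmvt (fun z => Cexp z - z) (fun z => Cexp z - 1)).
  - intros z. replace (Cexp z - 1) with (Cexp z + (0 * z + RtoC (-1) * 1)) by ring.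
    apply (hasd_ext (fun z => Cexp z + RtoC (-1) * z)); [intros; ring|].
    apply (hasd_plus Cexp (fun z => RtoC (-1) * z)); [apply hasd_Cexp|]. apply (hasd_mult (fun _ => RtoC (-1)) (fun z => z));
      [apply hasd_const|apply hasd_id].
  - intros z. apply holo_ccont. holo_tac.
  - intros t Ht. eapply Rle_trans; [apply Cexp_minus_1_le|].
    assert (A := Cmod_scal_le t u Ht). assert (B := re_le_Cmod (RtoC t * u)).
    apply Rmult_le_compat; try easy; [apply Rlt_le, exp_pos|apply Cmod_ge_0|apply exp_le; lra].
Qed.

Lemma Cexp_taylor2 u :
  (Cmod (Cexp u - 1 - u - u * u / 2) <= exp (Cmod u) * Cmod u * Cmod u * Cmod u)%R.
Proof.
  replace (Cexp u - 1 - u - u * u / 2) with ((Cexp u - u - u * u / 2) - (Cexp 0 - 0 - 0 * 0 / 2))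
    by (rewrite Cexp_0; field).
  apply (Cmvt (fun z => Cexp z - z - z * z / 2) (fun z => Cexp z - 1 - z)).
  - intros z.
    replace (Cexp z - 1 - z) with (Cexp z + ((0 * z + RtoC (-1) * 1)
      + (0 * (z * z) + - / 2 * (1 * z + z * 1)))) by field.
    apply (hasd_ext (fun z => Cexp z + (RtoC (-1) * z + - / 2 * (z * z)))); [intros; field|].
    apply (hasd_plus Cexp (fun z => RtoC (-1) * z + - / 2 * (z * z))); [apply hasd_Cexp|].
    apply (hasd_plus (fun z => RtoC (-1) * z) (fun z => - / 2 * (z * z))).
    + apply (hasd_mult (fun _ => RtoC (-1)) (fun z => z)); [apply hasd_const|apply hasd_id].
    + apply (hasd_mult (fun _ => - / 2) (fun z => z * z)); [apply hasd_const|].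
      apply (hasd_mult (fun z => z) (fun z => z)); apply hasd_id.
  - intros z. apply holo_ccont. holo_tac.
  - intros t Ht. eapply Rle_trans; [apply Cexp_taylor1|].
    assert (A := Cmod_scal_le t u Ht). assert (A0 := Cmod_ge_0 (RtoC t * u)).
    assert (exp (Cmod (RtoC t * u)) <= exp (Cmod u))%R by now apply exp_le.
    assert (E0 := exp_pos (Cmod (RtoC t * u))).
    repeat apply Rmult_le_compat; try lra. nra.
Qed.

Definition phi (u : C) : C :=
  if excluded_middle_informative (u = 0) then 1 else (Cexp u - 1) / u.

Lemma phi_mult u : u * phi u = Cexp u - 1.
Proof.
  unfold phi. destruct (excluded_middle_informative (u = 0)) as [->|N].
  - rewrite Cexp_0. ring.
  - field. easy.
Qed.

Lemma phi_0 : phi 0 = 1.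
Proof. unfold phi. destruct (excluded_middle_informative (RtoC 0 = 0)); easy. Qed.

Lemma holo_phi : hentire phi.
Proof.
  intros u. destruct (excluded_middle_informative (u = 0)) as [->|N].
  - exists (/ 2). apply hasd_eps. intros eps He.
    assert (P3 := exp_pos 1).
    exists (Rmin 1 (eps / exp 1)). split; [apply Rmin_pos; [lra|now apply Rdiv_lt_0_compat]|].
    intros y Hy. replace (y - 0) with y in * by ring. rewrite phi_0.
    assert (N1 := Rmin_l 1 (eps / exp 1)). assert (N2 := Rmin_r 1 (eps / exp 1)).
    destruct (excluded_middle_informative (y = 0)) as [->|Ny].
    + rewrite phi_0. replace (1 - 1 - 0 * / 2) with (RtoC 0) by ring. rewrite Cmod_0. lra.
    + assert (Py := proj1 (Cmod_gt_0 y) Ny).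
      replace (phi y - 1 - y * / 2) with ((Cexp y - 1 - y - y * y / 2) / y)
        by (rewrite <- (phi_mult y); field; easy).
      rewrite Cmod_div by easy. apply Rle_div_l; [easy|].
      eapply Rle_trans; [apply Cexp_taylor2|].
      assert (exp (Cmod y) <= exp 1)%R by (apply exp_le; lra).
      assert (Hs : (Cmod y <= eps / exp 1)%R) by lra. apply Rle_div_r in Hs; [|easy].
      assert (exp (Cmod y) * Cmod y <= eps)%R by nra.
      rewrite !Rmult_assoc. rewrite <- !Rmult_assoc. apply Rmult_le_compat_r; [lra|].
      apply Rmult_le_compat_r; [lra|]. easy.
  - assert (K : holo (fun y => (Cexp y - 1) * / y) u).
    { apply (holo_mult (fun y => Cexp y - 1) (fun y => / y)); [holo_tac|].
      apply holo_inv; [easy|apply holo_id]. }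
    destruct K as [l K]. exists l. revert K. apply hasd_local.
    exists (Cmod u). split; [now apply Cmod_gt_0|]. intros y Hy.
    unfold phi. destruct (excluded_middle_informative (y = 0)) as [->|Ny]; [|easy].
    replace (0 - u) with (- u) in Hy by ring. rewrite Cmod_opp in Hy. lra.
Qed.

Lemma phi_bound u : (Cmod (phi u) <= exp (Rabs (Re u)))%R.
Proof.
  unfold phi. destruct (excluded_middle_informative (u = 0)) as [->|N].
  - simpl. rewrite Rabs_R0, exp_0, Cmod_1. lra.
  - rewrite Cmod_div by easy. apply Rle_div_l; [now apply Cmod_gt_0|]. apply Cexp_minus_1_le.
Qed.

(** Writing the block through [phi] builds in the value i l at [z = c] and makes it entire without a
    case distinction in [z]. *)
Definition Eb (l : R) (c z : C) : C := Ci * RtoC l * phi (Ci * RtoC l * (z - c)).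

Lemma Eb_mult l c z : (z - c) * Eb l c z = Cexp (Ci * RtoC l * (z - c)) - 1.
Proof. rewrite <- phi_mult. unfold Eb. ring. Qed.

Lemma Eb_off l c z : z <> c -> Eb l c z = (Cexp (Ci * RtoC l * (z - c)) - 1) / (z - c).
Proof. intros H. rewrite <- Eb_mult. field. now apply Cminus_eq_contra. Qed.

Lemma Eb_at l c : Eb l c c = Ci * RtoC l.
Proof.
  unfold Eb. replace (Ci * RtoC l * (c - c)) with (RtoC 0) by ring. rewrite phi_0. ring.
Qed.

Lemma hentire_Eb l c : hentire (Eb l c).
Proof.
  intros z. unfold Eb. apply (holo_mult (fun _ => Ci * RtoC l)); [apply holo_const|].
  apply (holo_comp phi); [apply holo_phi|]. holo_tac.
Qed.

Lemma Eb_bound l c z : (Cmod (Eb l c z) <= Rabs l * exp (Rabs l * Rabs (Im (z - c))))%R.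
Proof.
  unfold Eb. rewrite !Cmod_mult, Cmod_Ci, Cmod_R, Rmult_1_l.
  apply Rmult_le_compat_l; [apply Rabs_pos|]. eapply Rle_trans; [apply phi_bound|].
  right. f_equal. rewrite <- Rabs_mult.
  replace (Re (Ci * RtoC l * (z - c))) with (- (l * Im (z - c)))%R by (destruct z, c; simpl; ring).
  apply Rabs_Ropp.
Qed.

Lemma Eb_conj l c z : Cconj (Eb l c z) = Eb (- l) (Cconj c) (Cconj z).
Proof.
  destruct (excluded_middle_informative (z = c)) as [->|N].
  - rewrite !Eb_at. apply Ceq; simpl; ring.
  - assert (N' : Cconj z <> Cconj c).
    { intros E. apply N. rewrite <- (Cconj_conj z), E. apply Cconj_conj. }
    rewrite !Eb_off by easy. rewrite Cdiv_conj by now apply Cminus_eq_contra.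
    rewrite Cminus_conj, Cconj_Cexp, Cminus_conj. f_equal. f_equal; [|apply Ceq; simpl; ring].
    f_equal. rewrite Cmult_conj, Cminus_conj. f_equal. apply Ceq; simpl; ring.
Qed.

(** On the real line both the block and its product with [x - c] are bounded, and x^2 is at most 2
    |x - c|^2 + 2 |c|^2. Square integrability follows. *)
Lemma Eb_decay l c : exists A, forall x : R, (Cmod (Eb l c x) ^ 2 <= A / (1 + x ^ 2))%R.
Proof.
  set (e := exp (Rabs l * Rabs (Im c))).
  exists ((Rabs l * e) ^ 2 + 2 * (e + 1) ^ 2 + 2 * Cmod c ^ 2 * (Rabs l * e) ^ 2)%R.
  intros x. assert (Px : (0 < 1 + x ^ 2)%R) by (generalize (pow2_ge_0 x); lra).
  apply (proj1 (Rle_div_r _ _ _ Px)).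
  assert (Im0 : Rabs (Im (RtoC x - c)) = Rabs (Im c)).
  { destruct c as [u v]; simpl. rewrite <- Rabs_Ropp. f_equal. ring. }
  assert (B1 := Eb_bound l c x). rewrite Im0 in B1. fold e in B1.
  assert (B2 : (Cmod (RtoC x - c) * Cmod (Eb l c x) <= e + 1)%R).
  { rewrite <- Cmod_mult, Eb_mult. eapply Rle_trans; [apply Cmod_minus_le|].
    rewrite Cmod_1, Cmod_Cexp. apply Rplus_le_compat_r. apply exp_le.
    replace (Re (Ci * RtoC l * (RtoC x - c))) with (l * Im c)%R by (destruct c; simpl; ring).
    rewrite <- Rabs_mult. apply Rle_abs. }
  assert (T : (Rabs x <= Cmod (RtoC x - c) + Cmod c)%R).
  { rewrite <- Cmod_R. assert (T := Cmod_triangle (RtoC x - c) c).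
    now replace (RtoC x - c + c) with (RtoC x) in T by ring. }
  assert (X2 : (x ^ 2 <= 2 * Cmod (RtoC x - c) ^ 2 + 2 * Cmod c ^ 2)%R).
  { rewrite <- pow2_abs. assert (0 <= Rabs x)%R by apply Rabs_pos.
    set (p := Cmod (RtoC x - c)) in *. set (q := Cmod c) in *. set (m := Rabs x) in *.
    assert (m ^ 2 <= (p + q) ^ 2)%R by (apply pow_incr; easy).
    assert (0 <= (p - q) ^ 2)%R by apply pow2_ge_0. nra. }
  assert (P0 := Cmod_ge_0 (Eb l c x)). assert (P1 := Cmod_ge_0 (RtoC x - c)).
  assert (S1 : (Cmod (Eb l c x) ^ 2 <= (Rabs l * e) ^ 2)%R) by (apply pow_incr; easy).
  assert (S2 : ((Cmod (RtoC x - c) * Cmod (Eb l c x)) ^ 2 <= (e + 1) ^ 2)%R)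
    by (apply pow_incr; split; [now apply Rmult_le_pos|easy]).
  rewrite Rpow_mult_distr in S2.
  set (E2 := (Cmod (Eb l c x) ^ 2)%R) in *. assert (0 <= E2)%R by apply pow2_ge_0.
  set (p2 := (Cmod (RtoC x - c) ^ 2)%R) in *. set (q2 := (Cmod c ^ 2)%R) in *.
  assert (0 <= q2)%R by apply pow2_ge_0.
  assert (E2 * x ^ 2 <= E2 * (2 * p2 + 2 * q2))%R by (apply Rmult_le_compat_l; easy).
  assert (E2 * q2 <= (Rabs l * e) ^ 2 * q2)%R by (apply Rmult_le_compat_r; easy).
  lra.
Qed.

(** * Improper integrals over the real line *)

Definition isI (f : R -> C) (v : C) : Prop :=
  @is_RInt_gen C_R_NormedModule f (Rbar_locally m_infty) (Rbar_locally p_infty) v.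

Lemma filter_prod_infty (P : R * R -> Prop) :
  filter_prod (Rbar_locally m_infty) (Rbar_locally p_infty) P <->
  exists N, forall a b, (a <= - N)%R -> (N <= b)%R -> P (a, b).
Proof.
  split.
  - intros [Q1 Q2 [M1 H1] [M2 H2] H].
    exists (Rmax (1 - M1) (M2 + 1)). intros a b Ha Hb.
    assert (N1 := Rmax_l (1 - M1) (M2 + 1)). assert (N2 := Rmax_r (1 - M1) (M2 + 1)).
    apply H; [apply H1|apply H2]; lra.
  - intros [N H]. exists (fun a => (a <= - N)%R) (fun b => (N <= b)%R).
    + exists (- N)%R. intros x Hx. lra.
    + exists N. intros x Hx. lra.
    + intros a b. apply H.
Qed.

Lemma isI_eps f v : allc f -> (isI f v <-> forall eps, (0 < eps)%R -> exists N,
  forall a b, (a <= - N)%R -> (N <= b)%R -> (Cmod (CI f a b - v) <= eps)%R).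
Proof.
  intros Hf. split.
  - intros H eps He.
    assert (He2 : (0 < eps / 2)%R) by lra.
    destruct (proj1 (filter_prod_infty _) (H _ (@locally_ball C_R_NormedModule v (mkposreal _ He2)))) as [N HN].
    exists N. intros a b Ha Hb. destruct (HN a b Ha Hb) as [y [Hy [B1 B2]]]. simpl in Hy.
    rewrite (CI_unique f a b y Hy).
    assert (B1' : (Rabs (Re y - Re v) < eps / 2)%R) by exact B1.
    assert (B2' : (Rabs (Im y - Im v) < eps / 2)%R) by exact B2.
    eapply Rle_trans; [apply Cmod_le_Re_Im|].
    change (Re (y - v)) with (Re y - Re v)%R. change (Im (y - v)) with (Im y - Im v)%R. lra.
  - intros H P [e He]. unfold filtermapi. apply filter_prod_infty.
    destruct (H (e / 2)%R ltac:(generalize (cond_pos e); lra)) as [N HN].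
    exists N. intros a b Ha Hb. exists (CI f a b). split; [now apply CI_correct|].
    apply He. specialize (HN a b Ha Hb). assert (Q := cond_pos e). split.
    + eapply Rle_lt_trans; [apply (re_le_Cmod (CI f a b - v))|]. lra.
    + eapply Rle_lt_trans; [apply (Im_le_Cmod (CI f a b - v))|]. lra.
Qed.

Lemma isI_unique f u v : allc f -> isI f u -> isI f v -> u = v.
Proof.
  intros Hf Hu Hv. apply Cmod_small_eq. intros eps He.
  destruct (proj1 (isI_eps f u Hf) Hu (eps / 2)%R ltac:(lra)) as [N1 H1].
  destruct (proj1 (isI_eps f v Hf) Hv (eps / 2)%R ltac:(lra)) as [N2 H2].
  set (N := Rmax N1 N2). assert (L1 : (N1 <= N)%R) by apply Rmax_l. assert (L2 : (N2 <= N)%R) by apply Rmax_r.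
  specialize (H1 (- N)%R N ltac:(lra) ltac:(lra)). specialize (H2 (- N)%R N ltac:(lra) ltac:(lra)).
  replace (u - v) with ((CI f (- N) N - v) - (CI f (- N) N - u)) by ring.
  eapply Rle_trans; [apply Cmod_minus_le|]. lra.
Qed.

Lemma isI_ext f g v : (forall x, f x = g x) -> isI f v -> isI g v.
Proof.
  intros H Hv. refine (@is_RInt_gen_ext C_R_NormedModule (Rbar_locally m_infty) (Rbar_locally p_infty)
    _ _ f g v _ Hv).
  apply filter_prod_infty. exists 0%R. intros a b _ _ x _. apply H.
Qed.

Lemma isI_plus f g u v : isI f u -> isI g v -> isI (fun x => f x + g x) (u + v).
Proof.
  intros Hf Hg. exact (@is_RInt_gen_plus C_R_NormedModule (Rbar_locally m_infty) (Rbar_locally p_infty)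
    _ _ f g u v Hf Hg).
Qed.

Lemma isI_scal c f u : allc f -> isI f u -> isI (fun x => c * f x) (c * u).
Proof.
  intros Hf Hu. apply isI_eps; [now apply allc_scal|]. intros eps He.
  assert (P : (0 < 1 + Cmod c)%R) by (generalize (Cmod_ge_0 c); lra).
  destruct (proj1 (isI_eps f u Hf) Hu (eps / (1 + Cmod c))%R) as [N HN]; [now apply Rdiv_lt_0_compat|].
  exists N. intros a b Ha Hb. specialize (HN a b Ha Hb). rewrite CI_scal by easy.
  replace (c * CI f a b - c * u) with (c * (CI f a b - u)) by ring. rewrite Cmod_mult.
  apply Rle_div_r in HN; [|easy]. generalize (Cmod_ge_0 c) (Cmod_ge_0 (CI f a b - u)). nra.
Qed.

Lemma isI_minus f g u v : allc g -> isI f u -> isI g v -> isI (fun x => f x - g x) (u - v).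
Proof.
  intros Hc Hf Hg. replace (u - v) with (u + RtoC (-1) * v) by ring.
  apply isI_ext with (fun x => f x + RtoC (-1) * g x); [intros; ring|].
  apply isI_plus; [easy|]. now apply isI_scal.
Qed.

Lemma isI_conj f u : allc f -> isI f u -> isI (fun x => Cconj (f x)) (Cconj u).
Proof.
  intros Hf Hu. apply isI_eps; [intros x; apply econt_conj, Hf|]. intros eps He.
  destruct (proj1 (isI_eps f u Hf) Hu eps He) as [N HN]. exists N. intros a b Ha Hb.
  rewrite CI_conj by easy. rewrite <- Cminus_conj, Cmod_conj. auto.
Qed.

(** The boxes of the contour argument are centred at [Re c], not at 0, hence the midpoint [m]. *)
Lemma isI_sym_lim f v (m : R) : allc f -> isI f v -> forall eps, (0 < eps)%R ->
  exists N, forall r, (N <= r)%R -> (Cmod (CI f (m - r) (m + r) - v) <= eps)%R.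
Proof.
  intros Hf Hv eps He. destruct (proj1 (isI_eps f v Hf) Hv eps He) as [N HN].
  exists (N + Rabs m)%R. intros r Hr. assert (A := Rle_abs m). assert (B := Rle_abs (- m)).
  rewrite Rabs_Ropp in B. apply HN; lra.
Qed.

Definition Rcont (g : R -> R) : Prop := forall x, continuous g x.

Lemma RInt_add (g : R -> R) a b c : Rcont g -> (RInt g a b + RInt g b c)%R = RInt g a c.
Proof.
  intros H. apply (@RInt_Chasles R_CompleteNormedModule); now apply ex_RInt_allR.
Qed.

Lemma RInt_ge0 (g : R -> R) a b : Rcont g -> (forall x, (0 <= g x)%R) -> (a <= b)%R -> (0 <= RInt g a b)%R.
Proof. intros Hg H Hab. apply RInt_ge_0; auto. now apply ex_RInt_allR. Qed.

Lemma RInt_mono (g h : R -> R) a b : Rcont g -> Rcont h -> (a <= b)%R ->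
  (forall x, (g x <= h x)%R) -> (RInt g a b <= RInt h a b)%R.
Proof. intros Hg Hh Hab H. apply RInt_le; auto; now apply ex_RInt_allR. Qed.

Lemma RInt_widen (g : R -> R) a b a' b' : Rcont g -> (forall x, (0 <= g x)%R) ->
  (a' <= a)%R -> (a <= b)%R -> (b <= b')%R -> (RInt g a b <= RInt g a' b')%R.
Proof.
  intros Hg H H1 H2 H3. rewrite <- (RInt_add g a' a b' Hg), <- (RInt_add g a b b' Hg).
  generalize (RInt_ge0 g a' a Hg H H1) (RInt_ge0 g b b' Hg H H3). lra.
Qed.

(** For a nonnegative continuous [g], a common bound of the partial integrals encodes integrability
    over the line together with a bound for the integral, without naming the improper integral. *)
Definition bddI (g : R -> R) (B : R) : Prop := forall a b, (a <= b)%R -> (RInt g a b <= B)%R.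

(** An interval whose integral comes within [eps] of the supremum of all partial integrals leaves at
    most [eps] outside. *)
Lemma bddI_tail (g : R -> R) B : Rcont g -> (forall x, (0 <= g x)%R) -> bddI g B ->
  forall eps, (0 < eps)%R -> exists N, (0 <= N)%R /\ forall b b', (N <= b)%R -> (b <= b')%R ->
    (RInt g b b' <= eps)%R /\ (RInt g (- b') (- b) <= eps)%R.
Proof.
  intros Hg H0 HB eps He.
  destruct (completeness (fun r => exists a b, (a <= b)%R /\ r = RInt g a b)) as [S [S1 S2]].
  - exists B. intros r [a [b [Hab ->]]]. now apply HB.
  - exists (RInt g 0 0). exists 0%R, 0%R. split; [lra|easy].
  - assert (Hx : exists a b, (a <= b)%R /\ (S - eps < RInt g a b)%R).
    { apply NNPP. intros N. assert (S <= S - eps)%R; [|lra]. apply S2.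
      intros r [a [b [Hab ->]]]. apply Rnot_lt_le. intros h. apply N. now exists a, b. }
    destruct Hx as [a [b [Hab Hs]]].
    exists (Rabs a + Rabs b)%R. assert (A1 := Rle_abs a). assert (A2 := Rle_abs (- a)). assert (A3 := Rle_abs b).
    assert (A4 := Rle_abs (- b)). rewrite !Rabs_Ropp in *. assert (A5 := Rabs_pos a). assert (A6 := Rabs_pos b).
    split; [lra|]. intros c c' Hc Hc'.
    assert (K1 : (RInt g a c' <= S)%R) by (apply S1; exists a, c'; split; [lra|easy]).
    assert (K2 : (RInt g (- c') b <= S)%R) by (apply S1; exists (- c')%R, b; split; [lra|easy]).
    rewrite <- (RInt_add g a b c' Hg), <- (RInt_add g b c c' Hg) in K1.
    rewrite <- (RInt_add g (- c') (- c) b Hg), <- (RInt_add g (- c) a b Hg) in K2.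
    assert (Q1 := RInt_ge0 g b c Hg H0 ltac:(lra)). assert (Q2 := RInt_ge0 g (- c) a Hg H0 ltac:(lra)). lra.
Qed.

Lemma ex_RInt_gen_bddI (g : R -> R) : Rcont g -> (forall x, (0 <= g x)%R) ->
  (ex_RInt_gen g (Rbar_locally m_infty) (Rbar_locally p_infty) <-> exists B, bddI g B).
Proof.
  intros Hg H0. split.
  - intros [l Hl].
    destruct (proj1 (filter_prod_infty _) (Hl _ (@locally_ball R_NormedModule l (mkposreal 1 Rlt_0_1)))) as [N HN].
    exists (l + 1)%R. intros a b Hab.
    set (A := Rmin a (- N)). set (B := Rmax b N).
    assert (A1 : (A <= a)%R) by apply Rmin_l. assert (A2 : (A <= - N)%R) by apply Rmin_r.
    assert (B1 : (b <= B)%R) by apply Rmax_l. assert (B2 : (N <= B)%R) by apply Rmax_r.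
    destruct (HN A B A2 B2) as [y [Hy By]]. simpl in Hy.
    apply (@is_RInt_unique R_CompleteNormedModule) in Hy.
    assert (By' : (Rabs (y - l) < 1)%R) by exact By. apply Rabs_def2 in By'.
    assert (W := RInt_widen g a b A B Hg H0 A1 Hab B1). rewrite Hy in W. lra.
  - intros [B HB].
    assert (Hl : exists l : R, filterlim (fun ab : R * R => RInt g (fst ab) (snd ab))
      (filter_prod (Rbar_locally m_infty) (Rbar_locally p_infty)) (locally l)).
    { apply (filterlim_locally_cauchy (U := R_CompleteSpace)). intros eps.
      destruct (bddI_tail g B Hg H0 HB (eps / 3)%R ltac:(generalize (cond_pos eps); lra)) as [N [HN0 HN]].
      exists (fun ab => (fst ab <= - N)%R /\ (N <= snd ab)%R). split.
      - apply filter_prod_infty. exists N. intros a b Ha Hb. now split.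
      - assert (K : forall a b, (a <= - N)%R -> (N <= b)%R ->
          (RInt g (- N) N <= RInt g a b <= RInt g (- N) N + 2 * (eps / 3))%R).
        { intros a b Ha Hb. split; [apply RInt_widen; auto; lra|].
          rewrite <- (RInt_add g a (- N) b Hg), <- (RInt_add g (- N) N b Hg).
          destruct (HN N b ltac:(lra) Hb) as [T1 _]. destruct (HN N (- a)%R ltac:(lra) ltac:(lra)) as [_ T2].
          rewrite Ropp_involutive in T2. lra. }
        intros [a b] [a' b'] [H1 H2] [H3 H4]. simpl in *.
        specialize (K a b H1 H2) as K1. specialize (K a' b' H3 H4) as K2.
        change (Rabs (RInt g a' b' - RInt g a b) < eps)%R. assert (Q := cond_pos eps). apply Rabs_def1; lra. }
    destruct Hl as [l Hl]. exists l. intros P HP. specialize (Hl P HP). unfold filtermapi.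
    apply filter_prod_infty in Hl. destruct Hl as [N HN]. apply filter_prod_infty. exists N.
    intros a b Ha Hb. exists (RInt g a b). split; [|now apply (HN a b)].
    apply (@RInt_correct R_CompleteNormedModule). now apply ex_RInt_allR.
Qed.

Lemma isI_exists f (g : R -> R) B : allc f -> Rcont g -> (forall x, (Cmod (f x) <= g x)%R) -> bddI g B ->
  exists v, isI f v.
Proof.
  intros Hf Hg H HB.
  assert (H0 : forall x, (0 <= g x)%R) by (intros x; eapply Rle_trans; [apply Cmod_ge_0|apply H]).
  assert (Hl : exists l : C, filterlim (fun ab : R * R => CI f (fst ab) (snd ab))
    (filter_prod (Rbar_locally m_infty) (Rbar_locally p_infty)) (@locally C_R_CompleteNormedModule l)).
  { apply (filterlim_locally_cauchy (U := C_R_CompleteNormedModule)). intros eps.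
    destruct (bddI_tail g B Hg H0 HB (eps / 5)%R ltac:(generalize (cond_pos eps); lra)) as [N [HN0 HN]].
    exists (fun ab => (fst ab <= - N)%R /\ (N <= snd ab)%R). split.
    - apply filter_prod_infty. exists N. intros a b Ha Hb. now split.
    - assert (K : forall a b, (a <= - N)%R -> (N <= b)%R ->
        (Cmod (CI f a b - CI f (- N) N) <= 2 * (eps / 5))%R).
      { intros a b Ha Hb.
        replace (CI f a b - CI f (- N) N) with (CI f a (- N) + CI f N b)
          by (rewrite <- (CI_Chasles f a (- N) b Hf), <- (CI_Chasles f (- N) N b Hf); ring).
        eapply Rle_trans; [apply Cmod_triangle|].
        assert (T1 := CI_norm f g a (- N) ltac:(lra) Hf Hg ltac:(auto)).
        assert (T2 := CI_norm f g N b ltac:(lra) Hf Hg ltac:(auto)).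
        destruct (HN N b ltac:(lra) Hb) as [T3 _]. destruct (HN N (- a)%R ltac:(lra) ltac:(lra)) as [_ T4].
        rewrite Ropp_involutive in T4. lra. }
      intros [a b] [a' b'] [H1 H2] [H3 H4]. simpl in *.
      specialize (K a b H1 H2) as K1. specialize (K a' b' H3 H4) as K2.
      assert (Q := cond_pos eps).
      assert (D : (Cmod (CI f a' b' - CI f a b) < eps)%R).
      { replace (CI f a' b' - CI f a b) with ((CI f a' b' - CI f (- N) N) - (CI f a b - CI f (- N) N)) by ring.
        eapply Rle_lt_trans; [apply Cmod_minus_le|]. lra. }
      split.
      + eapply Rle_lt_trans; [apply (re_le_Cmod (CI f a' b' - CI f a b))|exact D].
      + eapply Rle_lt_trans; [apply (Im_le_Cmod (CI f a' b' - CI f a b))|exact D]. }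
  destruct Hl as [l Hl]. exists l. intros P HP. specialize (Hl P HP). unfold filtermapi.
  apply filter_prod_infty in Hl. destruct Hl as [N HN]. apply filter_prod_infty. exists N.
  intros a b Ha Hb. exists (CI f a b). split; [|now apply (HN a b)]. now apply CI_correct.
Qed.

(** * Weighted square-integrable functions *)

Definition sqw (w : R -> R) (f : R -> C) (x : R) : R := (Cmod (f x) ^ 2 * w x)%R.

Definition weight (w : R -> R) : Prop := Rcont w /\ forall x, (0 <= w x)%R.

Lemma Rcont_mult g h : Rcont g -> Rcont h -> Rcont (fun x => g x * h x)%R.
Proof. intros Hg Hh x. apply (continuous_mult (K := R_AbsRing) g h); auto. Qed.

Lemma Rcont_plus g h : Rcont g -> Rcont h -> Rcont (fun x => g x + h x)%R.
Proof. intros Hg Hh x. apply (continuous_plus (V := R_NormedModule) g h); auto. Qed.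

Lemma Rcont_const c : Rcont (fun _ => c).
Proof. intros x. apply continuous_const. Qed.

Lemma Rcont_sqw w f : weight w -> allc f -> Rcont (sqw w f).
Proof.
  intros [Hw _] Hf. unfold sqw. apply Rcont_mult; [|easy].
  assert (Hc : Rcont (fun x => Cmod (f x))) by (intros x; apply rcont_Cmod, Hf).
  intros x. apply continuous_ext with (fun x => (Cmod (f x) * Cmod (f x))%R); [intros y; simpl; ring|].
  now apply Rcont_mult.
Qed.

Lemma sqw_pos w f x : weight w -> (0 <= sqw w f x)%R.
Proof. intros [_ H]. apply Rmult_le_pos; [apply pow2_ge_0|auto]. Qed.

Lemma RInt_lin (g h : R -> R) p q a b : Rcont g -> Rcont h ->
  RInt (fun x => p * g x + q * h x)%R a b = (p * RInt g a b + q * RInt h a b)%R.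
Proof.
  intros Hg Hh. apply (@is_RInt_unique R_CompleteNormedModule).
  apply (is_RInt_plus (V := R_NormedModule)); apply (is_RInt_scal (V := R_NormedModule));
    apply (@RInt_correct R_CompleteNormedModule); now apply ex_RInt_allR.
Qed.

(** The arithmetic-geometric inequality with a free weight: optimising [s] yields Cauchy-Schwarz,
    while a fixed small [s] lets the tail of one factor control the tail of a product. *)
Lemma prod_le_sq (s u v w : R) : (0 < s)%R -> (0 <= w)%R ->
  (u * v * w <= s / 2 * (u ^ 2 * w) + / (2 * s) * (v ^ 2 * w))%R.
Proof.
  intros Hs Hw.
  assert (E : (s / 2 * (u ^ 2 * w) + / (2 * s) * (v ^ 2 * w) - u * v * w
     = / (2 * s) * ((s * u - v) ^ 2 * w))%R) by (field; lra).
  assert (0 <= / (2 * s) * ((s * u - v) ^ 2 * w))%R.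
  { apply Rmult_le_pos; [apply Rlt_le, Rinv_0_lt_compat; lra|].
    apply Rmult_le_pos; [apply pow2_ge_0|easy]. }
  lra.
Qed.

Lemma allc_mult f g : allc f -> allc g -> allc (fun x => f x * g x).
Proof. intros Hf Hg x. apply econt_mult; auto. Qed.

Lemma allc_RtoC w : Rcont w -> allc (fun x => RtoC (w x)).
Proof. intros H x. apply rcont_RtoC_cont, H. Qed.

Lemma CI_prod_le w f g s a b : weight w -> allc f -> allc g -> (0 < s)%R -> (a <= b)%R ->
  (Cmod (CI (fun x => (f x * g x * RtoC (w x))%C) a b)
     <= s / 2 * RInt (sqw w f) a b + / (2 * s) * RInt (sqw w g) a b)%R.
Proof.
  intros Hw Hf Hg Hs Hab. rewrite <- RInt_lin by now apply Rcont_sqw.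
  apply CI_norm; [easy| | |].
  - apply allc_mult; [now apply allc_mult|apply allc_RtoC, Hw].
  - apply Rcont_plus; apply Rcont_mult; try apply Rcont_const; now apply Rcont_sqw.
  - intros x _. rewrite !Cmod_mult, Cmod_R, Rabs_pos_eq by apply Hw.
    apply prod_le_sq; [easy|apply Hw].
Qed.

Lemma isI_prod_exists w f g X Y : weight w -> allc f -> allc g -> bddI (sqw w f) X -> bddI (sqw w g) Y ->
  exists v, isI (fun x => f x * g x * RtoC (w x)) v.
Proof.
  intros Hw Hf Hg HX HY.
  apply isI_exists with (fun x => 1 / 2 * sqw w f x + / (2 * 1) * sqw w g x)%R (1 / 2 * X + / (2 * 1) * Y)%R.
  - apply allc_mult; [now apply allc_mult|apply allc_RtoC, Hw].
  - apply Rcont_plus; apply Rcont_mult; try apply Rcont_const; now apply Rcont_sqw.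
  - intros x. rewrite !Cmod_mult, Cmod_R, Rabs_pos_eq by apply Hw.
    apply prod_le_sq; [lra|apply Hw].
  - intros a b Hab. rewrite RInt_lin by now apply Rcont_sqw. specialize (HX a b Hab). specialize (HY a b Hab). lra.
Qed.

Lemma amgm_opt (v X Y : R) : (0 <= v)%R -> (0 <= X)%R -> (0 <= Y)%R ->
  (forall s, (0 < s)%R -> (v <= s / 2 * X + / (2 * s) * Y)%R) -> (v ^ 2 <= X * Y)%R.
Proof.
  intros Hv HX HY H.
  (* [X] or [Y] may be 0, so both are raised by [e] before the optimal parameter, the square root of
     [Y / X], is inserted. *)
  assert (K : forall e, (0 < e)%R -> (v ^ 2 <= (X + e) * (Y + e))%R).
  { intros e He. set (p := (X + e)%R). set (q := (Y + e)%R).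
    assert (Pp : (0 < p)%R) by (unfold p; lra). assert (Pq : (0 < q)%R) by (unfold q; lra).
    assert (Sp := sqrt_lt_R0 p Pp). assert (Sq := sqrt_lt_R0 q Pq).
    assert (Ep := sqrt_sqrt p (Rlt_le _ _ Pp)). assert (Eq := sqrt_sqrt q (Rlt_le _ _ Pq)).
    set (a := sqrt p) in *. set (b := sqrt q) in *. assert (Ps : (0 < b / a)%R) by now apply Rdiv_lt_0_compat.
    specialize (H _ Ps).
    assert (v <= b / a / 2 * p + / (2 * (b / a)) * q)%R.
    { eapply Rle_trans; [exact H|]. apply Rplus_le_compat; apply Rmult_le_compat_l.
      - lra.
      - unfold p; lra.
      - apply Rlt_le, Rinv_0_lt_compat. lra.
      - unfold q; lra. }
    assert (Eab : (b / a / 2 * p + / (2 * (b / a)) * q = a * b)%R) by (rewrite <- Ep, <- Eq; field; lra).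
    rewrite Eab in H0. rewrite <- Ep, <- Eq. assert (0 < a * b)%R by now apply Rmult_lt_0_compat. nra. }
  apply Rnot_lt_le. intros h.
  set (e := Rmin 1 ((v ^ 2 - X * Y) / (2 * (X + Y + 1)))).
  assert (Pe : (0 < e)%R) by (apply Rmin_pos; [lra|apply Rdiv_lt_0_compat; lra]).
  assert (E1 : (e <= 1)%R) by apply Rmin_l.
  assert (E2 : (e <= (v ^ 2 - X * Y) / (2 * (X + Y + 1)))%R) by apply Rmin_r. clearbody e.
  apply Rle_div_r in E2; [|lra]. specialize (K e Pe). nra.
Qed.

Lemma bddI_pos g B : bddI g B -> (0 <= B)%R.
Proof.
  intros H. specialize (H 0%R 0%R ltac:(lra)). rewrite (@RInt_point R_CompleteNormedModule) in H. exact H.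
Qed.

Theorem cauchy_schwarz w f g X Y v : weight w -> allc f -> allc g -> bddI (sqw w f) X -> bddI (sqw w g) Y ->
  isI (fun x => f x * g x * RtoC (w x)) v -> (Cmod v ^ 2 <= X * Y)%R.
Proof.
  intros Hw Hf Hg HX HY Hv. apply amgm_opt; [apply Cmod_ge_0|now apply (bddI_pos _ _ HX)|now apply (bddI_pos _ _ HY)|].
  intros s Hs.
  assert (Ac : allc (fun x => f x * g x * RtoC (w x)))
    by (apply allc_mult; [now apply allc_mult|apply allc_RtoC, Hw]).
  apply le_epsilon. intros eps He.
  destruct (proj1 (isI_eps _ v Ac) Hv eps He) as [N HN]. set (M := Rabs N).
  assert (N <= M)%R by apply Rle_abs. assert (0 <= M)%R by apply Rabs_pos.
  specialize (HN (- M)%R M ltac:(lra) ltac:(lra)).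
  assert (B := CI_prod_le w f g s (- M) M Hw Hf Hg Hs ltac:(lra)).
  specialize (HX (- M)%R M ltac:(lra)). specialize (HY (- M)%R M ltac:(lra)).
  rewrite Cmod_sym in HN.
  match type of B with (Cmod ?I <= _)%R => assert (T := Cmod_triangle (v - I) I);
    replace (v - I + I) with v in T by ring end.
  assert (Ps : (0 < / (2 * s))%R) by (apply Rinv_0_lt_compat; lra).
  assert (s / 2 * RInt (sqw w f) (- M) M <= s / 2 * X)%R by (apply Rmult_le_compat_l; lra).
  assert (/ (2 * s) * RInt (sqw w g) (- M) M <= / (2 * s) * Y)%R by (apply Rmult_le_compat_l; lra).
  lra.
Qed.

(** Norm bounds and locally uniform convergence give weak convergence: the tails of the products are
    small uniformly in [n] because the fixed factor [g] alone has small tails. *)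
Theorem weak_limit w (fn : nat -> R -> C) f g X Y vn v :
  weight w -> (forall n, allc (fn n)) -> allc f -> allc g ->
  (forall n, bddI (sqw w (fn n)) X) -> bddI (sqw w f) X -> bddI (sqw w g) Y ->
  (forall r eps, (0 < eps)%R -> exists N, forall n x, (N <= n)%nat -> (Rabs x <= r)%R ->
     (Cmod (fn n x - f x) <= eps)%R) ->
  (forall n, isI (fun x => fn n x * g x * RtoC (w x)) (vn n)) ->
  isI (fun x => f x * g x * RtoC (w x)) v ->
  forall eps, (0 < eps)%R -> exists N, forall n, (N <= n)%nat -> (Cmod (vn n - v) <= eps)%R.
Proof.
  intros Hw Hfn Hf Hg HXn HX HY Hun Hvn Hv eps He.
  assert (X0 := bddI_pos _ _ HX). assert (Y0 := bddI_pos _ _ HY).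
  (* With this parameter the bounded norms cost at most [eps / 16]; the tail of [g] is then taken
     below [eps / 16 * (2 * s)] so that it costs as little. *)
  set (s := (eps / (8 * (X + 1)))%R). assert (Ps : (0 < s)%R) by (apply Rdiv_lt_0_compat; lra).
  assert (Es : (s / 2 * X <= eps / 16)%R).
  { assert (s * (8 * (X + 1)) = eps)%R by (unfold s; field; lra). nra. }
  assert (Pi : (0 < / (2 * s))%R) by (apply Rinv_0_lt_compat; lra).
  assert (Pd : (0 < eps / 16 * (2 * s))%R) by nra.
  destruct (bddI_tail _ Y (Rcont_sqw w g Hw Hg) (fun x => sqw_pos w g x Hw) HY _ Pd) as [N [HN0 HN]].
  assert (Tail : forall h, allc h -> bddI (sqw w h) X -> forall b b', (N <= b)%R -> (b <= b')%R ->
    (Cmod (CI (fun x => (h x * g x * RtoC (w x))%C) b b') <= eps / 8)%R /\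
    (Cmod (CI (fun x => (h x * g x * RtoC (w x))%C) (- b') (- b)) <= eps / 8)%R).
  { intros h Hh HXh b b' Hb Hb'. destruct (HN b b' Hb Hb') as [T1 T2].
    assert (B1 := CI_prod_le w h g s b b' Hw Hh Hg Ps Hb').
    assert (B2 := CI_prod_le w h g s (- b') (- b) Hw Hh Hg Ps ltac:(lra)).
    assert (U1 := HXh b b' Hb'). assert (U2 := HXh (- b')%R (- b)%R ltac:(lra)).
    assert (Ee : (/ (2 * s) * (eps / 16 * (2 * s)) = eps / 16)%R) by (field; lra).
    assert (V1 : (/ (2 * s) * RInt (sqw w g) b b' <= eps / 16)%R) by (rewrite <- Ee; apply Rmult_le_compat_l; lra).
    assert (V2 : (/ (2 * s) * RInt (sqw w g) (- b') (- b) <= eps / 16)%R)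
      by (rewrite <- Ee; apply Rmult_le_compat_l; lra).
    split; nra. }
  assert (Acg : forall h, allc h -> allc (fun x => h x * g x * RtoC (w x)))
    by (intros h Hh; apply allc_mult; [now apply allc_mult|apply allc_RtoC, Hw]).
  assert (Cut : forall h u, allc h -> bddI (sqw w h) X -> isI (fun x => h x * g x * RtoC (w x)) u ->
    (Cmod (CI (fun x => (h x * g x * RtoC (w x))%C) (- N) N - u) <= 3 * (eps / 8))%R).
  { intros h u Hh HXh Hu.
    destruct (proj1 (isI_eps _ u (Acg h Hh)) Hu (eps / 8)%R ltac:(lra)) as [M HM].
    set (M' := Rmax M N). assert (L1 : (M <= M')%R) by apply Rmax_l. assert (L2 : (N <= M')%R) by apply Rmax_r.
    specialize (HM (- M')%R M' ltac:(lra) ltac:(lra)).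
    destruct (Tail h Hh HXh N M' ltac:(lra) L2) as [T1 T2].
    rewrite <- (CI_Chasles _ (- M') (- N) M' (Acg h Hh)), <- (CI_Chasles _ (- N) N M' (Acg h Hh)) in HM.
    set (p := CI (fun x => h x * g x * RtoC (w x)) (- M') (- N)) in *.
    set (q := CI (fun x => h x * g x * RtoC (w x)) N M') in *.
    set (m := CI (fun x => h x * g x * RtoC (w x)) (- N) N) in *.
    replace (m - u) with (((p + (m + q)) - u) - (p + q)) by ring.
    eapply Rle_trans; [apply Cmod_minus_le|]. assert (T := Cmod_triangle p q). lra. }
  set (G := RInt (fun x => (Cmod (g x) * w x)%R) (- N) N).
  assert (Cgw : Rcont (fun x => (Cmod (g x) * w x)%R))
    by (apply Rcont_mult; [intros x; apply rcont_Cmod, Hg|apply Hw]).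
  assert (G0 : (0 <= G)%R).
  { apply RInt_ge0; [easy| |lra]. intros x. apply Rmult_le_pos; [apply Cmod_ge_0|apply Hw]. }
  destruct (Hun N (eps / (8 * (G + 1)))%R) as [n0 Hn0]; [apply Rdiv_lt_0_compat; lra|].
  exists n0. intros n Hn.
  assert (C1 := Cut (fn n) (vn n) (Hfn n) (HXn n) (Hvn n)). assert (C2 := Cut f v Hf HX Hv).
  set (q := (eps / (8 * (G + 1)))%R) in *.
  assert (Pq : (0 < q)%R) by (apply Rdiv_lt_0_compat; lra).
  assert (Mid : (Cmod (CI (fun x => (fn n x * g x * RtoC (w x))%C) (- N) N
     - CI (fun x => (f x * g x * RtoC (w x))%C) (- N) N) <= eps / 8)%R).
  { rewrite <- CI_minus by auto.
    apply Rle_trans with (RInt (fun x => q * (Cmod (g x) * w x) + 0 * 0)%R (- N) N).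
    - apply CI_norm; [lra| | |].
      + intros x. apply econt_minus; apply Acg; auto.
      + apply Rcont_plus; [apply Rcont_mult; [apply Rcont_const|easy]|apply Rcont_const].
      + intros x Hx.
        replace (fn n x * g x * RtoC (w x) - f x * g x * RtoC (w x)) with ((fn n x - f x) * (g x * RtoC (w x))) by ring.
        rewrite !Cmod_mult, Cmod_R, (Rabs_pos_eq (w x)) by apply Hw.
        rewrite Rmult_0_l, Rplus_0_r.
        apply Rmult_le_compat_r; [apply Rmult_le_pos; [apply Cmod_ge_0|apply Hw]|].
        apply Hn0; [easy|]. apply Rabs_le; lra.
    - rewrite (RInt_lin (fun x => Cmod (g x) * w x)%R (fun _ => 0%R)) by (try easy; apply Rcont_const).
      fold G. assert (q * (8 * (G + 1)) = eps)%R by (unfold q; field; lra). nra. }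
  match type of C1 with (Cmod (?a - _) <= _)%R => match type of C2 with (Cmod (?b - _) <= _)%R =>
    replace (vn n - v) with ((a - b) - (a - vn n) + (b - v)) by ring end end.
  eapply Rle_trans; [apply Cmod_triangle|].
  eapply Rle_trans; [apply Rplus_le_compat_r, Cmod_minus_le|]. lra.
Qed.

(** * The contour argument *)

(* The integral along [x0 -> x0 + i Y -> x1 + i Y -> x1]; [Y] may be negative. *)
Definition pth (g : C -> C) (x0 x1 Y : R) : C :=
  Ci * vedge g x0 0 Y + hedge g Y x0 x1 - Ci * vedge g x1 0 Y.

Lemma hedge_pth g x0 x1 Y : hentire g -> hedge g 0 x0 x1 = pth g x0 x1 Y.
Proof.
  intros H. assert (E := cauchy_rect_entire g x0 x1 0 Y H). unfold rect in E. unfold pth.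
  apply Ceq_minus. rewrite <- E. ring.
Qed.

Lemma RInt_exp_decay d H : (0 < d)%R -> (0 <= H)%R -> (RInt (fun y => exp (- d * y))%R 0 H <= / d)%R.
Proof.
  intros Hd HH.
  assert (E : RInt (fun y => exp (- d * y))%R 0 H = (minus (- / d * exp (- d * H)) (- / d * exp (- d * 0)))%R).
  { apply (@is_RInt_unique R_CompleteNormedModule).
    apply (is_RInt_derive (V := R_CompleteNormedModule) (fun y => - / d * exp (- d * y))%R).
    - intros x _. auto_derive; [easy|]. field. lra.
    - intros x _. apply (ex_derive_continuous (V := R_NormedModule)). auto_derive. easy. }
  rewrite E. unfold minus, plus, opp; simpl. rewrite Rmult_0_r, exp_0.
  assert (0 < / d)%R by now apply Rinv_0_lt_compat. assert (P := exp_pos (- d * H)). nra.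
Qed.

(** The sign [s] is the direction of travel, up or down, so that both half planes share one
    estimate. *)
Lemma vedge_decay g x s H A d : (s = 1 \/ s = -1)%R -> (0 < d)%R -> (0 <= H)%R ->
  allc (fun y => g (x, y)) ->
  (forall y, (0 <= y <= H)%R -> (Cmod (g (x, (s * y)%R)) <= A * exp (- d * y))%R) ->
  (Cmod (vedge g x 0 (s * H)) <= A / d)%R.
Proof.
  intros Hs Hd HH Hc HA.
  assert (A0 : (0 <= A)%R).
  { specialize (HA 0%R ltac:(lra)). rewrite Rmult_0_r, Rmult_0_r, exp_0 in HA.
    generalize (Cmod_ge_0 (g (x, 0%R))). lra. }
  assert (E : vedge g x 0 (s * H) = CI (fun y => RtoC s * g (x, (s * y + 0)%R)) 0 H).
  { rewrite (CI_comp_lin (fun y => g (x, y)) s 0 0 H) by easy. unfold vedge. f_equal; ring. }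
  rewrite E.
  assert (Cexp_c : Rcont (fun y => exp (- d * y))%R).
  { intros y. apply (ex_derive_continuous (V := R_NormedModule)). auto_derive. easy. }
  apply Rle_trans with (RInt (fun y => A * exp (- d * y) + 0 * 0)%R 0 H).
  - apply CI_norm; [easy| | |].
    + apply allc_scal. apply (allc_lin (fun y => g (x, y))). easy.
    + apply Rcont_plus; [apply Rcont_mult; [apply Rcont_const|easy]|apply Rcont_const].
    + intros y Hy. rewrite Cmod_mult, Cmod_R.
      replace (Rabs s) with 1%R by (destruct Hs as [-> | ->]; [now rewrite Rabs_R1|rewrite Rabs_left; lra]).
      rewrite Rplus_0_r. specialize (HA y Hy). lra.
  - rewrite (RInt_lin (fun y => exp (- d * y))%R (fun _ => 0%R)) by (try easy; apply Rcont_const).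
    assert (B := RInt_exp_decay d H Hd HH). unfold Rdiv. nra.
Qed.

Section Box.
Variables (F : C -> C) (K t : R) (c : C).
Hypothesis (HF : hentire F) (Ht : (0 <= t)%R).
Hypothesis Hgr : forall z, (Cmod (F z) <= K * exp (t * Rabs (Im z)))%R.

Lemma box_K_pos : (0 <= K)%R.
Proof.
  assert (H := Hgr 0). simpl in H. rewrite Rabs_R0, Rmult_0_r, exp_0 in H.
  generalize (Cmod_ge_0 (F 0)). lra.
Qed.

Lemma box_allc_h (g : C -> C) y : centire g -> y <> Im c -> allc (fun x => g (x, y) * / ((x, y) - c)).
Proof.
  intros Hg Hy. apply allc_mult; [now apply allc_h|]. intros x.
  apply econt_inv.
  - intros E. apply (f_equal Im) in E. simpl in E. unfold Im in *. lra.
  - apply econt_minus; [apply hpoint_cont|apply econt_const].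
Qed.

Lemma box_allc_v (g : C -> C) x : centire g -> x <> Re c -> allc (fun y => g (x, y) * / ((x, y) - c)).
Proof.
  intros Hg Hy. apply allc_mult; [now apply allc_v|]. intros y.
  apply econt_inv.
  - intros E. apply (f_equal Re) in E. simpl in E. unfold Re in *. lra.
  - apply econt_minus; [apply vpoint_cont|apply econt_const].
Qed.

(** In the half plane of sign [s] the factor exp (i s l (z - c)) decays faster than [F] grows, so
    along the detour only the part [- F / (z - c)] of the integrand survives. In the bound,
    [/ (r * (l - t))] comes from the vertical sides and the exponential from the horizontal one. *)
Lemma box_half l s r : (s = 1 \/ s = -1)%R -> (t < l)%R -> (Rabs (Im c) < r)%R ->
  (Cmod (hedge (fun z => (F z * Eb (s * l) c z)%C) 0 (Re c - r) (Re c + r)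
     + pth (fun z => (F z * / (z - c))%C) (Re c - r) (Re c + r) (Im c + s * r))
   <= 2 * K * exp (l * Rabs (Im c)) * (/ (r * (l - t)) + exp (- (l - t) * (r - Rabs (Im c)))))%R.
Proof.
  intros Hs Hl Hr. assert (HK := box_K_pos).
  set (u := Re c). set (v := Im c). set (Y := (v + s * r)%R).
  assert (Rv := Rabs_pos v). fold v in Hr.
  set (H := (r + s * v)%R).
  assert (EY : Y = (s * H)%R) by (unfold Y, H; destruct Hs as [-> | ->]; ring).
  assert (V1 := Rle_abs v). assert (V2 := Rle_abs (- v)). rewrite Rabs_Ropp in V2.
  assert (HH : (r - Rabs v <= H)%R) by (unfold H; destruct Hs as [-> | ->]; lra).
  assert (HH0 : (0 < H)%R) by lra.
  set (e := fun z => F z * Cexp (Ci * RtoC (s * l) * (z - c))).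
  assert (He : hentire e) by (intros z; unfold e; holo_tac).
  assert (Ce := hentire_centire e He). assert (CF := hentire_centire F HF).
  assert (NY : Y <> Im c) by (fold v; unfold Y; destruct Hs as [-> | ->]; lra).
  assert (Nx0 : (u - r)%R <> Re c) by (fold u; lra).
  assert (Nx1 : (u + r)%R <> Re c) by (fold u; lra).
  assert (Off : forall z, z <> c -> F z * Eb (s * l) c z = e z * / (z - c) - F z * / (z - c)).
  { intros z Hz. rewrite Eb_off by easy. unfold e. field. now apply Cminus_eq_contra. }
  rewrite (hedge_pth _ (u - r) (u + r) Y) by (intros z; apply holo_mult; [apply HF|apply hentire_Eb]).
  assert (Epth : pth (fun z => F z * Eb (s * l) c z) (u - r) (u + r) Y
    = pth (fun z => e z * / (z - c)) (u - r) (u + r) Y - pth (fun z => F z * / (z - c)) (u - r) (u + r) Y).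
  { unfold pth.
    assert (Ev : forall x, x <> Re c -> vedge (fun z => F z * Eb (s * l) c z) x 0 Y
      = vedge (fun z => e z * / (z - c)) x 0 Y - vedge (fun z => F z * / (z - c)) x 0 Y).
    { intros x Hx. unfold vedge. rewrite <- CI_minus by (now apply box_allc_v).
      apply CI_ext. intros y _. apply Off. intros E. apply Hx. now rewrite <- E. }
    assert (Eh : hedge (fun z => F z * Eb (s * l) c z) Y (u - r) (u + r)
      = hedge (fun z => e z * / (z - c)) Y (u - r) (u + r) - hedge (fun z => F z * / (z - c)) Y (u - r) (u + r)).
    { unfold hedge. rewrite <- CI_minus by (now apply box_allc_h).
      apply CI_ext. intros x _. apply Off. intros E. apply NY. now rewrite <- E. }
    rewrite !Ev, Eh by easy. ring. }
  rewrite Epth.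
  match goal with |- (Cmod (?a - ?b + ?b) <= _)%R => replace (a - b + b) with a by ring end.
  set (el := exp (l * Rabs v)).
  assert (Pel : (0 < el)%R) by apply exp_pos.
  assert (Be : forall x y, (0 <= y)%R -> (r <= Cmod ((x, (s * y)%R) - c))%R ->
    (Cmod (e (x, (s * y)%R) * / ((x, (s * y)%R) - c)) <= K * el / r * exp (- (l - t) * y))%R).
  { intros x y Hy Hdist.
    assert (N : (x, (s * y)%R) - c <> 0) by (apply Cmod_gt_0; lra).
    rewrite Cmod_mult, Cmod_inv by easy. unfold e. rewrite Cmod_mult, Cmod_Cexp.
    replace (Re (Ci * RtoC (s * l) * ((x, (s * y)%R) - c))) with (- l * y + l * (s * v))%R.
    2: { unfold v. destruct c as [cu cv]; simpl. destruct Hs as [-> | ->]; ring. }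
    assert (G := Hgr (x, (s * y)%R)). simpl Im in G.
    assert (As : Rabs (s * y) = y).
    { destruct Hs as [-> | ->]; [rewrite Rmult_1_l; now apply Rabs_pos_eq|].
      replace (-1 * y)%R with (- y)%R by ring. rewrite Rabs_Ropp. now apply Rabs_pos_eq. }
    rewrite As in G.
    assert (Le : (exp (- l * y + l * (s * v)) <= exp (- l * y) * el)%R).
    { unfold el. rewrite <- exp_plus. apply exp_le. apply Rplus_le_compat_l. apply Rmult_le_compat_l; [lra|].
      destruct Hs as [-> | ->]; lra. }
    assert (Li : (/ Cmod ((x, (s * y)%R) - c) <= / r)%R) by (apply Rinv_le_contravar; lra).
    apply Rle_trans with (K * exp (t * y) * (exp (- l * y) * el) * / r)%R.
    - apply Rmult_le_compat; try easy.
      + apply Rmult_le_pos; [apply Cmod_ge_0|apply Rlt_le, exp_pos].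
      + apply Rlt_le, Rinv_0_lt_compat. lra.
      + apply Rmult_le_compat; try easy; [apply Cmod_ge_0|apply Rlt_le, exp_pos].
    - right. replace (- (l - t) * y)%R with (t * y + - l * y)%R by ring. rewrite exp_plus. field. lra. }
  assert (Dv : forall x y, (Rabs (x - u) = r)%R -> (r <= Cmod ((x, y) - c))%R).
  { intros x y Hx. assert (Q := re_le_Cmod ((x, y) - c)).
    change (Re ((x, y) - c)) with (x - u)%R in Q. lra. }
  assert (B0 : (Cmod (vedge (fun z => (e z * / (z - c))%C) (u - r) 0 (s * H)) <= K * el / r / (l - t))%R).
  { apply vedge_decay; try easy; [lra|lra|now apply box_allc_v|]. intros y Hy. apply Be; [lra|].
    apply Dv. rewrite Rabs_left; lra. }
  assert (B1 : (Cmod (vedge (fun z => (e z * / (z - c))%C) (u + r) 0 (s * H)) <= K * el / r / (l - t))%R).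
  { apply vedge_decay; try easy; [lra|lra|now apply box_allc_v|]. intros y Hy. apply Be; [lra|].
    apply Dv. rewrite Rabs_pos_eq; lra. }
  assert (B2 : (Cmod (hedge (fun z => (e z * / (z - c))%C) Y (u - r) (u + r))
     <= K * el / r * exp (- (l - t) * (r - Rabs v)) * (u + r - (u - r)))%R).
  { apply CI_bound; [lra|now apply box_allc_h|]. intros x Hx. rewrite EY.
    eapply Rle_trans; [apply Be; [lra|]|].
    - assert (Q := Im_le_Cmod ((x, (s * H)%R) - c)).
      change (Im ((x, (s * H)%R) - c)) with (s * H - v)%R in Q.
      assert (Rabs (s * H - v) = r)%R; [|lra].
      unfold H. destruct Hs as [-> | ->].
      + replace (1 * (r + 1 * v) - v)%R with r by ring. apply Rabs_pos_eq. lra.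
      + replace (-1 * (r + -1 * v) - v)%R with (- r)%R by ring. rewrite Rabs_Ropp. apply Rabs_pos_eq. lra.
    - apply Rmult_le_compat_l.
      + apply Rcomplements.Rdiv_le_0_compat; [nra|lra].
      + apply exp_le. nra. }
  unfold pth. rewrite EY at 1 3.
  eapply Rle_trans; [apply Cmod_minus_le|].
  eapply Rle_trans; [apply Rplus_le_compat_r, Cmod_triangle|].
  rewrite !Cmod_mult, Cmod_Ci, !Rmult_1_l.
  set (X := exp (- (l - t) * (r - Rabs v))) in *.
  replace (2 * K * el * (/ (r * (l - t)) + X))%R
    with (K * el / r / (l - t) + K * el / r * X * (u + r - (u - r)) + K * el / r / (l - t))%R by (field; lra).
  lra.
Qed.

Lemma box_small l : (t < l)%R -> forall eps, (0 < eps)%R -> exists N, forall r, (N <= r)%R ->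
  (Rabs (Im c) < r)%R /\
  (2 * K * exp (l * Rabs (Im c)) * (/ (r * (l - t)) + exp (- (l - t) * (r - Rabs (Im c)))) <= eps)%R.
Proof.
  intros Hl eps He. assert (HK := box_K_pos). set (v := Rabs (Im c)). assert (Hv : (0 <= v)%R) by apply Rabs_pos.
  set (A := (2 * K * exp (l * v))%R). assert (HA : (0 <= A)%R) by (unfold A; generalize (exp_pos (l * v)); nra).
  set (N := (v + 1 + 2 * A / ((l - t) * eps))%R).
  assert (Q : (0 <= 2 * A / ((l - t) * eps))%R) by (apply Rcomplements.Rdiv_le_0_compat; nra).
  exists N. intros r Hr. unfold N in Hr. split; [lra|].
  set (d := (l - t)%R) in *. assert (Hd : (0 < d)%R) by (unfold d; lra).
  assert (Pv : (0 < r - v)%R) by lra.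
  (* exp (-x) is at most 1/x, which turns both terms into multiples of [/ ((r - v) * d)] and makes
     [N] explicit. *)
  assert (E1 : (exp (- d * (r - v)) <= / ((r - v) * d))%R).
  { replace (- d * (r - v))%R with (- ((r - v) * d))%R by ring. rewrite exp_Ropp.
    assert (P : (0 < (r - v) * d)%R) by nra.
    apply Rinv_le_contravar; [easy|]. generalize (exp_ineq1_le ((r - v) * d)). lra. }
  assert (E2 : (/ (r * d) <= / ((r - v) * d))%R).
  { apply Rinv_le_contravar; [nra|]. nra. }
  assert (E3 : (A * (2 * / ((r - v) * d)) <= eps)%R).
  { replace (A * (2 * / ((r - v) * d)))%R with (2 * A / ((r - v) * d))%R by (field; split; lra).
    apply Rle_div_l; [nra|].
    assert (2 * A / (d * eps) <= r - v)%R by lra. apply Rle_div_l in H; [|nra]. nra. }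
  eapply Rle_trans; [|exact E3]. apply Rmult_le_compat_l; [easy|lra].
Qed.

(** The upper and lower detours together bound a square around [c], where Cauchy's formula applies
    with the known value 2 pi i. *)
Lemma box_square r : (Rabs (Im c) < r)%R ->
  pth (fun z => F z * / (z - c)) (Re c - r) (Re c + r) (Im c - r)
  - pth (fun z => F z * / (z - c)) (Re c - r) (Re c + r) (Im c + r) = 2 * piC * Ci * F c.
Proof.
  intros Hr. assert (Hr0 : (0 < r)%R) by (generalize (Rabs_pos (Im c)); lra).
  assert (Hin : inside c (Re c - r) (Re c + r) (Im c - r) (Im c + r)) by (unfold inside; lra).
  assert (E := cauchy_formula F c _ _ _ _ HF Hin). rewrite winding_square in E by easy.
  transitivity (F c * (2 * piC * Ci)); [|ring]. rewrite <- E. unfold rect, pth.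
  assert (CF := hentire_centire F HF).
  assert (Ev : forall x, x <> Re c -> vedge (fun z => F z * / (z - c)) x (Im c - r) (Im c + r)
    = vedge (fun z => F z * / (z - c)) x 0 (Im c + r) - vedge (fun z => F z * / (z - c)) x 0 (Im c - r)).
  { intros x Hx. unfold vedge.
    rewrite <- (CI_Chasles _ 0 (Im c - r) (Im c + r)) by now apply box_allc_v. ring. }
  rewrite !Ev by lra. ring.
Qed.

(** The strict inequalities make the error along both detours vanish as the box grows; frequencies
    equal to the type are reached later by dilating [F]. *)
Theorem box_reproduce l m v u : (t < l)%R -> (t < m)%R ->
  isI (fun x => F (RtoC x) * Eb l c (RtoC x)) v -> isI (fun x => F (RtoC x) * Eb (- m) c (RtoC x)) u ->
  v - u = 2 * piC * Ci * F c.
Proof.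
  intros Hl Hm Hv Hu. apply Cmod_small_eq. intros eps He.
  assert (CF := hentire_centire F HF).
  assert (Ac : forall l, allc (fun x => F (RtoC x) * Eb l c (RtoC x))).
  { intros k. apply (allc_h (fun z => F z * Eb k c z) 0).
    intros z. apply econt_mult; [apply CF|apply hentire_centire, hentire_Eb]. }
  destruct (box_small l Hl (eps / 4)%R ltac:(lra)) as [N1 H1].
  destruct (box_small m Hm (eps / 4)%R ltac:(lra)) as [N2 H2].
  destruct (isI_sym_lim _ v (Re c) (Ac l) Hv (eps / 4)%R ltac:(lra)) as [N3 H3].
  destruct (isI_sym_lim _ u (Re c) (Ac (- m)%R) Hu (eps / 4)%R ltac:(lra)) as [N4 H4].
  set (r := Rmax (Rmax N1 N2) (Rmax N3 N4)).
  assert (L1 : (N1 <= r)%R) by (eapply Rle_trans; [apply Rmax_l|apply Rmax_l]).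
  assert (L2 : (N2 <= r)%R) by (eapply Rle_trans; [apply Rmax_r|apply Rmax_l]).
  assert (L3 : (N3 <= r)%R) by (eapply Rle_trans; [apply Rmax_l|apply Rmax_r]).
  assert (L4 : (N4 <= r)%R) by (eapply Rle_trans; [apply Rmax_r|apply Rmax_r]).
  clearbody r. destruct (H1 r L1) as [Hr S1]. destruct (H2 r L2) as [_ S2].
  specialize (H3 r L3). specialize (H4 r L4).
  assert (B1 := box_half l 1 r ltac:(lra) Hl Hr). assert (B2 := box_half m (-1) r ltac:(lra) Hm Hr).
  replace (1 * l)%R with l in B1 by ring. replace (-1 * m)%R with (- m)%R in B2 by ring.
  replace (Im c + 1 * r)%R with (Im c + r)%R in B1 by ring.
  replace (Im c + -1 * r)%R with (Im c - r)%R in B2 by ring.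
  rewrite <- (box_square r Hr).
  set (p1 := pth _ _ _ (Im c - r)) in *. set (p2 := pth _ _ _ (Im c + r)) in *.
  set (h1 := hedge (fun z => F z * Eb l c z) 0 (Re c - r) (Re c + r)) in *.
  set (h2 := hedge (fun z => F z * Eb (- m) c z) 0 (Re c - r) (Re c + r)) in *.
  change (CI (fun x => F (RtoC x) * Eb l c (RtoC x)) (Re c - r) (Re c + r)) with h1 in H3.
  change (CI (fun x => F (RtoC x) * Eb (- m) c (RtoC x)) (Re c - r) (Re c + r)) with h2 in H4.
  replace (v - u - (p1 - p2)) with ((h1 + p2) - (h2 + p1) - (h1 - v) + (h2 - u)) by ring.
  eapply Rle_trans; [apply Cmod_triangle|].
  eapply Rle_trans; [apply Rplus_le_compat_r, Cmod_minus_le|].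
  eapply Rle_trans; [apply Rplus_le_compat_r, Rplus_le_compat_r, Cmod_minus_le|]. lra.
Qed.
End Box.

(** * The reproducing formula for Paley-Wiener functions *)

Definition unitw (_ : R) : R := 1%R.

(** The unweighted Paley-Wiener space. It has the same elements as the weighted space, since the
    weight is bounded above and away from 0. *)
Definition pw (tau : R) (F : C -> C) : Prop :=
  hentire F /\ exp_type_le F tau /\ exists B, bddI (sqw unitw (fun x => F (RtoC x))) B.

Lemma weight_unitw : weight unitw.
Proof. split; [intros x; apply continuous_const|intros; unfold unitw; lra]. Qed.

Lemma allc_real f : centire f -> allc (fun x => f (RtoC x)).
Proof. intros H. exact (allc_h f 0 H). Qed.

Lemma decay_bddI g A : allc g -> (forall x, (Cmod (g x) ^ 2 <= A / (1 + x ^ 2))%R) ->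
  bddI (sqw unitw g) (A * PI).
Proof.
  intros Hg HA a b Hab.
  assert (A0 : (0 <= A)%R).
  { specialize (HA 0%R). replace (A / (1 + 0 ^ 2))%R with A in HA by field. generalize (pow2_ge_0 (Cmod (g 0%R))). lra. }
  assert (E : is_RInt (fun x => A / (1 + x ^ 2))%R a b (minus (A * atan b) (A * atan a))%R).
  { apply (is_RInt_derive (V := R_CompleteNormedModule) (fun x => A * atan x)%R).
    - intros x _. auto_derive; [easy|]. assert (0 <= x * x)%R by apply Rle_0_sqr. field. nra.
    - intros x _. apply (ex_derive_continuous (V := R_NormedModule)). auto_derive.
      assert (0 <= x * x)%R by apply Rle_0_sqr. nra. }
  assert (E2 := is_RInt_unique (V := R_CompleteNormedModule) _ _ _ _ E).
  apply Rle_trans with (RInt (fun x => A / (1 + x ^ 2))%R a b).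
  - apply RInt_le; [easy|apply ex_RInt_allR, (Rcont_sqw unitw g weight_unitw Hg)|eexists; exact E|].
    intros x _. unfold sqw, unitw. rewrite Rmult_1_r. apply HA.
  - rewrite E2. unfold minus, plus, opp; simpl. assert (T1 := atan_bound a). assert (T2 := atan_bound b). nra.
Qed.

Lemma Eb_bddI l c : exists B, bddI (sqw unitw (fun x => Eb l c (RtoC x))) B.
Proof.
  destruct (Eb_decay l c) as [A HA]. exists (A * PI)%R. apply decay_bddI; [|easy].
  apply allc_real, hentire_centire, hentire_Eb.
Qed.

(** * Averages over short windows *)

Lemma RInt_extR (f g : R -> R) a b : (forall x, f x = g x) -> @eq R (RInt f a b) (RInt g a b).
Proof. intros H. apply (RInt_ext (V := R_CompleteNormedModule)). intros x _. apply H. Qed.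

Lemma RInt_constR (c a b : R) : @eq R (RInt (fun _ => c) a b) ((b - a) * c)%R.
Proof. apply (@RInt_const R_CompleteNormedModule). Qed.

Lemma CI_sq_le f a b : allc f -> (a <= b)%R ->
  (Cmod (CI f a b) ^ 2 <= (b - a) * RInt (sqw unitw f) a b)%R.
Proof.
  intros Hf Hab. rewrite Rmult_comm. apply amgm_opt.
  - apply Cmod_ge_0.
  - apply RInt_ge0; [(apply Rcont_sqw; [exact weight_unitw|easy])|intros x; apply sqw_pos, weight_unitw|easy].
  - lra.
  - intros s Hs. assert (B := CI_prod_le unitw f (fun _ => 1) s a b weight_unitw Hf ltac:(intros x; apply econt_const) Hs Hab).
    rewrite (CI_ext (fun x => f x * 1 * RtoC (unitw x)) f) in B by (intros; unfold unitw; ring).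
    replace (RInt (sqw unitw (fun _ => 1)) a b) with (b - a)%R in B; [easy|].
    rewrite (RInt_extR _ (fun _ => 1%R)); [rewrite RInt_constR; ring|].
    intros x. unfold sqw, unitw. rewrite Cmod_1. ring.
Qed.

(** Fubini's theorem done by hand: with an antiderivative [Q] of [q] the double integral collapses
    to integrals of [Q] over two windows of length [h], and [Q] is monotone with total increase at
    most [B]. *)
Lemma window_average (q : R -> R) B r h : Rcont q -> (forall x, (0 <= q x)%R) -> bddI q B ->
  (0 < r)%R -> (0 < h)%R ->
  Rcont (fun x => RInt q (r * x) (r * x + h)) /\
  bddI (fun x => RInt q (r * x) (r * x + h)) (h * (B / r)).
Proof.
  intros Hq H0 HB Hr Hh.
  set (Q := (fun x => RInt q 0 x) : R -> R).
  assert (DQ : forall x, is_derive Q x (q x)).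
  { intros x. apply (is_derive_RInt (V := R_NormedModule) q Q 0 x).
    - exists (mkposreal 1 Rlt_0_1). intros y _. apply (@RInt_correct R_CompleteNormedModule). now apply ex_RInt_allR.
    - apply Hq. }
  assert (CQ : Rcont Q) by (intros x; apply (ex_derive_continuous (V := R_NormedModule)); eexists; apply DQ).
  assert (EQ : forall a b, @eq R (RInt q a b) (Q b - Q a)%R)
    by (intros a b; unfold Q; rewrite <- (RInt_add q 0 a b Hq); lra).
  assert (MQ : forall a b, (a <= b)%R -> (Q a <= Q b)%R)
    by (intros a b Hab; generalize (RInt_ge0 q a b Hq H0 Hab); rewrite EQ; lra).
  assert (Lin : forall k, Rcont (fun x => Q (r * x + k)%R)).
  { intros k x. apply (continuous_comp (fun x => r * x + k)%R Q); [|apply CQ].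
    apply (ex_derive_continuous (V := R_NormedModule)). auto_derive. easy. }
  assert (Ew : forall x, @eq R (RInt q (r * x) (r * x + h)) (1 * Q (r * x + h) + -1 * Q (r * x + 0))%R)
    by (intros x; rewrite EQ, Rplus_0_r; lra).
  assert (Cw : Rcont (fun x => (1 * Q (r * x + h) + -1 * Q (r * x + 0))%R))
    by (apply Rcont_plus; apply Rcont_mult; try apply Rcont_const; apply Lin).
  split.
  - intros x. apply continuous_ext with (fun x => (1 * Q (r * x + h) + -1 * Q (r * x + 0))%R); [|apply Cw].
    intros y. now rewrite Ew.
  - intros a b Hab.
    rewrite (RInt_extR _ (fun x => (1 * Q (r * x + h) + -1 * Q (r * x + 0))%R)) by apply Ew.
    rewrite (RInt_lin (fun x => Q (r * x + h)%R) (fun x => Q (r * x + 0)%R)) by apply Lin.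
    assert (Sub : forall k, @eq R (RInt (fun x => Q (r * x + k)%R) a b) (/ r * RInt Q (r * a + k) (r * b + k))%R).
    { intros k.
      assert (S1 : @eq R (RInt (fun y => r * Q (r * y + k) + 0 * 0)%R a b) (RInt Q (r * a + k) (r * b + k))).
      { rewrite <- (RInt_comp_lin (V := R_CompleteNormedModule) Q r k a b) by now apply ex_RInt_allR.
        apply RInt_extR. intros y. change (r * Q (r * y + k) + 0 * 0 = r * Q (r * y + k))%R. ring. }
      rewrite <- S1, (RInt_lin (fun y => Q (r * y + k)%R) (fun _ => 0%R)) by (try apply Lin; apply Rcont_const).
      set (I := RInt (fun y => Q (r * y + k)%R) a b : R). change (I = / r * (r * I + 0 * RInt (fun _ => 0%R) a b))%R.
      field. lra. }
    rewrite !Sub, !Rplus_0_r.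
    assert (Ch : @eq R (RInt Q (r * a + h) (r * b + h)) (RInt Q (r * a) (r * b)
      + RInt Q (r * b) (r * b + h) - RInt Q (r * a) (r * a + h))%R).
    { rewrite <- (RInt_add Q (r * a) (r * a + h) (r * b) CQ).
      rewrite <- (RInt_add Q (r * a + h) (r * b) (r * b + h) CQ). lra. }
    assert (U1 : (RInt Q (r * b) (r * b + h) <= h * Q (r * b + h))%R).
    { apply Rle_trans with (RInt (fun _ => Q (r * b + h)%R) (r * b) (r * b + h)).
      - apply RInt_le; try (apply ex_RInt_allR; [apply CQ|apply Rcont_const]); try lra.
        + now apply ex_RInt_allR.
        + apply ex_RInt_allR, Rcont_const.
        + intros x Hx. apply MQ. lra.
      - rewrite RInt_constR. right. ring. }
    assert (U2 : (h * Q (r * a) <= RInt Q (r * a) (r * a + h))%R).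
    { apply Rle_trans with (RInt (fun _ => Q (r * a)%R) (r * a) (r * a + h)).
      - rewrite RInt_constR. right. ring.
      - apply RInt_le; try lra.
        + apply ex_RInt_allR, Rcont_const.
        + now apply ex_RInt_allR.
        + intros x Hx. apply MQ. lra. }
    assert (Tot : (Q (r * b + h) - Q (r * a) <= B)%R).
    { rewrite <- EQ. apply HB. nra. }
    rewrite Ch.
    replace (1 * (/ r * (RInt Q (r * a) (r * b) + RInt Q (r * b) (r * b + h) - RInt Q (r * a) (r * a + h)))
      + -1 * (/ r * RInt Q (r * a) (r * b)))%R
      with (/ r * (RInt Q (r * b) (r * b + h) - RInt Q (r * a) (r * a + h)))%R by ring.
    replace (h * (B / r))%R with (/ r * (h * B))%R by (field; lra).
    apply Rmult_le_compat_l; [apply Rlt_le, Rinv_0_lt_compat; lra|]. nra.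
Qed.

(* The dilation makes the type strictly smaller, the averaging makes the function bounded on
   the real line. *)
Definition moll (F : C -> C) (r h : R) (z : C) : C :=
  / RtoC h * (prim F (RtoC r * z + RtoC h) - prim F (RtoC r * z)).

Section Moll.
Variables (F : C -> C) (r h : R).
Hypothesis (HF : hentire F) (Hr : (0 < r)%R) (Hh : (0 < h)%R).

Lemma RtoC_nz x : x <> 0%R -> RtoC x <> 0.
Proof. intros H E. apply H. now apply RtoC_inj. Qed.

Lemma hentire_moll : hentire (moll F r h).
Proof.
  intros z. unfold moll. apply (holo_mult (fun _ => / RtoC h)); [apply holo_const|].
  apply (holo_minus (fun z => prim F (RtoC r * z + RtoC h)) (fun z => prim F (RtoC r * z))).
  - apply (holo_comp (prim F) (fun z => RtoC r * z + RtoC h)); [|holo_tac].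
    eexists. now apply hasd_prim.
  - apply (holo_comp (prim F) (fun z => RtoC r * z)); [|holo_tac].
    eexists. now apply hasd_prim.
Qed.

Lemma moll_CI z : moll F r h z
  = / RtoC h * CI (fun s => F (s, (r * Im z)%R)) (r * Re z) (r * Re z + h).
Proof.
  unfold moll. f_equal. rewrite prim_diff by easy.
  replace (Re (RtoC r * z)) with (r * Re z)%R by (destruct z; simpl; ring).
  replace (Im (RtoC r * z)) with (r * Im z)%R by (destruct z; simpl; ring).
  replace (Re (RtoC r * z + RtoC h)) with (r * Re z + h)%R by (destruct z; simpl; ring).
  replace (Im (RtoC r * z + RtoC h)) with (r * Im z)%R by (destruct z; simpl; ring).
  unfold vedge. rewrite CI_point. unfold hedge. ring.
Qed.

(** An average is close to [w] when all averaged values are. With [w] equal to 0 this bounds growth,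
    with [w] a value of [F] it gives convergence. *)
Lemma moll_near z w eps : (0 <= eps)%R ->
  (forall s, (0 <= s <= h)%R -> (Cmod (F ((r * Re z + s)%R, (r * Im z)%R) - w) <= eps)%R) ->
  (Cmod (moll F r h z - w) <= eps)%R.
Proof.
  intros He H. rewrite moll_CI. assert (CF := hentire_centire F HF).
  assert (Nh : RtoC h <> 0) by (apply RtoC_nz; lra).
  assert (Ac : allc (fun s => F (s, (r * Im z)%R))) by now apply allc_h.
  replace (/ RtoC h * CI (fun s => F (s, (r * Im z)%R)) (r * Re z) (r * Re z + h) - w)
    with (/ RtoC h * CI (fun s => F (s, (r * Im z)%R) - w) (r * Re z) (r * Re z + h)).
  - rewrite Cmod_mult, Cmod_inv, Cmod_R, Rabs_pos_eq by (try easy; lra).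
    apply (Rmult_le_reg_l h); [easy|]. rewrite <- Rmult_assoc, Rinv_r, Rmult_1_l by lra.
    replace (h * eps)%R with (eps * (r * Re z + h - r * Re z))%R by ring.
    apply CI_bound; [lra| |].
    + intros s. apply econt_minus; [apply Ac|apply econt_const].
    + intros s Hs. replace s with (r * Re z + (s - r * Re z))%R by ring. apply H. lra.
  - rewrite (CI_minus (fun s => F (s, (r * Im z)%R)) (fun _ => w)) by (try easy; intros s; apply econt_const).
    rewrite CI_const. replace (r * Re z + h - r * Re z)%R with h by ring. field. easy.
Qed.

Lemma moll_growth M T z : (0 <= T)%R -> (h <= 1)%R ->
  (forall w, (Cmod (F w) <= M * exp (T * Cmod w))%R) ->
  (Cmod (moll F r h z) <= M * exp T * exp (T * r * Cmod z))%R.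
Proof.
  intros HT Hh1 Hgr.
  assert (M0 : (0 <= M)%R).
  { assert (Q := Hgr 0). rewrite Cmod_0, Rmult_0_r, exp_0 in Q. generalize (Cmod_ge_0 (F 0)). lra. }
  replace (moll F r h z) with (moll F r h z - 0) by ring. apply moll_near.
  { apply Rmult_le_pos; [apply Rmult_le_pos; [easy|]|]; apply Rlt_le, exp_pos. }
  intros s Hs. match goal with |- (Cmod (Cminus ?a ?b) <= _)%R => replace (Cminus a b) with a by ring end.
  eapply Rle_trans; [apply Hgr|].
  rewrite Rmult_assoc, <- exp_plus. apply Rmult_le_compat_l; [easy|]. apply exp_le.
  replace ((r * Re z + s)%R, (r * Im z)%R) with (RtoC r * z + RtoC s) by (destruct z; apply Ceq; simpl; ring).
  assert (Q := Cmod_triangle (RtoC r * z) (RtoC s)).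
  rewrite Cmod_mult, !Cmod_R, !Rabs_pos_eq in Q by lra. nra.
Qed.

Lemma moll_sq (x : R) : (Cmod (moll F r h x) ^ 2
  <= / h * RInt (sqw unitw (fun s => F (RtoC s))) (r * x) (r * x + h))%R.
Proof.
  assert (CF := hentire_centire F HF).
  rewrite moll_CI. simpl Re. simpl Im. rewrite Rmult_0_r.
  assert (Ac : allc (fun s => F (RtoC s))) by now apply allc_real.
  assert (Q := CI_sq_le (fun s => F (RtoC s)) (r * x) (r * x + h) Ac ltac:(lra)).
  replace (r * x + h - r * x)%R with h in Q by ring.
  change (CI (fun s => F (s, 0%R)) (r * x) (r * x + h)) with (CI (fun s => F (RtoC s)) (r * x) (r * x + h)).
  rewrite Cmod_mult, Cmod_inv, Cmod_R, Rabs_pos_eq by (try apply RtoC_nz; lra).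
  rewrite Rpow_mult_distr. apply Rle_trans with ((/ h) ^ 2 * (h * RInt (sqw unitw (fun s => F (RtoC s))) (r * x) (r * x + h)))%R.
  - apply Rmult_le_compat_l; [apply pow2_ge_0|easy].
  - right. field. lra.
Qed.

Lemma moll_bddI B : bddI (sqw unitw (fun x => F (RtoC x))) B ->
  bddI (sqw unitw (fun x => moll F r h (RtoC x))) (B / r).
Proof.
  intros HB. assert (CF := hentire_centire F HF).
  assert (Ac : allc (fun s => F (RtoC s))) by now apply allc_real.
  destruct (window_average (sqw unitw (fun s => F (RtoC s))) B r h) as [W1 W2]; try easy.
  { (apply Rcont_sqw; [exact weight_unitw|easy]). }
  { intros x. apply sqw_pos, weight_unitw. }
  intros a b Hab.
  apply Rle_trans with (RInt (fun x => / h * RInt (sqw unitw (fun s => F (RtoC s))) (r * x) (r * x + h) + 0 * 0)%R a b).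
  - apply RInt_mono; [| |easy|].
    + apply Rcont_sqw; [apply weight_unitw|]. apply allc_real, hentire_centire, hentire_moll.
    + apply Rcont_plus; [apply Rcont_mult; [apply Rcont_const|easy]|apply Rcont_const].
    + intros x. unfold sqw at 1, unitw at 1. rewrite Rmult_1_r, Rmult_0_l, Rplus_0_r. apply moll_sq.
  - rewrite (RInt_lin _ (fun _ => 0%R) (/ h) 0) by (try easy; apply Rcont_const).
    specialize (W2 a b Hab).
    apply (Rmult_le_compat_l (/ h)) in W2; [|apply Rlt_le, Rinv_0_lt_compat; lra].
    replace (/ h * (h * (B / r)))%R with (B / r)%R in W2 by (field; split; lra). lra.
Qed.

(** Comes from the mean square over a single window and the inequality [u <= 1 + u ^ 2]. The bound
    degenerates as [h] tends to 0, which is harmless because it is used for one average at a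
    time. *)
Lemma moll_real_bound B : bddI (sqw unitw (fun x => F (RtoC x))) B -> 
  forall x : R, (Cmod (moll F r h x) <= 1 + B / h)%R.
Proof.
  intros HB x. assert (Q := moll_sq x). specialize (HB (r * x)%R (r * x + h)%R ltac:(lra)).
  assert (P : (/ h * RInt (sqw unitw (fun s => F (RtoC s))) (r * x) (r * x + h) <= / h * B)%R)
    by (apply Rmult_le_compat_l; [apply Rlt_le, Rinv_0_lt_compat; lra|easy]).
  assert (Z := Cmod_ge_0 (moll F r h x)). unfold Rdiv. nra.
Qed.
End Moll.

(** * Removing the average and the dilation *)

Lemma real_unifcont f r : allc f -> forall eps, (0 < eps)%R -> exists d, (0 < d)%R /\
  forall x y, (Rabs x <= r)%R -> (Rabs y <= r)%R -> (Rabs (x - y) <= d)%R -> (Cmod (f x - f y) <= eps)%R.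
Proof.
  intros Hf eps He.
  destruct (@unifcont_normed_1d R_AbsRing C_R_NormedModule f (- r) r) with (eps := mkposreal eps He) as [d Hd].
  { intros x _. apply rcont_continuous, Hf. }
  exists (d / 2)%R. split; [generalize (cond_pos d); lra|]. intros x y Hx Hy Hxy.
  apply Rabs_le_between in Hx. apply Rabs_le_between in Hy.
  assert (Q := Hd y x Hy Hx). rewrite Cmod_norm. apply Rlt_le. apply Q.
  change (Rabs (x - y) < d)%R. generalize (cond_pos d). lra.
Qed.

(** The averaged dilations have type strictly below [tau], so the contour argument applies to each
    of them even when [l] or [m] equals [tau]. Their norms stay bounded, so the integrals converge
    weakly to those of [F], and the values at [c] converge pointwise. *)
Theorem core_reproduce F tau l m c v u : pw tau F -> (0 < tau)%R -> (tau <= l)%R -> (tau <= m)%R ->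
  isI (fun x => F (RtoC x) * Eb l c (RtoC x)) v -> isI (fun x => F (RtoC x) * Eb (- m) c (RtoC x)) u ->
  v - u = 2 * piC * Ci * F c.
Proof.
  intros [HF [Hty [B HB]]] Ht Hl Hm Hv Hu.
  assert (CF := hentire_centire F HF).
  assert (B0 := bddI_pos _ _ HB).
  (* The dilation factors stay above 1/2, which bounds the squared norms of all averages by
     [2 * B]. *)
  set (rn := fun n : nat => (1 - / (INR n + 2))%R). set (hn := fun n : nat => (/ (INR n + 1))%R).
  assert (Pn : forall n, (0 <= INR n)%R) by apply pos_INR.
  assert (Hrn : forall n, (/ 2 <= rn n < 1)%R).
  { intros n. specialize (Pn n). unfold rn.
    assert (0 < / (INR n + 2))%R by (apply Rinv_0_lt_compat; lra).
    assert (/ (INR n + 2) <= / 2)%R by (apply Rinv_le_contravar; lra). lra. }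
  assert (Hhn : forall n, (0 < hn n <= 1)%R).
  { intros n. specialize (Pn n). unfold hn. split; [apply Rinv_0_lt_compat; lra|].
    rewrite <- Rinv_1. apply Rinv_le_contravar; lra. }
  assert (Small : forall eps, (0 < eps)%R -> exists N, forall n, (N <= n)%nat ->
     (1 - rn n <= eps)%R /\ (hn n <= eps)%R).
  { intros eps He. destruct (INR_unbounded (/ eps)) as [N HN]. exists N. intros n Hn.
    apply le_INR in Hn. assert (Pi : (0 < / eps)%R) by now apply Rinv_0_lt_compat.
    rewrite <- (Rinv_inv eps). unfold rn, hn.
    split; [replace (1 - (1 - / (INR n + 2)))%R with (/ (INR n + 2))%R by ring|]; apply Rinv_le_contravar; lra. }
  set (Fn := fun n => moll F (rn n) (hn n)).
  assert (HFn : forall n, hentire (Fn n)) by (intros n; now apply hentire_moll).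
  assert (BFn : forall n, bddI (sqw unitw (fun x => Fn n (RtoC x))) (2 * B)).
  { intros n a b Hab. destruct (Hrn n) as [R1 R2]. destruct (Hhn n) as [H1 H2].
    eapply Rle_trans; [apply (moll_bddI F (rn n) (hn n) HF ltac:(lra) H1 B HB a b Hab)|].
    unfold Rdiv. rewrite Rmult_comm. apply Rmult_le_compat_r; [easy|].
    rewrite <- (Rinv_inv 2). apply Rinv_le_contravar; lra. }
  assert (Ex : forall G k X, hentire G -> bddI (sqw unitw (fun x => G (RtoC x))) X ->
    exists w, isI (fun x => G (RtoC x) * Eb k c (RtoC x)) w).
  { intros G k X HG HX. destruct (Eb_bddI k c) as [Y HY].
    destruct (isI_prod_exists unitw (fun x => G (RtoC x)) (fun x => Eb k c (RtoC x)) X Y) as [w Hw]; try easy.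
    - apply weight_unitw.
    - now apply allc_real, hentire_centire.
    - apply allc_real, hentire_centire, hentire_Eb.
    - exists w. revert Hw. apply isI_ext. intros x. unfold unitw. ring. }
  assert (Vn : forall k n, exists w, isI (fun x => Fn n (RtoC x) * Eb k c (RtoC x)) w)
    by (intros k n; apply (Ex (Fn n) k (2 * B)%R); auto).
  set (vn := fun k n => proj1_sig (constructive_indefinite_description _ (Vn k n))).
  assert (Hvn : forall k n, isI (fun x => Fn n (RtoC x) * Eb k c (RtoC x)) (vn k n))
    by (intros k n; exact (proj2_sig (constructive_indefinite_description _ (Vn k n)))).
  assert (Rep : forall n, vn l n - vn (- m)%R n = 2 * piC * Ci * Fn n c).
  { intros n. destruct (Hrn n) as [R1 R2]. destruct (Hhn n) as [H1 H2].
    (* Half of the room created by the dilation: with r = [rn n], the new type (tau + e) r equals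
       tau - tau/2 (1 - r)(2 - r), still below [tau], and the growth bound holds at this exponent
       with no further loss. *)
    set (e := (tau * (1 - rn n) / 2)%R).
    assert (Pe : (0 < e)%R) by (unfold e; nra).
    destruct (Hty e Pe) as [M HM].
    set (T := ((tau + e) * rn n)%R).
    assert (HT : (0 <= T < tau)%R).
    { unfold T. split; [apply Rmult_le_pos; lra|]. unfold e. set (r := rn n) in *.
      assert (Q : (0 < (1 - r) * (2 - r))%R) by (apply Rmult_lt_0_compat; lra).
      replace ((tau + tau * (1 - r) / 2) * r)%R with (tau - tau / 2 * ((1 - r) * (2 - r)))%R by field.
      assert (0 < tau / 2 * ((1 - r) * (2 - r)))%R by (apply Rmult_lt_0_compat; lra). lra. }
    apply (box_reproduce (Fn n) (1 + Rabs (1 + B / hn n) + Rabs (M * exp (tau + e))) T c (HFn n) (proj1 HT)) with (l := l) (m := m); try lra; auto.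
    intros z. apply strip_growth; auto; [lra| |].
    - intros w. unfold T. eapply Rle_trans; [apply (moll_growth F (rn n) (hn n) HF ltac:(lra) H1 M (tau + e)); auto; lra|].
      right. f_equal. 
    - apply (moll_real_bound F (rn n) (hn n) HF H1 B HB). }
  assert (Unif : forall r eps, (0 < eps)%R -> exists N, forall n x, (N <= n)%nat -> (Rabs x <= r)%R ->
     (Cmod (Fn n (RtoC x) - F (RtoC x)) <= eps)%R).
  { intros r eps He. destruct (real_unifcont (fun x => F (RtoC x)) (Rabs r + 1) (allc_real F CF) eps He) as [d [Hd K]].
    assert (Rr := Rabs_pos r). assert (Rr2 := Rle_abs r).
    destruct (Small (d / (Rabs r + 1))%R) as [N HN]; [apply Rdiv_lt_0_compat; lra|].
    exists N. intros n x Hn Hx. destruct (HN n Hn) as [S1 S2]. destruct (Hrn n) as [R1 R2]. destruct (Hhn n) as [H1 H2].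
    apply moll_near; try easy; try lra. intros s Hs. simpl Re. simpl Im. rewrite Rmult_0_r.
    apply (K (rn n * x + s)%R x); [| lra |].
    - eapply Rle_trans; [apply Rabs_triang|]. rewrite Rabs_mult, (Rabs_pos_eq (rn n)), (Rabs_pos_eq s) by lra.
      assert (0 <= Rabs x)%R by apply Rabs_pos. nra.
    - replace (rn n * x + s - x)%R with (- ((1 - rn n) * x) + s)%R by ring.
      eapply Rle_trans; [apply Rabs_triang|]. rewrite Rabs_Ropp, Rabs_mult, (Rabs_pos_eq (1 - rn n)), (Rabs_pos_eq s) by lra.
      set (q := (d / (Rabs r + 1))%R) in *. assert (Eq : (q * (Rabs r + 1) = d)%R) by (unfold q; field; lra).
      assert (0 <= Rabs x)%R by apply Rabs_pos.
      assert ((1 - rn n) * Rabs x <= q * Rabs r)%R by (apply Rmult_le_compat; lra). lra. }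
  assert (Weak : forall k w, isI (fun x => F (RtoC x) * Eb k c (RtoC x)) w ->
    forall eps, (0 < eps)%R -> exists N, forall n, (N <= n)%nat -> (Cmod (vn k n - w) <= eps)%R).
  { intros k w Hw. destruct (Eb_bddI k c) as [Y HY].
    apply (weak_limit unitw (fun n x => Fn n (RtoC x)) (fun x => F (RtoC x)) (fun x => Eb k c (RtoC x)) (2 * B) Y); auto.
    - apply weight_unitw.
    - intros n. now apply allc_real, hentire_centire.
    - now apply allc_real.
    - apply allc_real, hentire_centire, hentire_Eb.
    - intros a b Hab. specialize (HB a b Hab). lra.
    - intros n. generalize (Hvn k n). apply isI_ext. intros x. unfold unitw. ring.
    - revert Hw. apply isI_ext. intros x. unfold unitw. ring. }
  assert (Pt : forall eps, (0 < eps)%R -> exists N, forall n, (N <= n)%nat -> (Cmod (Fn n c - F c) <= eps)%R).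
  { intros eps He. destruct (CF c eps He) as [d [Hd K]].
    assert (Pc := Cmod_ge_0 c).
    destruct (Small (d / (2 * (Cmod c + 1)))%R) as [N HN]; [apply Rdiv_lt_0_compat; lra|].
    exists N. intros n Hn. destruct (HN n Hn) as [S1 S2]. destruct (Hrn n) as [R1 R2]. destruct (Hhn n) as [H1 H2].
    apply moll_near; try easy; try lra. intros s Hs. apply Rlt_le, K. unfold Cgap.
    replace (((rn n * Re c + s)%R, (rn n * Im c)%R) - c) with (RtoC s - RtoC (1 - rn n) * c)
      by (destruct c; apply Ceq; simpl; ring).
    eapply Rle_lt_trans; [apply Cmod_minus_le|]. rewrite Cmod_mult, !Cmod_R, !Rabs_pos_eq by lra.
    set (q := (d / (2 * (Cmod c + 1)))%R) in *.
    assert (Eq : (q * (2 * (Cmod c + 1)) = d)%R) by (unfold q; field; lra).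
    assert ((1 - rn n) * Cmod c <= q * Cmod c)%R by (apply Rmult_le_compat_r; lra). nra. }
  apply Cmod_small_eq. intros eps He.
  destruct (Weak l v Hv (eps / 3)%R ltac:(lra)) as [N1 K1].
  destruct (Weak (- m)%R u Hu (eps / 3)%R ltac:(lra)) as [N2 K2].
  set (A := (Cmod (2 * piC * Ci) + 1)%R). assert (PA : (0 < A)%R) by (unfold A; generalize (Cmod_ge_0 (2 * piC * Ci)); lra).
  destruct (Pt (eps / (3 * A))%R) as [N3 K3]; [apply Rdiv_lt_0_compat; lra|].
  set (n := (N1 + N2 + N3)%nat).
  specialize (K1 n ltac:(unfold n; lia)). specialize (K2 n ltac:(unfold n; lia)). specialize (K3 n ltac:(unfold n; lia)).
  replace (v - u - 2 * piC * Ci * F c)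
    with ((2 * piC * Ci) * (Fn n c - F c) - (vn l n - v) + (vn (- m)%R n - u))
    by (rewrite Cmult_comm; replace (vn l n) with (vn (- m)%R n + 2 * piC * Ci * Fn n c) by (rewrite <- Rep; ring); ring).
  eapply Rle_trans; [apply Cmod_triangle|].
  eapply Rle_trans; [apply Rplus_le_compat_r, Cmod_minus_le|]. rewrite Cmod_mult.
  assert (Cmod (2 * piC * Ci) * Cmod (Fn n c - F c) <= eps / 3)%R; [|lra].
  apply Rle_trans with (A * (eps / (3 * A)))%R; [|right; field; lra].
  apply Rmult_le_compat; try apply Cmod_ge_0; [unfold A; lra|easy].
Qed.

(** * The weight and the space *)

(** The entire function sin (2 pi z) / (2 pi z) written with blocks centred at 0, so that integrals
    against it become values of [J]. *)
Definition Tsinc (z : C) : C := (Eb (2 * PI) 0 z - Eb (- (2 * PI)) 0 z) / (4 * piC * Ci).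

Lemma piC_nz : piC <> 0.
Proof. apply RtoC_nz, Rgt_not_eq, PI_RGT_0. Qed.

Lemma Cexp_Ci_R (t : R) : Cexp (Ci * RtoC t) = (cos t, sin t).
Proof.
  unfold Cexp. replace (Re (Ci * RtoC t)) with 0%R by (simpl; ring).
  replace (Im (Ci * RtoC t)) with t by (simpl; ring). rewrite exp_0. apply Ceq; simpl; ring.
Qed.

Lemma W_Tsinc x : RtoC (W_SOeven x) = 1 + Tsinc (RtoC x).
Proof.
  assert (Hp := piC_nz). assert (Hi := Ci_nz). assert (P := PI_RGT_0).
  unfold W_SOeven, Tsinc. destruct (Req_EM_T x 0) as [->|N].
  - rewrite !Eb_at, RtoC_opp, RtoC_mult. fold piC. field. auto.
  - assert (Nx : RtoC x <> 0) by now apply RtoC_nz. rewrite !Eb_off by easy.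
    replace (Ci * RtoC (2 * PI) * (RtoC x - 0)) with (Ci * RtoC (2 * PI * x)) by (rewrite !RtoC_mult; ring).
    replace (Ci * RtoC (- (2 * PI)) * (RtoC x - 0)) with (Ci * RtoC (- (2 * PI * x)))
      by (rewrite !RtoC_opp, !RtoC_mult; ring).
    rewrite !Cexp_Ci_R, cos_neg, sin_neg. set (s := sin (2 * PI * x)). set (k := cos (2 * PI * x)).
    assert (N2 : (2 * PI * x)%R <> 0%R) by (apply Rmult_integral_contrapositive_currified; [lra|exact N]).
    rewrite RtoC_plus, RtoC_div by exact N2.
    rewrite !RtoC_mult. fold piC.
    replace ((k, s) : C) with (RtoC k + Ci * RtoC s) by (apply Ceq; simpl; ring).
    replace ((k, (- s)%R) : C) with (RtoC k - Ci * RtoC s) by (apply Ceq; simpl; ring).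
    field. auto.
Qed.

Lemma hentire_Tsinc : hentire Tsinc.
Proof.
  intros z. unfold Tsinc, Cdiv. apply (holo_mult (fun z => Eb (2 * PI) 0 z - Eb (- (2 * PI)) 0 z));
    [|apply holo_const].
  apply (holo_minus (Eb (2 * PI) 0) (Eb (- (2 * PI)) 0)); apply hentire_Eb.
Qed.

Lemma Rcont_W : Rcont W_SOeven.
Proof.
  intros x. apply continuous_ext with (fun x => Re (1 + Tsinc (RtoC x))).
  - intros y. rewrite <- W_Tsinc. reflexivity.
  - apply rcont_Re. apply econt_plus; [apply econt_const|]. apply allc_real, hentire_centire, hentire_Tsinc.
Qed.

(** Up to pi the sine is nonnegative, and beyond it 1/t is already below 1/2. The lower constant is
    not sharp; it only has to exceed -1. *)
Lemma sinc_bounds t : (0 < t)%R -> (- / 2 <= sin t / t <= 1)%R.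
Proof.
  intros Ht. assert (P3 := PI2_3_2). split.
  - destruct (Rle_dec t PI) as [h|h].
    + assert (0 <= sin t)%R by (apply sin_ge_0; lra).
      assert (0 <= sin t / t)%R by now apply Rcomplements.Rdiv_le_0_compat. lra.
    + assert (B := SIN_bound t). apply Rle_div_r; [easy|]. lra.
  - apply Rle_div_l; [easy|]. rewrite Rmult_1_l. left. now apply sin_lt_x.
Qed.

(** These bounds make the weighted norm equivalent to the unweighted one, so that membership,
    convergence and bounds on evaluation can be treated without the weight. *)
Lemma W_bounds x : (/ 2 <= W_SOeven x <= 2)%R.
Proof.
  unfold W_SOeven. destruct (Req_EM_T x 0) as [->|N]; [lra|].
  assert (P := PI_RGT_0).
  assert (K : (- / 2 <= sin (2 * PI * x) / (2 * PI * x) <= 1)%R); [|lra].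
  destruct (Rlt_dec 0 x) as [h|h].
  - apply sinc_bounds. nra.
  - replace (sin (2 * PI * x) / (2 * PI * x))%R with (sin (2 * PI * - x) / (2 * PI * - x))%R.
    + apply sinc_bounds. nra.
    + replace (2 * PI * - x)%R with (- (2 * PI * x))%R by ring. rewrite sin_neg. field. lra.
Qed.

Lemma weight_W : weight W_SOeven.
Proof. split; [apply Rcont_W|]. intros x. generalize (W_bounds x). lra. Qed.

Lemma RInt_scalR (g : R -> R) k a b : Rcont g -> @eq R (RInt (fun x => k * g x)%R a b) (k * RInt g a b)%R.
Proof.
  intros Hg. rewrite (RInt_extR _ (fun x => k * g x + 0 * 0)%R) by (intros; ring).
  rewrite (RInt_lin g (fun _ => 0%R)) by (try easy; apply Rcont_const). lra.
Qed.

Lemma bddI_le g h k B : Rcont g -> Rcont h -> (0 <= k)%R -> (forall x, (g x <= k * h x)%R) ->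
  bddI h B -> bddI g (k * B).
Proof.
  intros Hg Hh Hk H HB a b Hab. eapply Rle_trans.
  - apply (RInt_mono g (fun x => k * h x)%R); auto. apply Rcont_mult; [apply Rcont_const|easy].
  - rewrite RInt_scalR by easy. apply Rmult_le_compat_l; auto.
Qed.

Lemma bddI_W_unitw f B : allc f -> bddI (sqw W_SOeven f) B -> bddI (sqw unitw f) (2 * B).
Proof.
  intros Hf. apply bddI_le; try lra; try (apply Rcont_sqw; [|easy]); [apply weight_unitw|apply weight_W|].
  intros x. unfold sqw, unitw. assert (Q := W_bounds x). assert (Z := pow2_ge_0 (Cmod (f x))). nra.
Qed.

Lemma bddI_unitw_W f B : allc f -> bddI (sqw unitw f) B -> bddI (sqw W_SOeven f) (2 * B).
Proof.
  intros Hf. apply bddI_le; try lra; try (apply Rcont_sqw; [|easy]); [apply weight_W|apply weight_unitw|].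
  intros x. unfold sqw, unitw. assert (Q := W_bounds x). assert (Z := pow2_ge_0 (Cmod (f x))). nra.
Qed.

Lemma in_H_pw Delta F : in_H_SOeven Delta F <-> pw (PI * Delta) F.
Proof.
  unfold in_H_SOeven, pw. rewrite entire_holo. split.
  - intros [H1 [H2 H3]]. split; [easy|]. split; [easy|].
    assert (Ac : allc (fun x => F (RtoC x))) by now apply allc_real, hentire_centire.
    apply (ex_RInt_gen_bddI (sqw W_SOeven (fun x => F (RtoC x)))) in H3.
    + destruct H3 as [B HB]. exists (2 * B)%R. now apply bddI_W_unitw.
    + apply Rcont_sqw; [apply weight_W|easy].
    + intros x. apply sqw_pos, weight_W.
  - intros [H1 [H2 [B HB]]]. split; [easy|]. split; [easy|].
    assert (Ac : allc (fun x => F (RtoC x))) by now apply allc_real, hentire_centire.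
    apply (ex_RInt_gen_bddI (sqw W_SOeven (fun x => F (RtoC x)))).
    + apply Rcont_sqw; [apply weight_W|easy].
    + intros x. apply sqw_pos, weight_W.
    + exists (2 * B)%R. now apply bddI_unitw_W.
Qed.

Lemma allc_pw tau F : pw tau F -> allc (fun x => F (RtoC x)).
Proof. intros [H _]. now apply allc_real, hentire_centire. Qed.

Lemma pw_bddI_W tau F : pw tau F -> exists X, bddI (sqw W_SOeven (fun x => F (RtoC x))) X.
Proof.
  intros H. assert (Ac := allc_pw _ _ H). destruct H as [_ [_ [B HB]]]. exists (2 * B)%R. now apply bddI_unitw_W.
Qed.

Lemma pw_bound_type tau F M : (forall z, (Cmod (F z) <= M * exp (tau * Cmod z))%R) -> exp_type_le F tau.
Proof.
  intros H eps He. exists M. intros z. eapply Rle_trans; [apply H|].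
  assert (M0 : (0 <= M)%R).
  { specialize (H 0). rewrite Cmod_0, Rmult_0_r, exp_0 in H. generalize (Cmod_ge_0 (F 0)). lra. }
  apply Rmult_le_compat_l; [easy|]. apply exp_le. generalize (Cmod_ge_0 z). nra.
Qed.

Lemma sq_sum_le (a b : C) : (Cmod (a + b) ^ 2 <= 2 * Cmod a ^ 2 + 2 * Cmod b ^ 2)%R.
Proof.
  assert (T := Cmod_triangle a b). assert (Z := Cmod_ge_0 (a + b)).
  assert (Cmod (a + b) ^ 2 <= (Cmod a + Cmod b) ^ 2)%R by (apply pow_incr; easy).
  assert (0 <= (Cmod a - Cmod b) ^ 2)%R by apply pow2_ge_0. nra.
Qed.

Lemma pw_plus tau F G : pw tau F -> pw tau G -> pw tau (fun z => F z + G z).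
Proof.
  intros HF HG. assert (AF := allc_pw _ _ HF). assert (AG := allc_pw _ _ HG).
  destruct HF as [F1 [F2 [B1 F3]]]. destruct HG as [G1 [G2 [B2 G3]]]. split; [|split].
  - intros z. apply holo_plus; [apply F1|apply G1].
  - intros eps He. destruct (F2 eps He) as [M1 H1]. destruct (G2 eps He) as [M2 H2].
    exists (M1 + M2)%R. intros z. eapply Rle_trans; [apply Cmod_triangle|].
    specialize (H1 z). specialize (H2 z). lra.
  - exists (2 * B1 + 2 * B2)%R. intros a b Hab.
    eapply Rle_trans; [apply (RInt_mono _ (fun x => 2 * sqw unitw (fun x => F (RtoC x)) x + 2 * sqw unitw (fun x => G (RtoC x)) x)%R)|].
    + apply Rcont_sqw; [apply weight_unitw|]. intros x. apply econt_plus; auto.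
    + apply Rcont_plus; apply Rcont_mult; try apply Rcont_const; apply Rcont_sqw; auto; apply weight_unitw.
    + easy.
    + intros x. unfold sqw, unitw. rewrite !Rmult_1_r. apply sq_sum_le.
    + rewrite RInt_lin by (apply Rcont_sqw; [apply weight_unitw|easy]).
      specialize (F3 a b Hab). specialize (G3 a b Hab). lra.
Qed.

(** Types add under multiplication, and boundedness of [G] on the real line preserves square
    integrability. *)
Lemma pw_mult_bounded tau tau' F G M A : pw tau F -> hentire G ->
  (forall z, (Cmod (G z) <= M * exp (tau' * Cmod z))%R) -> (0 <= A)%R ->
  (forall x : R, (Cmod (G x) ^ 2 <= A)%R) -> pw (tau + tau') (fun z => F z * G z).
Proof.
  intros HF HG HM HA HGA. assert (AF := allc_pw _ _ HF). destruct HF as [F1 [F2 [B F3]]].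
  assert (AG : allc (fun x => G (RtoC x))) by now apply allc_real, hentire_centire.
  split; [|split].
  - intros z. apply holo_mult; [apply F1|apply HG].
  - intros eps He. destruct (F2 eps He) as [M1 H1]. exists (M1 * M)%R. intros z.
    rewrite Cmod_mult. replace ((tau + tau' + eps) * Cmod z)%R with ((tau + eps) * Cmod z + tau' * Cmod z)%R by ring.
    rewrite exp_plus. apply Rle_trans with (M1 * exp ((tau + eps) * Cmod z) * (M * exp (tau' * Cmod z)))%R; [|right; ring].
    apply Rmult_le_compat; auto; apply Cmod_ge_0.
  - exists (A * B)%R. revert F3. apply bddI_le; auto.
    + apply Rcont_sqw; [apply weight_unitw|now apply allc_mult].
    + apply Rcont_sqw; [apply weight_unitw|easy].
    + intros x. unfold sqw, unitw. rewrite Cmod_mult, Rpow_mult_distr, !Rmult_1_r.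
      specialize (HGA x). assert (Z := pow2_ge_0 (Cmod (F (RtoC x)))). nra.
Qed.

Lemma pw_scal tau F c : pw tau F -> pw tau (fun z => c * F z).
Proof.
  intros HF. assert (H := pw_mult_bounded tau 0 F (fun _ => c) (Cmod c) (Cmod c ^ 2) HF).
  rewrite Rplus_0_r in H.
  assert (K : pw tau (fun z => F z * c)).
  { apply H.
    - intros z. apply holo_const.
    - intros z. rewrite Rmult_0_l, exp_0. lra.
    - apply pow2_ge_0.
    - intros x. lra. }
  destruct K as [K1 [K2 [B K3]]]. split; [|split].
  - intros z. apply holo_ext with (fun z => F z * c); [intros; ring|apply K1].
  - intros eps He. destruct (K2 eps He) as [M HM]. exists M. intros z. rewrite Cmult_comm. apply HM.
  - exists B. intros a b Hab. specialize (K3 a b Hab).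
    rewrite (RInt_extR _ (sqw unitw (fun x => F (RtoC x) * c))); [easy|].
    intros x. unfold sqw. now rewrite Cmult_comm.
Qed.

Lemma Eb_growth k c z : (Cmod (Eb k c z) <= Rabs k * exp (Rabs k * Cmod c) * exp (Rabs k * Cmod z))%R.
Proof.
  eapply Rle_trans; [apply Eb_bound|]. rewrite Rmult_assoc, <- exp_plus.
  apply Rmult_le_compat_l; [apply Rabs_pos|]. apply exp_le.
  assert (Q := Im_le_Cmod (z - c)). assert (T := Cmod_minus_le z c). assert (Z := Rabs_pos k). nra.
Qed.

Lemma pw_Eb tau k c : (Rabs k <= tau)%R -> pw tau (Eb k c).
Proof.
  intros Hk. split; [apply hentire_Eb|split; [|apply Eb_bddI]].
  apply pw_bound_type with (Rabs k * exp (Rabs k * Cmod c))%R. intros z.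
  eapply Rle_trans; [apply Eb_growth|].
  assert (P := exp_pos (Rabs k * Cmod c)). assert (Z := Rabs_pos k).
  apply Rmult_le_compat_l; [nra|]. apply exp_le. generalize (Cmod_ge_0 z). nra.
Qed.

Lemma pw_mult_Eb tau F k c : pw tau F -> pw (tau + Rabs k) (fun z => F z * Eb k c z).
Proof.
  intros HF. destruct (Eb_decay k c) as [A HA].
  assert (A0 : (0 <= A)%R).
  { specialize (HA 0%R). replace (A / (1 + 0 ^ 2))%R with A in HA by field.
    generalize (pow2_ge_0 (Cmod (Eb k c 0%R))). lra. }
  apply pw_mult_bounded with (Rabs k * exp (Rabs k * Cmod c))%R A; auto; [apply hentire_Eb|apply Eb_growth|].
  intros x. eapply Rle_trans; [apply HA|]. apply Rle_div_l; [generalize (pow2_ge_0 x); lra|].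
  generalize (pow2_ge_0 x). nra.
Qed.

Lemma pw_conj tau F : pw tau F -> pw tau (fun z => Cconj (F (Cconj z))).
Proof.
  intros [H1 [H2 [B H3]]]. split; [now apply hentire_conj|split].
  - intros eps He. destruct (H2 eps He) as [M HM]. exists M. intros z.
    rewrite Cmod_conj, <- (Cmod_conj z). apply HM.
  - exists B. intros a b Hab. specialize (H3 a b Hab).
    rewrite (RInt_extR _ (sqw unitw (fun x => F (RtoC x)))); [easy|].
    intros x. unfold sqw. rewrite Cmod_conj. do 3 f_equal. f_equal. apply Ceq; simpl; ring.
Qed.

(** * Integrals against the building blocks *)

Lemma Eb_swap k c z : Eb (- k) z c = - Eb k c z.
Proof.
  unfold Eb. rewrite RtoC_opp. replace (Ci * - RtoC k * (c - z)) with (Ci * RtoC k * (z - c)) by ring. ring.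
Qed.

Lemma ccont_eq_off f g (p q : C) : centire f -> centire g -> (forall z, z <> p -> z <> q -> f z = g z) ->
  forall z, f z = g z.
Proof.
  intros Hf Hg H z. apply Cmod_small_eq. intros eps He.
  destruct (Hf z (eps / 2)%R ltac:(lra)) as [d1 [D1 K1]]. destruct (Hg z (eps / 2)%R ltac:(lra)) as [d2 [D2 K2]].
  set (d := Rmin d1 d2). assert (Pd : (0 < d)%R) by now apply Rmin_pos.
  assert (L1 : (d <= d1)%R) by apply Rmin_l. assert (L2 : (d <= d2)%R) by apply Rmin_r.
  assert (Hy : exists y, (Cmod (y - z) < d)%R /\ y <> p /\ y <> q).
  { assert (Cand : forall t : R, (0 < t < d)%R -> (Cmod (z + RtoC t - z) < d)%R).
    { intros t Ht. replace (z + RtoC t - z) with (RtoC t) by ring. rewrite Cmod_R, Rabs_pos_eq; lra. }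
    assert (Inj : forall (s t : R) w, z + RtoC s = w -> z + RtoC t = w -> s = t).
    { intros s t w E1 E2. apply RtoC_inj. replace (RtoC s) with (z + RtoC s - z) by ring.
      rewrite E1, <- E2. ring. }
    (* Of three distinct candidates near [z], at most two can be the excluded points. *)
    destruct (classic (z + RtoC (d / 2) = p \/ z + RtoC (d / 2) = q)) as [B1|G1].
    2: { exists (z + RtoC (d / 2)). split; [apply Cand; lra|tauto]. }
    destruct (classic (z + RtoC (d / 3) = p \/ z + RtoC (d / 3) = q)) as [B2|G2].
    2: { exists (z + RtoC (d / 3)). split; [apply Cand; lra|tauto]. }
    exists (z + RtoC (d / 4)). split; [apply Cand; lra|].
    split; intros E; destruct B1 as [B1|B1]; destruct B2 as [B2|B2];
      repeat match goal with
      | A : z + RtoC ?s = ?w, B : z + RtoC ?t = ?w |- _ =>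
          assert (s = t) by (apply (Inj s t w A B)); lra
      end. }
  destruct Hy as [y [Hy [Np Nq]]].
  specialize (K1 y ltac:(unfold Cgap; lra)). specialize (K2 y ltac:(unfold Cgap; lra)).
  rewrite (H y Np Nq) in K1.
  replace (f z - g z) with ((g y - g z) - (g y - f z)) by ring.
  eapply Rle_trans; [apply Cmod_minus_le|]. lra.
Qed.

(** Partial fractions 1/((z - c) z) = (1/(z - c) - 1/z)/c, together with the shift of the frequency
    [k] by +-2 pi caused by the sine. The exponential coefficients arise from recentring
    exponentials between 0 and [c]. *)
Lemma Eb_Tsinc k (c z : C) : c <> 0 -> Eb k c z * Tsinc z =
  (Cexp (Ci * RtoC (2 * PI) * c) * (Eb (k + 2 * PI) c z - Eb (2 * PI) c z)
   - Cexp (- (Ci * RtoC (2 * PI) * c)) * (Eb (k - 2 * PI) c z - Eb (- (2 * PI)) c z)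
   - Cexp (- (Ci * RtoC k * c)) * (Eb (k + 2 * PI) 0 z - Eb (k - 2 * PI) 0 z)
   + (Eb (2 * PI) 0 z - Eb (- (2 * PI)) 0 z)) / (4 * piC * Ci * c).
Proof.
  intros Hc. assert (Hp := piC_nz). assert (Hi := Ci_nz).
  revert z. apply (ccont_eq_off _ _ 0 c).
  - intros z. apply econt_mult; [apply hentire_centire, hentire_Eb|apply hentire_centire, hentire_Tsinc].
  - intros z. unfold Cdiv.
    apply econt_mult; [|apply econt_const].
    assert (Ce : forall k c, ccont (Eb k c) z) by (intros; apply hentire_centire, hentire_Eb).
    apply econt_plus; [|now apply econt_minus].
    apply econt_minus; [apply econt_minus|]; (apply econt_mult; [apply econt_const|now apply econt_minus]).
  - intros z Hz Hzc. unfold Tsinc. rewrite !Eb_off by easy.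
    assert (Hd : z - c <> 0) by now apply Cminus_eq_contra.
    set (E := Cexp (Ci * RtoC (2 * PI) * c)). set (U := Cexp (Ci * RtoC (2 * PI) * (z - c))).
    set (Kc := Cexp (Ci * RtoC k * c)). set (V := Cexp (Ci * RtoC k * (z - c))).
    assert (NE : E <> 0) by apply Cexp_nz. assert (NU : U <> 0) by apply Cexp_nz.
    assert (NK : Kc <> 0) by apply Cexp_nz. assert (NV : V <> 0) by apply Cexp_nz.
    replace (Cexp (- (Ci * RtoC (2 * PI) * c))) with (/ E) by (unfold E; now rewrite Cexp_opp).
    replace (Cexp (- (Ci * RtoC k * c))) with (/ Kc) by (unfold Kc; now rewrite Cexp_opp).
    replace (Cexp (Ci * RtoC (2 * PI) * (z - 0))) with (U * E)
      by (unfold U, E; rewrite <- Cexp_plus; f_equal; ring).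
    replace (Cexp (Ci * RtoC (- (2 * PI)) * (z - 0))) with (/ (U * E))
      by (unfold U, E; rewrite <- Cexp_plus, <- Cexp_opp; f_equal; rewrite RtoC_opp; ring).
    replace (Cexp (Ci * RtoC (k + 2 * PI) * (z - c))) with (V * U)
      by (unfold U, V; rewrite <- Cexp_plus; f_equal; rewrite RtoC_plus; ring).
    replace (Cexp (Ci * RtoC (k - 2 * PI) * (z - c))) with (V * / U)
      by (unfold U, V; rewrite <- Cexp_opp, <- Cexp_plus; f_equal; rewrite RtoC_minus; ring).
    replace (Cexp (Ci * RtoC (- (2 * PI)) * (z - c))) with (/ U)
      by (unfold U; rewrite <- Cexp_opp; f_equal; rewrite RtoC_opp; ring).
    replace (Cexp (Ci * RtoC (k + 2 * PI) * (z - 0))) with (V * Kc * (U * E))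
      by (unfold U, V, E, Kc; rewrite <- !Cexp_plus; f_equal; rewrite RtoC_plus; ring).
    replace (Cexp (Ci * RtoC (k - 2 * PI) * (z - 0))) with (V * Kc * / (U * E))
      by (unfold U, V, E, Kc; rewrite <- !Cexp_plus, <- Cexp_opp, <- !Cexp_plus; f_equal; rewrite RtoC_minus; ring).
    assert (Hz0 : z - 0 <> 0) by (replace (z - 0) with z by ring; easy).
    field. repeat split; auto.
Qed.

Section Functional.
Variables (tau : R) (F : C -> C).
Hypothesis (HF : pw tau F) (Ht : (0 < tau)%R).

Lemma isI_Eb_ex k c : exists v, isI (fun x => F (RtoC x) * Eb k c (RtoC x)) v.
Proof.
  assert (AF := allc_pw _ _ HF). destruct HF as [_ [_ [X HX]]]. destruct (Eb_bddI k c) as [Y HY].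
  destruct (isI_prod_exists unitw (fun x => F (RtoC x)) (fun x => Eb k c (RtoC x)) X Y) as [w Hw]; try easy.
  - apply weight_unitw.
  - apply allc_real, hentire_centire, hentire_Eb.
  - exists w. revert Hw. apply isI_ext. intros x. unfold unitw. ring.
Qed.

(** The number J(k) for the centre [c], chosen from an existence proof; uniqueness of improper
    integrals makes the choice immaterial. *)
Definition Jint (k : R) (c : C) : C :=
  proj1_sig (constructive_indefinite_description _ (isI_Eb_ex k c)).

Lemma Jint_isI k c : isI (fun x => F (RtoC x) * Eb k c (RtoC x)) (Jint k c).
Proof. exact (proj2_sig (constructive_indefinite_description _ (isI_Eb_ex k c))). Qed.

Lemma Jint_jump l m c : (tau <= l)%R -> (tau <= m)%R -> Jint l c - Jint (- m) c = 2 * piC * Ci * F c.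
Proof.
  intros Hl Hm. apply (core_reproduce F tau l m c); auto; apply Jint_isI.
Qed.

Lemma Jint_up l c : (tau <= l)%R -> Jint l c = Jint tau c.
Proof.
  intros Hl. assert (E1 := Jint_jump l tau c Hl (Rle_refl _)). assert (E2 := Jint_jump tau tau c (Rle_refl _) (Rle_refl _)).
  replace (Jint l c) with (Jint l c - Jint (- tau) c + Jint (- tau) c) by ring. rewrite E1, <- E2. ring.
Qed.

Lemma Jint_down l c : (tau <= l)%R -> Jint (- l) c = Jint tau c - 2 * piC * Ci * F c.
Proof.
  intros Hl. rewrite <- (Jint_jump tau l c (Rle_refl _) Hl). ring.
Qed.
End Functional.

(** The product of [F] and the block has type at most 2 pi, the frequency of the sinc. The jump
    formula at the centre 0 therefore evaluates this product at 0, and the 1/2 is 2 pi i divided by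
    4 pi i. *)
Lemma isI_Tsinc_small tau F k c : pw tau F -> (0 < tau)%R -> (tau + Rabs k <= 2 * PI)%R ->
  isI (fun x => F (RtoC x) * Eb k c (RtoC x) * Tsinc (RtoC x)) (F 0 * Eb k c 0 / 2).
Proof.
  intros HF Ht Hk. assert (HP := pw_mult_Eb tau F k c HF).
  assert (Hp := piC_nz). assert (Hi := Ci_nz).
  set (P := fun z => F z * Eb k c z) in *.
  assert (Pt : (0 < tau + Rabs k)%R) by (generalize (Rabs_pos k); lra).
  assert (E := Jint_jump (tau + Rabs k) P HP Pt (2 * PI) (2 * PI) 0 Hk Hk).
  assert (I1 := Jint_isI (tau + Rabs k) P HP (2 * PI) 0). assert (I2 := Jint_isI (tau + Rabs k) P HP (- (2 * PI)) 0).
  set (v := Jint (tau + Rabs k) P HP (2 * PI) 0) in *. set (u := Jint (tau + Rabs k) P HP (- (2 * PI)) 0) in *.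
  assert (Ac : forall k, allc (fun x => P (RtoC x) * Eb k 0 (RtoC x))).
  { intros k'. apply allc_mult; [apply (allc_pw _ _ HP)|apply allc_real, hentire_centire, hentire_Eb]. }
  replace (F 0 * Eb k c 0 / 2) with (/ (4 * piC * Ci) * (v - u)).
  - apply isI_ext with (fun x => / (4 * piC * Ci) * (P (RtoC x) * Eb (2 * PI) 0 (RtoC x) - P (RtoC x) * Eb (- (2 * PI)) 0 (RtoC x))).
    { intros x. unfold P, Tsinc. field. auto. }
    apply isI_scal; [|apply isI_minus; auto].
    intros x. apply econt_minus; apply Ac.
  - rewrite E. unfold P. field. auto.
Qed.

Lemma isI_Tsinc tau F k (c : C) (HF : pw tau F) : c <> 0 ->
  isI (fun x => F (RtoC x) * Eb k c (RtoC x) * Tsinc (RtoC x))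
   ((Cexp (Ci * RtoC (2 * PI) * c) * (Jint tau F HF (k + 2 * PI) c - Jint tau F HF (2 * PI) c)
   - Cexp (- (Ci * RtoC (2 * PI) * c)) * (Jint tau F HF (k - 2 * PI) c - Jint tau F HF (- (2 * PI)) c)
   - Cexp (- (Ci * RtoC k * c)) * (Jint tau F HF (k + 2 * PI) 0 - Jint tau F HF (k - 2 * PI) 0)
   + (Jint tau F HF (2 * PI) 0 - Jint tau F HF (- (2 * PI)) 0)) / (4 * piC * Ci * c)).
Proof.
  intros Hc. assert (Hp := piC_nz). assert (Hi := Ci_nz).
  assert (Ac : forall k c, allc (fun x => F (RtoC x) * Eb k c (RtoC x))).
  { intros k' c'. apply allc_mult; [apply (allc_pw _ _ HF)|apply allc_real, hentire_centire, hentire_Eb]. }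
  set (e1 := Cexp (Ci * RtoC (2 * PI) * c)). set (e2 := Cexp (- (Ci * RtoC (2 * PI) * c))).
  set (e3 := Cexp (- (Ci * RtoC k * c))).
  set (B := fun k c x => F (RtoC x) * Eb k c (RtoC x)).
  apply isI_ext with (fun x => / (4 * piC * Ci * c) * (
     (e1 * (B (k + 2 * PI)%R c x - B (2 * PI)%R c x) - e2 * (B (k - 2 * PI)%R c x - B (- (2 * PI))%R c x)
      - e3 * (B (k + 2 * PI)%R 0 x - B (k - 2 * PI)%R 0 x)) + (B (2 * PI)%R 0 x - B (- (2 * PI))%R 0 x))).
  { intros x. transitivity (F (RtoC x) * (Eb k c (RtoC x) * Tsinc (RtoC x))); [|ring].
    rewrite (Eb_Tsinc k c (RtoC x) Hc). unfold B, e1, e2, e3. field. auto. }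
  unfold Cdiv at 1. rewrite (Cmult_comm _ (/ (4 * piC * Ci * c))).
  assert (Am : forall f g, allc f -> allc g -> allc (fun x => f x - g x)) by (intros f g Hf Hg x; apply econt_minus; auto).
  assert (AB : forall k c, allc (B k c)) by (intros; apply Ac).
  assert (IB : forall k c, isI (B k c) (Jint tau F HF k c)) by (intros; apply Jint_isI).
  assert (As : forall s f, allc f -> allc (fun x => s * f x)) by (intros; now apply allc_scal).
  apply isI_scal.
  { intros x. apply econt_plus.
    - apply (Am (fun x => e1 * (B (k + 2 * PI)%R c x - B (2 * PI)%R c x) - e2 * (B (k - 2 * PI)%R c x - B (- (2 * PI))%R c x)));
        [apply Am|]; apply As; apply Am; apply AB.
    - apply Am; apply AB. }
  apply isI_plus; [|apply isI_minus; auto].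
  apply isI_minus; [apply As; apply Am; apply AB| |apply isI_scal; [apply Am; apply AB|apply isI_minus; auto]].
  apply isI_minus; [apply As; apply Am; apply AB| |]; (apply isI_scal; [apply Am; apply AB|apply isI_minus; auto]).
Qed.

(** A candidate kernel is stored as a list of coefficients, frequencies and centres, so that its
    values by [comb] and its integrals by [combv] are computed from the same data. *)
Fixpoint comb (L : list (C * R * C)) (z : C) : C :=
  match L with
  | nil => 0
  | (a, k, c) :: L' => a * Eb k c z + comb L' z
  end.

Fixpoint combv (I : R -> C -> C) (L : list (C * R * C)) : C :=
  match L with
  | nil => 0
  | (a, k, c) :: L' => a * I k c + combv I L'
  end.

Lemma pw_comb tau L : (0 <= tau)%R -> (forall a k c, In (a, k, c) L -> (Rabs k <= tau)%R) -> pw tau (comb L).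
Proof.
  intros Ht. induction L as [|[[a k] c] L IH]; intros H.
  - simpl. assert (K := pw_scal tau (Eb 0 0) 0 (pw_Eb tau 0 0 ltac:(rewrite Rabs_R0; easy))).
    destruct K as [K1 [K2 [B K3]]]. split; [intros z; apply holo_const|split].
    + intros eps He. destruct (K2 eps He) as [M HM]. exists M. intros z. specialize (HM z).
      replace (0 * Eb 0 0 z) with (RtoC 0) in HM by ring. exact HM.
    + exists B. intros u v Huv. specialize (K3 u v Huv).
      rewrite (RInt_extR _ (sqw unitw (fun x => 0 * Eb 0 0 (RtoC x)))); [easy|].
      intros x. unfold sqw. do 3 f_equal. ring.
  - simpl. apply (pw_plus tau (fun z => a * Eb k c z) (comb L)).
    + apply pw_scal, pw_Eb. apply (H a k c). now left.
    + apply IH. intros a' k' c' Hin. apply (H a' k' c'). now right.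
Qed.

Lemma comb_isI (g : R -> C) (I : R -> C -> C) L : allc g ->
  (forall a k c, In (a, k, c) L -> isI (fun x => g x * Eb k c (RtoC x)) (I k c)) ->
  isI (fun x => g x * comb L (RtoC x)) (combv I L).
Proof.
  intros Hg. induction L as [|[[a k] c] L IH]; intros H.
  - simpl. apply isI_ext with (fun _ => 0); [intros; ring|].
    apply isI_eps; [intros x; apply econt_const|]. intros eps He. exists 0%R. intros u v _ _.
    rewrite CI_const. replace (RtoC (v - u) * 0 - 0) with (RtoC 0) by ring. rewrite Cmod_0. lra.
  - simpl. apply isI_ext with (fun x => a * (g x * Eb k c (RtoC x)) + g x * comb L (RtoC x)); [intros; ring|].
    apply isI_plus.
    + apply isI_scal; [|apply (H a); now left].
      apply allc_mult; [easy|apply allc_real, hentire_centire, hentire_Eb].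
    + apply IH. intros a' k' c' Hin. apply (H a'). now right.
Qed.

(** * Weighted integrals of the building blocks *)

Section WeightedFunctional.
Variables (tau : R) (F : C -> C).
Hypothesis (HF : pw tau F) (Ht : (0 < tau)%R).
Let J := Jint tau F HF.

Lemma allc_FW : allc (fun x => F (RtoC x) * RtoC (W_SOeven x)).
Proof. apply allc_mult; [apply (allc_pw _ _ HF)|apply allc_RtoC, Rcont_W]. Qed.

Lemma Wint_ex k c : exists v, isI (fun x => F (RtoC x) * RtoC (W_SOeven x) * Eb k c (RtoC x)) v.
Proof.
  destruct (pw_bddI_W _ _ HF) as [X HX].
  assert (HE : pw (Rabs k) (Eb k c)) by (apply pw_Eb; lra).
  destruct (pw_bddI_W _ _ HE) as [Y HY].
  destruct (isI_prod_exists W_SOeven (fun x => F (RtoC x)) (fun x => Eb k c (RtoC x)) X Y weight_W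
    (allc_pw _ _ HF) (allc_pw _ _ HE) HX HY) as [v Hv].
  exists v. revert Hv. apply isI_ext. intros x. ring.
Qed.

Definition Wint (k : R) (c : C) : C := proj1_sig (constructive_indefinite_description _ (Wint_ex k c)).

Lemma Wint_isI k c : isI (fun x => F (RtoC x) * RtoC (W_SOeven x) * Eb k c (RtoC x)) (Wint k c).
Proof. exact (proj2_sig (constructive_indefinite_description _ (Wint_ex k c))). Qed.

Lemma Wint_from_Tsinc k c v :
  isI (fun x => F (RtoC x) * Eb k c (RtoC x) * Tsinc (RtoC x)) v -> Wint k c = J k c + v.
Proof.
  intros Hv.
  apply (isI_unique (fun x => F (RtoC x) * RtoC (W_SOeven x) * Eb k c (RtoC x))).
  - apply allc_mult; [apply allc_FW|apply allc_real, hentire_centire, hentire_Eb].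
  - apply Wint_isI.
  - apply isI_ext with (fun x => F (RtoC x) * Eb k c (RtoC x) + F (RtoC x) * Eb k c (RtoC x) * Tsinc (RtoC x)).
    + intros x. rewrite W_Tsinc. ring.
    + apply isI_plus; [apply Jint_isI|easy].
Qed.

Lemma Wint_small k c : (tau + Rabs k <= 2 * PI)%R -> Wint k c = J k c + F 0 * Eb k c 0 / 2.
Proof. intros Hk. apply Wint_from_Tsinc. now apply (isI_Tsinc_small tau). Qed.

(** Shifting the frequency [tau] upwards by 2 pi stays above the band and contributes nothing new;
    shifting it downwards gives [tau - 2 * PI], the only frequency at which [J] need not reduce to
    [J tau] and a value of [F]. *)
Lemma Wint_tau (c : C) : c <> 0 -> (tau <= 2 * PI)%R ->
  Wint tau c = J tau c +
   (- Cexp (- (Ci * RtoC (2 * PI) * c)) * (J (tau - 2 * PI) c - (J tau c - 2 * piC * Ci * F c))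
   - Cexp (- (Ci * RtoC tau * c)) * (J tau 0 - J (tau - 2 * PI) 0)
   + 2 * piC * Ci * F 0) / (4 * piC * Ci * c).
Proof.
  intros Hc Hpi. rewrite (Wint_from_Tsinc _ _ _ (isI_Tsinc tau F tau c HF Hc)).
  assert (P := PI_RGT_0). f_equal. f_equal. fold J.
  assert (U1 : forall c, J (tau + 2 * PI) c = J tau c) by (intros; apply Jint_up; [exact Ht|lra]).
  assert (U2 : forall c, J (2 * PI) c = J tau c) by (intros; apply Jint_up; [exact Ht|lra]).
  assert (U3 : forall c, J (- (2 * PI)) c = J tau c - 2 * piC * Ci * F c)
    by (intros; apply Jint_down; [exact Ht|lra]).
  rewrite !U1, !U2, !U3. ring.
Qed.

Lemma Wint_opp_tau (c : C) : c <> 0 -> (tau <= 2 * PI)%R ->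
  Wint (- tau) c = J tau c - 2 * piC * Ci * F c +
   (Cexp (Ci * RtoC (2 * PI) * c) * (J (2 * PI - tau) c - J tau c)
   - Cexp (Ci * RtoC tau * c) * (J (2 * PI - tau) 0 - (J tau 0 - 2 * piC * Ci * F 0))
   + 2 * piC * Ci * F 0) / (4 * piC * Ci * c).
Proof.
  intros Hc Hpi. rewrite (Wint_from_Tsinc _ _ _ (isI_Tsinc tau F (- tau) c HF Hc)).
  assert (P := PI_RGT_0). fold J.
  assert (U0 : J (- tau) c = J tau c - 2 * piC * Ci * F c) by (apply Jint_down; [exact Ht|lra]).
  rewrite U0. f_equal. f_equal.
  assert (U1 : forall c, J (- tau - 2 * PI) c = J tau c - 2 * piC * Ci * F c).
  { intros c'. replace (- tau - 2 * PI)%R with (- (tau + 2 * PI))%R by ring. apply Jint_down; [exact Ht|lra]. }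
  assert (U2 : forall c, J (2 * PI) c = J tau c) by (intros; apply Jint_up; [exact Ht|lra]).
  assert (U3 : forall c, J (- (2 * PI)) c = J tau c - 2 * piC * Ci * F c)
    by (intros; apply Jint_down; [exact Ht|lra]).
  replace (- tau + 2 * PI)%R with (2 * PI - tau)%R by ring.
  replace (- (Ci * RtoC (- tau) * c)) with (Ci * RtoC tau * c) by (rewrite RtoC_opp; ring).
  rewrite !U1, !U2, !U3. ring.
Qed.

Lemma comb_reproduce L :
  isI (fun x => F (RtoC x) * comb L (RtoC x) * RtoC (W_SOeven x)) (combv Wint L).
Proof.
  apply isI_ext with (fun x => F (RtoC x) * RtoC (W_SOeven x) * comb L (RtoC x)); [intros; ring|].
  apply comb_isI; [apply allc_FW|]. intros. apply Wint_isI.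
Qed.
End WeightedFunctional.

(** The inner product conjugates the kernel. Reflecting the combination across the real axis undoes
    this: on the line the conjugate of the candidate is again the combination, and the candidate
    itself is entire. *)
Definition conj_ker (f : C -> C) (z : C) : C := Cconj (f (Cconj z)).

Lemma Cconj_R (x : R) : Cconj (RtoC x) = RtoC x.
Proof. apply Ceq; simpl; ring. Qed.

(** The kernel property at a single [w], so that existence can be settled separately at generic and
    at exceptional points. *)
Definition reproduces (Delta : R) (w : C) (k : C -> C) : Prop :=
  in_H_SOeven Delta k /\
  forall F, in_H_SOeven Delta F ->
    isI (fun x => F (RtoC x) * Cconj (k (RtoC x)) * RtoC (W_SOeven x)) (F w).

Lemma comb_reproduces Delta w L : (0 < Delta)%R ->
  (forall a k c, In (a, k, c) L -> (Rabs k <= PI * Delta)%R) ->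
  (forall F (HF : pw (PI * Delta) F), combv (Wint (PI * Delta) F HF) L = F w) ->
  reproduces Delta w (conj_ker (comb L)).
Proof.
  intros HD Hk Hv. assert (P := PI_RGT_0). split.
  - apply in_H_pw. apply (pw_conj (PI * Delta) (comb L)). apply pw_comb; [nra|easy].
  - intros F HF. apply in_H_pw in HF. rewrite <- (Hv F HF).
    generalize (comb_reproduce (PI * Delta) F HF L). apply isI_ext.
    intros x. unfold conj_ker. now rewrite Cconj_conj, Cconj_R.
Qed.

(** * The kernel for [Delta <= 1] *)

(** This is sin (k w) / (pi w), with the value k / pi at 0. *)
Definition sinc0 (k : R) (w : C) : C := (Eb k 0 w - Eb (- k) 0 w) / (2 * piC * Ci).

(** Under the weight, the sine kernel at [w] returns F(w) + sinc0(w) F(0) / 2, and the sine kernel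
    at 0 returns (1 + Delta/2) F(0). Cancelling F(0) forces the coefficient sinc0(w) / (2 +
    Delta). *)
Definition ker_i (Delta : R) (w : C) : list (C * R * C) :=
  let s := (PI * Delta)%R in let i2 := / (2 * piC * Ci) in
  let a := 1 / (2 + RtoC Delta) * sinc0 s w * i2 in
  (i2, s, w) :: (- i2, (- s)%R, w) :: (- a, s, RtoC 0) :: (a, (- s)%R, RtoC 0) :: nil.

Lemma ker_i_reproduces Delta w : (0 < Delta <= 1)%R -> reproduces Delta w (conj_ker (comb (ker_i Delta w))).
Proof.
  intros HD. assert (P := PI_RGT_0). assert (Hp := piC_nz). assert (Hi := Ci_nz).
  assert (Hs : (0 < PI * Delta)%R) by nra.
  assert (HD2 : 2 + RtoC Delta <> 0) by (rewrite <- RtoC_plus; apply RtoC_nz; lra).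
  apply comb_reproduces; [lra| |].
  - intros a k c H. unfold ker_i in H. simpl in H.
    assert (Ab : Rabs (PI * Delta) = (PI * Delta)%R) by (apply Rabs_pos_eq; lra).
    decompose [or] H; try easy;
      match goal with E : (_, _, _) = (_, _, _) |- _ => injection E as <- <- <- end;
      rewrite ?Rabs_Ropp, Ab; lra.
  - intros F HF. unfold ker_i. simpl combv. set (s := (PI * Delta)%R) in *.
    assert (B : forall k c, (k = s \/ k = - s)%R -> Wint s F HF k c = Jint s F HF k c + F 0 * Eb k c 0 / 2).
    { intros k c Hk. apply Wint_small; [easy|].
      assert (Rabs k = s) by (destruct Hk as [-> | ->]; rewrite ?Rabs_Ropp; apply Rabs_pos_eq; lra).
      unfold s in *. nra. }
    rewrite !B by lra.
    assert (Dn : forall c, Jint s F HF (- s) c = Jint s F HF s c - 2 * piC * Ci * F c)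
      by (intros; apply Jint_down; [easy|lra]).
    rewrite !Dn, !Eb_at.
    assert (Sw : forall k, Eb k w 0 = - Eb (- k) 0 w)
      by (intros k; rewrite <- (Ropp_involutive k) at 1; apply Eb_swap).
    rewrite !Sw, !Ropp_involutive. unfold sinc0. rewrite RtoC_opp.
    replace (RtoC s) with (piC * RtoC Delta) by (unfold s; now rewrite RtoC_mult).
    field. repeat split; auto.
Qed.

Lemma Cexp_Csin u : Csin u = (Cexp (Ci * u) - / Cexp (Ci * u)) / (2 * Ci).
Proof. unfold Csin. now rewrite Cexp_opp. Qed.

Lemma Cexp_Ccos u : Ccos u = (Cexp (Ci * u) + / Cexp (Ci * u)) / 2.
Proof. unfold Ccos. now rewrite Cexp_opp. Qed.

Lemma Cconj_Ci : Cconj Ci = - Ci.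
Proof. apply Ceq; simpl; ring. Qed.

Lemma Cconj_piC : Cconj piC = piC.
Proof. apply Cconj_R. Qed.

Lemma ker_i_formula Delta w z : nonsing_i w z -> (0 < Delta)%R ->
  conj_ker (comb (ker_i Delta w)) z = K_formula_i Delta w z.
Proof.
  intros [Hw [Hz Hzw]] HD. assert (Hp := piC_nz). assert (Hi := Ci_nz).
  assert (HD2 : 2 + RtoC Delta <> 0) by (rewrite <- RtoC_plus; apply RtoC_nz; lra).
  assert (Hd : z - Cconj w <> 0) by now apply Cminus_eq_contra.
  assert (Hcw : Cconj w <> 0) by (intros E; apply Hw; rewrite <- (Cconj_conj w), E; apply Cconj_R).
  assert (N2 : 2 * piC * Ci <> 0) by (repeat apply Cmult_neq_0; auto; apply RtoC_nz; lra).
  unfold conj_ker, ker_i, K_formula_i, sinc0. simpl comb.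
  set (s := (PI * Delta)%R).
  repeat (rewrite Cplus_conj || rewrite Cmult_conj || rewrite Cminus_conj || rewrite Copp_conj
    || (rewrite Cinv_conj by auto) || (rewrite Cdiv_conj by auto)).
  rewrite !Eb_conj, !Cconj_conj, !Cconj_R, Cconj_Ci, Cconj_piC.
  rewrite !Ropp_involutive.
  rewrite !Eb_off by auto. rewrite !Cexp_Csin.
  replace (Ci * RtoC (- s) * (z - Cconj w)) with (- (Ci * (piC * RtoC Delta * (z - Cconj w))))
    by (unfold s; rewrite RtoC_opp, RtoC_mult; unfold piC; ring).
  replace (Ci * RtoC s * (z - Cconj w)) with (Ci * (piC * RtoC Delta * (z - Cconj w)))
    by (unfold s; rewrite RtoC_mult; unfold piC; ring).
  replace (Ci * RtoC (- s) * (z - 0)) with (- (Ci * (piC * RtoC Delta * z)))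
    by (unfold s; rewrite RtoC_opp, RtoC_mult; unfold piC; ring).
  replace (Ci * RtoC s * (z - 0)) with (Ci * (piC * RtoC Delta * z))
    by (unfold s; rewrite RtoC_mult; unfold piC; ring).
  replace (Ci * RtoC (- s) * (Cconj w - 0)) with (- (Ci * (piC * RtoC Delta * Cconj w)))
    by (unfold s; rewrite RtoC_opp, RtoC_mult; unfold piC; ring).
  replace (Ci * RtoC s * (Cconj w - 0)) with (Ci * (piC * RtoC Delta * Cconj w))
    by (unfold s; rewrite RtoC_mult; unfold piC; ring).
  rewrite !Cexp_opp.
  assert (N1 := Cexp_nz (Ci * (piC * RtoC Delta * (z - Cconj w)))).
  assert (N3 := Cexp_nz (Ci * (piC * RtoC Delta * z))).
  assert (N4 := Cexp_nz (Ci * (piC * RtoC Delta * Cconj w))).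
  replace (z - 0) with z by ring. replace (Cconj w - 0) with (Cconj w) by ring.
  field. repeat split; auto.
Qed.

(** * The kernel for [1 < Delta <= 2] *)

(** Given to [field] as a side equation, so that rational identities are decided modulo i^2 = -1. *)
Lemma Ci2 : Ci * Ci = RtoC (-1).
Proof. apply Ceq; simpl; ring. Qed.

Lemma Cmult_2_neq (z : C) : z <> 0 -> 2 * z <> 0.
Proof. intros H. apply Cmult_neq_0; [apply RtoC_nz; lra|easy]. Qed.

(** The zeros of 1 - 16 pi^2 w^2. The denominators 2 pi i z + i/2 and 2 pi i z - i/2 of the formula
    are 2 pi i (z - [cm]) and 2 pi i (z - [cp]). *)
Definition cm : C := RtoC (- / (4 * PI)).
Definition cp : C := RtoC (/ (4 * PI)).

Lemma cp_eq : cp = / (4 * piC).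
Proof.
  assert (P := PI_RGT_0). unfold cp. rewrite RtoC_inv, RtoC_mult by lra. reflexivity.
Qed.

Lemma cm_eq : cm = - / (4 * piC).
Proof. unfold cm. rewrite RtoC_opp. fold cp. now rewrite cp_eq. Qed.

Section PartTwo.
Variables (Delta : R) (w : C).
Hypothesis (HD : (1 < Delta <= 2)%R) (Hw0 : w <> 0) (Hwp : w <> cp) (Hwm : w <> cm).

Let s : R := (PI * Delta)%R.
(** Since [s + r = 2 * PI], a shift by 2 pi exchanges [s] with [- r] and [r] with [- s]. *)
Let r : R := (PI * (2 - Delta))%R.
Let P : C := Cexp (RtoC ((2 - Delta) / 4) * Ci).
Let Q : C := Cexp (RtoC (Delta / 4) * Ci).
Let A := A_ii Delta w.
Let B := B_ii Delta w.
Let Cw := C_ii w.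
Let Ct := Cconj (C_ii (Cconj w)).
Let D := D_ii Delta w.
Let x := Cexp (Ci * RtoC s * w).
Let y := Cexp (Ci * RtoC r * w).
Let den (w : C) : C := 1 - RtoC 16 * piC ^ 2 * w ^ 2.

Lemma den_nz (v : C) : v <> cp -> v <> cm -> den v <> 0.
Proof.
  intros H1 H2 E. assert (Hp := piC_nz). unfold den in E.
  replace (1 - RtoC 16 * piC ^ 2 * v ^ 2) with ((1 - 4 * piC * v) * (1 + 4 * piC * v)) in E by ring.
  assert (N4 : 4 * piC <> 0) by (apply Cmult_neq_0; [apply RtoC_nz; lra|easy]).
  revert E. apply Cmult_neq_0; intros E.
  - apply H1. rewrite cp_eq. replace v with ((1 - (1 - 4 * piC * v)) / (4 * piC)) by (field; easy).
    rewrite E. field. easy.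
  - apply H2. rewrite cm_eq. replace v with ((1 + 4 * piC * v - 1) / (4 * piC)) by (field; easy).
    rewrite E. field. easy.
Qed.

Lemma Cconj_unit t : Cconj (Cexp (RtoC t * Ci)) = / Cexp (RtoC t * Ci).
Proof.
  rewrite Cconj_Cexp, <- Cexp_opp. f_equal. rewrite Cmult_conj, Cconj_Ci, Cconj_R. ring.
Qed.

(** The determinant is 2 i times the imaginary part of conj(a) b. With th = (Delta - 1)/2 this part
    equals 2 + 2 sin th - (1 - (2 - Delta)/2) cos th, which is at least 1 because sin th is
    nonnegative and the factor of cos th lies between 0 and 1 in modulus. *)
Lemma det_nz : Cconj (a_ii Delta) * b_ii Delta - a_ii Delta * Cconj (b_ii Delta) <> 0.
Proof.
  assert (HQ : Q = (cos (Delta / 4), sin (Delta / 4))) by (unfold Q; rewrite Cmult_comm; apply Cexp_Ci_R).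
  assert (HP : P = (cos ((2 - Delta) / 4), sin ((2 - Delta) / 4))) by (unfold P; rewrite Cmult_comm; apply Cexp_Ci_R).
  assert (S1 := sin2_cos2 (Delta / 4)). assert (S2 := sin2_cos2 ((2 - Delta) / 4)).
  set (th := (Delta / 4 - (2 - Delta) / 4)%R).
  assert (Eth : th = ((Delta - 1) / 2)%R) by (unfold th; field).
  assert (Cth : cos th = (cos (Delta / 4) * cos ((2 - Delta) / 4) + sin (Delta / 4) * sin ((2 - Delta) / 4))%R)
    by apply cos_minus.
  assert (Sth : sin th = (sin (Delta / 4) * cos ((2 - Delta) / 4) - cos (Delta / 4) * sin ((2 - Delta) / 4))%R)
    by apply sin_minus.
  assert (P3 := PI2_3_2).
  assert (Spos : (0 <= sin th)%R) by (apply sin_ge_0; lra).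
  assert (Cb := COS_bound th).
  assert (E : forall u v : C, Cconj u * v - u * Cconj v = 2 * Ci * RtoC (Im (Cconj u * v))).
  { intros [u1 u2] [v1 v2]. apply Ceq; simpl; ring. }
  rewrite E. apply Cmult_neq_0; [apply Cmult_2_neq, Ci_nz|]. apply RtoC_nz.
  assert (EI : Im (Cconj (a_ii Delta) * b_ii Delta)
    = (2 + 2 * sin th - cos th + 2 * ((2 - Delta) / 4) * cos th)%R).
  { unfold a_ii, b_ii, tau_ii. fold P Q. rewrite HP, HQ, Cth, Sth. unfold Rsqr in S1, S2.
    set (ca := cos ((2 - Delta) / 4)) in *. set (sa := sin ((2 - Delta) / 4)) in *.
    set (cb := cos (Delta / 4)) in *. set (sb := sin (Delta / 4)) in *. set (e := ((2 - Delta) / 4)%R).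
    (* The constant 2 is the sum of cos^2 + sin^2 over the two angles; written so, the claim is a
       polynomial identity. *)
    replace 2%R with ((sb * sb + cb * cb) + (sa * sa + ca * ca))%R at 1 by lra.
    simpl. ring. }
  rewrite EI. nra.
Qed.

(** [A_ii] and [B_ii] are Cramer's solution of this system. The first equation will say that F(0)
    cancels, the difference of the two is one of the conditions at frequencies +-r. *)
Lemma A_B_system :
  a_ii Delta * A + Cconj (a_ii Delta) * B = G_ii Delta w /\
  b_ii Delta * A + Cconj (b_ii Delta) * B = Cconj (G_ii Delta (Cconj w)).
Proof.
  assert (N := det_nz). unfold A, B, A_ii, B_ii. split; field; easy.
Qed.

Lemma exp_2pi (c : C) : Cexp (Ci * RtoC (2 * PI) * c) = Cexp (Ci * RtoC s * c) * Cexp (Ci * RtoC r * c).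
Proof.
  rewrite <- Cexp_plus. f_equal. replace (2 * PI)%R with (s + r)%R by (unfold s, r; ring).
  rewrite RtoC_plus. ring.
Qed.

(** With the exponentials of frequencies [s] and [r] as variables, and e^(2 pi i v) as their
    product, all identities of this section become rational. *)
Lemma C_ii_expl (v : C) : C_ii v = (- (RtoC 16 * piC ^ 2 * v ^ 2)
  - 4 * piC * Ci * v * (Cexp (Ci * RtoC s * v) * Cexp (Ci * RtoC r * v))) / den v.
Proof.
  unfold C_ii. rewrite <- exp_2pi. unfold den. do 3 f_equal. f_equal.
  rewrite RtoC_mult. fold piC. ring.
Qed.

Lemma F_ii_expl (v : C) : F_ii Delta v = (let X := Cexp (Ci * RtoC s * v) in let Y := Cexp (Ci * RtoC r * v) in
  (Y + / Y - 8 * piC * v * ((X - / X) / (2 * Ci))) / den v).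
Proof.
  unfold F_ii. cbv zeta. rewrite Cexp_Csin, Cexp_Ccos.
  replace (Ci * (piC * (2 - RtoC Delta) * v)) with (Ci * RtoC r * v)
    by (unfold r; rewrite RtoC_mult, RtoC_minus; unfold piC; ring).
  replace (Ci * (piC * RtoC Delta * v)) with (Ci * RtoC s * v)
    by (unfold s; rewrite RtoC_mult; unfold piC; ring).
  unfold den. f_equal. field. repeat split; try apply Cexp_nz; apply Ci_nz.
Qed.

Lemma G_ii_expl (v : C) : v <> 0 -> den v <> 0 ->
  G_ii Delta v = (let X := Cexp (Ci * RtoC s * v) in let Y := Cexp (Ci * RtoC r * v) in
   (X + / X + 4 * piC * Ci * v * / X - Y) / den v - (Y - / Y) / (2 * Ci) / (2 * piC * v * den v)
   + RtoC ((2 - Delta) / 4) * F_ii Delta v).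
Proof.
  intros Hv Hd. unfold G_ii. cbv zeta. rewrite Cexp_Csin, Cexp_Ccos.
  replace (Ci * (piC * (2 - RtoC Delta) * v)) with (Ci * RtoC r * v)
    by (unfold r; rewrite RtoC_mult, RtoC_minus; unfold piC; ring).
  replace (piC * (2 - RtoC Delta) * Ci * v) with (Ci * RtoC r * v)
    by (unfold r; rewrite RtoC_mult, RtoC_minus; unfold piC; ring).
  replace (Ci * (piC * RtoC Delta * v)) with (Ci * RtoC s * v)
    by (unfold s; rewrite RtoC_mult; unfold piC; ring).
  replace (piC * RtoC Delta * Ci * v) with (Ci * RtoC s * v)
    by (unfold s; rewrite RtoC_mult; unfold piC; ring).
  rewrite Cexp_opp. fold (den v).
  assert (Hp := piC_nz). assert (Hi := Ci_nz).
  assert (N1 := Cexp_nz (Ci * RtoC r * v)). assert (N2 := Cexp_nz (Ci * RtoC s * v)).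
  field. repeat split; auto.
Qed.

Lemma conj_exp_conj k : Cconj (Cexp (Ci * RtoC k * Cconj w)) = / Cexp (Ci * RtoC k * w).
Proof.
  rewrite Cconj_Cexp, <- Cexp_opp. f_equal.
  rewrite !Cmult_conj, Cconj_Ci, Cconj_R, Cconj_conj. ring.
Qed.

Lemma den_w : den w <> 0.
Proof. now apply den_nz. Qed.

Lemma Cconj_den : Cconj (den (Cconj w)) = den w.
Proof.
  unfold den. rewrite Cminus_conj, !Cmult_conj, !Cpow_conj, Cconj_conj, Cconj_piC, !Cconj_R. reflexivity.
Qed.

Lemma den_conj_w : den (Cconj w) <> 0.
Proof.
  intros E. apply den_w. rewrite <- Cconj_den, E. apply Cconj_R.
Qed.

Lemma Cw_expl : Cw = (- (RtoC 16 * piC ^ 2 * w ^ 2) - 4 * piC * Ci * w * (x * y)) / den w.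
Proof. apply C_ii_expl. Qed.

Lemma Ct_expl : Ct = (- (RtoC 16 * piC ^ 2 * w ^ 2) + 4 * piC * Ci * w * (/ x * / y)) / den w.
Proof.
  unfold Ct. rewrite C_ii_expl. rewrite Cdiv_conj by apply den_conj_w. rewrite Cconj_den.
  rewrite Cminus_conj, Copp_conj, !Cmult_conj, !conj_exp_conj, !Cpow_conj, Cconj_conj, Cconj_piC, Cconj_Ci, !Cconj_R.
  fold x y. unfold Cdiv. ring.
Qed.

Lemma Fw_expl : F_ii Delta w = (y + / y - 8 * piC * w * ((x - / x) / (2 * Ci))) / den w.
Proof. apply F_ii_expl. Qed.

Lemma Cconj_w_nz : Cconj w <> 0.
Proof. intros E. apply Hw0. rewrite <- (Cconj_conj w), E. apply Cconj_R. Qed.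

Lemma Gs_expl : Cconj (G_ii Delta (Cconj w)) =
   (x + / x - 4 * piC * Ci * w * x - / y) / den w - (y - / y) / (2 * Ci) / (2 * piC * w * den w)
   + RtoC ((2 - Delta) / 4) * F_ii Delta w.
Proof.
  assert (Hp := piC_nz). assert (Hi := Ci_nz). assert (Hcw := Cconj_w_nz).
  assert (Hd := den_w). assert (Hdc := den_conj_w).
  assert (Nx : x <> 0) by apply Cexp_nz. assert (Ny : y <> 0) by apply Cexp_nz.
  assert (Nxc := Cexp_nz (Ci * RtoC s * Cconj w)). assert (Nyc := Cexp_nz (Ci * RtoC r * Cconj w)).
  assert (N2i : 2 * Ci <> 0) by now apply Cmult_2_neq.
  assert (N2p : 2 * piC * Cconj w * den (Cconj w) <> 0)
    by (repeat apply Cmult_neq_0; auto; apply RtoC_nz; lra).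
  rewrite G_ii_expl by auto. cbv zeta. rewrite F_ii_expl. cbv zeta.
  repeat (rewrite Cplus_conj || rewrite Cmult_conj || rewrite Cminus_conj || rewrite Copp_conj
    || (rewrite Cinv_conj by auto) || (rewrite Cdiv_conj by auto)).
  rewrite !conj_exp_conj, !Cconj_conj, !Cconj_R, Cconj_Ci, Cconj_piC, Cconj_den. fold x y.
  rewrite Fw_expl. field. repeat split; auto.
Qed.

(** Up to sign, the two terms on the right are the contributions of the blocks at [w] to the
    coefficients of J(r) and J(-r) at 0. [F_ii] is their difference, and [Gdiff] is minus their
    sum. *)
Lemma F_from_C : F_ii Delta w = (Ct * x - Cw * / x) / (4 * piC * Ci * w).
Proof.
  assert (Hp := piC_nz). assert (Hi := Ci_nz). assert (Hd := den_w).
  assert (Nx : x <> 0) by apply Cexp_nz. assert (Ny : y <> 0) by apply Cexp_nz.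
  rewrite Fw_expl, Ct_expl, Cw_expl. field [Ci2]. repeat split; auto.
Qed.

Lemma Gdiff : Cconj (G_ii Delta (Cconj w)) - G_ii Delta w = - (Ct * x + Cw * / x) / (4 * piC * Ci * w).
Proof.
  assert (Hp := piC_nz). assert (Hi := Ci_nz). assert (Hd := den_w).
  assert (Nx : x <> 0) by apply Cexp_nz. assert (Ny : y <> 0) by apply Cexp_nz.
  rewrite Gs_expl, (G_ii_expl w) by auto. cbv zeta. fold x y. rewrite Ct_expl, Cw_expl. field [Ci2]. repeat split; auto.
Qed.

Lemma tau_conj : Cconj (tau_ii Delta) = / P - Ci * / Q.
Proof.
  unfold tau_ii. fold P Q. rewrite Cplus_conj, Cmult_conj, Cconj_Ci. unfold P, Q. rewrite !Cconj_unit. ring.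
Qed.

Lemma a_conj : Cconj (a_ii Delta) = / Q - Ci * / P + Ci * / Q + RtoC ((2 - Delta) / 4) * (/ P - Ci * / Q).
Proof.
  unfold a_ii. fold P Q. rewrite !Cplus_conj, Cminus_conj, !Cplus_conj, !Cmult_conj, Cconj_Ci, Cconj_R, tau_conj.
  unfold P, Q. rewrite !Cconj_unit. ring.
Qed.

Lemma b_conj : Cconj (b_ii Delta) = / Q - Ci * / P - / P + RtoC ((2 - Delta) / 4) * (/ P - Ci * / Q).
Proof.
  unfold b_ii. fold P Q. rewrite !Cplus_conj, Cminus_conj, !Cplus_conj, !Cmult_conj, Cconj_Ci, Cconj_R, tau_conj.
  unfold P, Q. rewrite !Cconj_unit. ring.
Qed.

(** The difference of the two equations for [A] and [B], where b - a = i Q - P. *)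
Lemma AB_diff : (Ci * Q - P) * A - (Ci * / Q + / P) * B = - (Ct * x + Cw * / x) / (4 * piC * Ci * w).
Proof.
  rewrite <- Gdiff. destruct A_B_system as [E1 E2]. rewrite <- E1, <- E2, a_conj, b_conj.
  unfold a_ii, b_ii. fold P Q. ring.
Qed.

Lemma D_expl : D = 1 / 2 * ((P + Ci * Q) * A + (/ P - Ci * / Q) * B - F_ii Delta w).
Proof. unfold D, D_ii. rewrite tau_conj. reflexivity. Qed.

(** The total coefficient of J(-r) at 0. Its sum with the coefficient of J(r) in [coef_r0] vanishes
    by [AB_diff], and their difference vanishes by the definition of [D]. *)
Lemma coef_m0 : Ci * Q * A - Ci * / Q * B - D + Cw * / x / (4 * piC * Ci * w) = 0.
Proof.
  assert (Hp := piC_nz). assert (Hi := Ci_nz). assert (Nx : x <> 0) by apply Cexp_nz.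
  assert (NQ : Q <> 0) by apply Cexp_nz. assert (NP : P <> 0) by apply Cexp_nz.
  rewrite D_expl.
  transitivity (1 / 2 * (((Ci * Q - P) * A - (Ci * / Q + / P) * B) + F_ii Delta w) + Cw * / x / (4 * piC * Ci * w));
    [field; repeat split; auto|]. rewrite AB_diff, F_from_C. field. repeat split; auto.
Qed.

Lemma coef_r0 : - P * A - / P * B + D + Ct * x / (4 * piC * Ci * w) = 0.
Proof.
  assert (Hp := piC_nz). assert (Hi := Ci_nz). assert (Nx : x <> 0) by apply Cexp_nz.
  assert (NQ : Q <> 0) by apply Cexp_nz. assert (NP : P <> 0) by apply Cexp_nz.
  rewrite D_expl.
  transitivity (1 / 2 * (((Ci * Q - P) * A - (Ci * / Q + / P) * B) - F_ii Delta w) + Ct * x / (4 * piC * Ci * w));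
    [field; repeat split; auto|]. rewrite AB_diff, F_from_C. field. repeat split; auto.
Qed.

(* The contribution of the pole at [w] to the coefficient of [F 0]. *)
Let Sw : C := Cw * (1 - / x) / (2 * w) + Cw * (/ y - 1) / (2 * w) + Ct * (- (y - 1) / (2 * w) - 1 / (2 * w))
  + (- (/ y - 1) + (y - 1)) / (2 * w).

(** The total coefficient of F(0). Substituting [D] turns the coefficients of [A] and [B] into 2 pi
    i a and 2 pi i conj(a), and the remaining part of [D] accounts for the term in [G_ii] that
    contains [F_ii]; what results is the first equation of [A_B_system]. *)
Lemma coef_f0 : 2 * piC * (Q - P + Ci * Q) * A + 2 * piC * (/ P - / Q + Ci * / Q) * B + D * (Ci * RtoC r) + Sw = 0.
Proof.
  assert (Hp := piC_nz). assert (Hi := Ci_nz). assert (Hd := den_w).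
  assert (Nx : x <> 0) by apply Cexp_nz. assert (Ny : y <> 0) by apply Cexp_nz.
  assert (NQ : Q <> 0) by apply Cexp_nz. assert (NP : P <> 0) by apply Cexp_nz.
  set (e := RtoC ((2 - Delta) / 4)).
  assert (Er : RtoC r = 4 * piC * e).
  { unfold r, e, piC. rewrite <- !RtoC_mult. f_equal. field. }
  assert (E1 : a_ii Delta * A + Cconj (a_ii Delta) * B = G_ii Delta w) by apply A_B_system.
  transitivity (2 * piC * Ci * (a_ii Delta * A + Cconj (a_ii Delta) * B - e * F_ii Delta w) + Sw).
  - rewrite D_expl, Er, a_conj. unfold a_ii, tau_ii. fold P Q e. field [Ci2]. auto.
  - rewrite E1, G_ii_expl by auto. cbv zeta. fold x y e. unfold Sw. rewrite Ct_expl, Cw_expl.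
    unfold den in *. field [Ci2]. repeat split; auto.
Qed.

(** At a centre c, J(-r) cancels between frequencies [s] and [- r] when the second pair has ratio
    e^(-2 pi i c) / (4 pi i c) to the first. This ratio is [k1] at [cm] and [k2] at [cp], where
    [P * Q] is e^(i/2), and at these two centres J(r) cancels as well. *)
Definition ker_ii : list (C * R * C) :=
  let i2 := / (2 * piC * Ci) in
  let k1 := Ci * (P * Q) in let k2 := - Ci * / (P * Q) in
  (i2 * A, s, cm) :: (- i2 * A, r, cm) :: (i2 * A * k1, (- r)%R, cm) :: (- i2 * A * k1, (- s)%R, cm) ::
  (i2 * B, s, cp) :: (- i2 * B, r, cp) :: (i2 * B * k2, (- r)%R, cp) :: (- i2 * B * k2, (- s)%R, cp) ::
  (i2 * Cw, s, w) :: (- i2 * Cw, r, w) :: (i2 * Ct, (- r)%R, w) :: (- i2 * Ct, (- s)%R, w) ::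
  (i2 * D, r, RtoC 0) :: (- i2 * D, (- r)%R, RtoC 0) :: (i2, r, w) :: (- i2, (- r)%R, w) :: nil.

(** * Cancellation of the unknown integrals in the kernel *)

Section Values.
Variables (F : C -> C) (HF : pw s F).
Let J := Jint s F HF.
Let I := Wint s F HF.
Let f0 := F 0.
(** The value of J(-s) at the centre 0, from below the band; it serves as the origin for J(r) and
    J(-r). *)
Let n0 := J s 0 - 2 * piC * Ci * f0.

Lemma s_pos : (0 < s)%R.
Proof. unfold s. generalize PI_RGT_0. nra. Qed.
Lemma s_le : (s <= 2 * PI)%R.
Proof. unfold s. generalize PI_RGT_0. nra. Qed.
Lemma r_pos : (0 <= r)%R.
Proof. unfold r. generalize PI_RGT_0. nra. Qed.

Lemma I_r k c : (k = r \/ k = - r)%R -> I k c = J k c + f0 * Eb k c 0 / 2.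
Proof.
  intros Hk. apply Wint_small; [apply s_pos|].
  assert (Rr := r_pos).
  replace (Rabs k) with r by (destruct Hk as [-> | ->]; rewrite ?Rabs_Ropp, Rabs_pos_eq; easy).
  unfold s, r. lra.
Qed.

Lemma I_s (c : C) : c <> 0 -> I s c = J s c +
   (- / (Cexp (Ci * RtoC s * c) * Cexp (Ci * RtoC r * c)) * (J (- r) c - (J s c - 2 * piC * Ci * F c))
   - / Cexp (Ci * RtoC s * c) * (J s 0 - J (- r) 0) + 2 * piC * Ci * f0) / (4 * piC * Ci * c).
Proof.
  intros Hc. unfold I. rewrite (Wint_tau s F HF s_pos c Hc s_le). fold J.
  replace (s - 2 * PI)%R with (- r)%R by (unfold s, r; ring). rewrite !Cexp_opp, exp_2pi. reflexivity.
Qed.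

Lemma I_ms (c : C) : c <> 0 -> I (- s) c = J s c - 2 * piC * Ci * F c +
   (Cexp (Ci * RtoC s * c) * Cexp (Ci * RtoC r * c) * (J r c - J s c)
   - Cexp (Ci * RtoC s * c) * (J r 0 - (J s 0 - 2 * piC * Ci * f0))
   + 2 * piC * Ci * f0) / (4 * piC * Ci * c).
Proof.
  intros Hc. unfold I. rewrite (Wint_opp_tau s F HF s_pos c Hc s_le). fold J.
  replace (2 * PI - s)%R with r by (unfold s, r; ring). rewrite exp_2pi. reflexivity.
Qed.

Lemma Eb_zero_point k (c : C) : c <> 0 -> Eb k c 0 = - (/ Cexp (Ci * RtoC k * c) - 1) / c.
Proof.
  intros Hc. rewrite Eb_off by auto.
  replace (Ci * RtoC k * (0 - c)) with (- (Ci * RtoC k * c)) by ring. rewrite Cexp_opp.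
  assert (N := Cexp_nz (Ci * RtoC k * c)). replace (0 - c) with (RtoC (-1) * c) by ring.
  field. repeat split; auto; apply RtoC_nz; lra.
Qed.

Lemma exp_opp_k k (c : C) : Cexp (Ci * RtoC (- k) * c) = / Cexp (Ci * RtoC k * c).
Proof. rewrite <- Cexp_opp. f_equal. rewrite RtoC_opp. ring. Qed.

Lemma exp_s_cm : Cexp (Ci * RtoC s * cm) = / Q.
Proof.
  assert (Hp := PI_RGT_0). unfold Q, cm. rewrite <- Cexp_opp. f_equal. unfold s.
  transitivity (Ci * RtoC (PI * Delta * - / (4 * PI))); [rewrite !RtoC_mult; ring|].
  transitivity (Ci * RtoC (- (Delta / 4))); [do 2 f_equal; field; lra|rewrite RtoC_opp; ring].
Qed.

Lemma exp_r_cm : Cexp (Ci * RtoC r * cm) = / P.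
Proof.
  assert (Hp := PI_RGT_0). unfold P, cm. rewrite <- Cexp_opp. f_equal. unfold r.
  transitivity (Ci * RtoC (PI * (2 - Delta) * - / (4 * PI))); [rewrite !RtoC_mult; ring|].
  transitivity (Ci * RtoC (- ((2 - Delta) / 4))); [do 2 f_equal; field; lra|rewrite RtoC_opp; ring].
Qed.

Lemma exp_cp k : Cexp (Ci * RtoC k * cp) = / Cexp (Ci * RtoC k * cm).
Proof. rewrite <- Cexp_opp. f_equal. rewrite cp_eq, cm_eq. ring. Qed.

(** Every integral centred at [cm], and the value of [F] there, has cancelled, so [A] can be chosen
    freely; only terms centred at 0 remain. *)
Lemma block_cm : I s cm - I r cm + Ci * (P * Q) * (I (- r) cm - I (- s) cm) =
  Ci * Q * (J (- r) 0 - n0) - P * (J r 0 - n0) + 2 * piC * f0 * (Q - P + Ci * Q).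
Proof.
  assert (Hp := piC_nz). assert (Hi := Ci_nz).
  assert (NQ : Q <> 0) by apply Cexp_nz. assert (NP : P <> 0) by apply Cexp_nz.
  assert (Ncm : cm <> 0) by (unfold cm; apply RtoC_nz; generalize (Rinv_0_lt_compat (4 * PI)); generalize PI_RGT_0; lra).
  rewrite I_s, I_ms, !I_r, !Eb_zero_point, !exp_opp_k, exp_s_cm, exp_r_cm by auto.
  unfold n0. rewrite cm_eq. field [Ci2]. repeat split; auto.
Qed.

Lemma block_cp : I s cp - I r cp + - Ci * / (P * Q) * (I (- r) cp - I (- s) cp) =
  - Ci * / Q * (J (- r) 0 - n0) - / P * (J r 0 - n0) + 2 * piC * f0 * (/ P - / Q + Ci * / Q).
Proof.
  assert (Hp := piC_nz). assert (Hi := Ci_nz).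
  assert (NQ : Q <> 0) by apply Cexp_nz. assert (NP : P <> 0) by apply Cexp_nz.
  assert (Ncp : cp <> 0) by (unfold cp; apply RtoC_nz; generalize (Rinv_0_lt_compat (4 * PI)); generalize PI_RGT_0; lra).
  rewrite I_s, I_ms, !I_r, !Eb_zero_point, !exp_opp_k, !exp_cp, exp_s_cm, exp_r_cm by auto.
  unfold n0. rewrite cp_eq. field [Ci2]. repeat split; auto.
Qed.

(** [Cw] and [Ct] solve the inhomogeneous system whose right side comes from the last pair, of
    coefficient 1. All integrals centred at [w] cancel, and F(w) survives with the factor 2 pi i. *)
Lemma block_w : Cw * (I s w - I r w) + Ct * (I (- r) w - I (- s) w) + (I r w - I (- r) w) =
  2 * piC * Ci * F w + (J (- r) 0 - n0) * (Cw * / x / (4 * piC * Ci * w))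
  + (J r 0 - n0) * (Ct * x / (4 * piC * Ci * w)) + f0 * Sw.
Proof.
  assert (Hp := piC_nz). assert (Hi := Ci_nz). assert (Hd := den_w).
  assert (Nx : x <> 0) by apply Cexp_nz. assert (Ny : y <> 0) by apply Cexp_nz.
  rewrite I_s, I_ms, !I_r, !Eb_zero_point, !exp_opp_k by auto. fold x y.
  unfold n0, Sw. rewrite Cw_expl, Ct_expl. unfold den in *. field [Ci2]. repeat split; auto.
Qed.

Lemma block_0 : I r 0 - I (- r) 0 = J r 0 - J (- r) 0 + f0 * (Ci * RtoC r).
Proof. rewrite !I_r, !Eb_at, RtoC_opp by auto. field. Qed.

(** The sixteen terms are grouped by centre, then regrouped by the three remaining unknowns, whose
    coefficients vanish. *)
Lemma ker_ii_value : combv I ker_ii = F w.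
Proof.
  assert (Hp := piC_nz). assert (Hi := Ci_nz).
  unfold ker_ii. simpl combv.
  transitivity (/ (2 * piC * Ci) * (A * (I s cm - I r cm + Ci * (P * Q) * (I (- r) cm - I (- s) cm))
    + B * (I s cp - I r cp + - Ci * / (P * Q) * (I (- r) cp - I (- s) cp))
    + (Cw * (I s w - I r w) + Ct * (I (- r) w - I (- s) w) + (I r w - I (- r) w))
    + D * (I r 0 - I (- r) 0))); [ring|].
  rewrite block_cm, block_cp, block_w, block_0.
  transitivity (/ (2 * piC * Ci) * (2 * piC * Ci * F w
    + (J (- r) 0 - n0) * (Ci * Q * A - Ci * / Q * B - D + Cw * / x / (4 * piC * Ci * w))
    + (J r 0 - n0) * (- P * A - / P * B + D + Ct * x / (4 * piC * Ci * w))
    + f0 * (2 * piC * (Q - P + Ci * Q) * A + 2 * piC * (/ P - / Q + Ci * / Q) * B + D * (Ci * RtoC r) + Sw))); [ring|].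
  rewrite coef_m0, coef_r0, coef_f0. field. auto.
Qed.
End Values.

Lemma ker_ii_reproduces : reproduces Delta w (conj_ker (comb ker_ii)).
Proof.
  apply comb_reproduces; [lra| |].
  - intros a k c H.
    assert (As : Rabs s = s) by (apply Rabs_pos_eq, Rlt_le, s_pos).
    assert (Ar : Rabs r = r) by (apply Rabs_pos_eq, r_pos).
    assert (Rs : (r <= s)%R) by (unfold r, s; generalize PI_RGT_0; nra).
    fold s. unfold ker_ii in H. simpl in H.
    repeat (destruct H as [H|H]; [injection H as <- <- <-; rewrite ?Rabs_Ropp, ?As, ?Ar; lra|]). easy.
  - intros F HF. apply ker_ii_value.
Qed.
End PartTwo.

Lemma ker_ii_formula Delta w z : nonsing_ii w z ->
  conj_ker (comb (ker_ii Delta w)) z = K_formula_ii Delta w z.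
Proof.
  intros [Hw0 [Hwp [Hwm [Hz0 [Hzp [Hzm Hzw]]]]]].
  assert (Hp := piC_nz). assert (Hi := Ci_nz).
  assert (N2 : 2 * piC * Ci <> 0) by (repeat apply Cmult_neq_0; auto; apply RtoC_nz; lra).
  change (RtoC (/ (4 * PI))) with cp in *. change (RtoC (- / (4 * PI))) with cm in *.
  set (s := (PI * Delta)%R). set (r := (PI * (2 - Delta))%R).
  assert (EP : Cconj (Cexp (RtoC ((2 - Delta) / 4) * Ci)) = / Cexp (RtoC ((2 - Delta) / 4) * Ci)) by apply Cconj_unit.
  assert (EQ : Cconj (Cexp (RtoC (Delta / 4) * Ci)) = / Cexp (RtoC (Delta / 4) * Ci)) by apply Cconj_unit.
  assert (S1 := exp_s_cm Delta). assert (S2 := exp_r_cm Delta). fold s in S1. fold r in S2.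
  assert (Cs := exp_cp s). assert (Cr := exp_cp r). rewrite S1 in Cs. rewrite S2 in Cr.
  assert (Ecc : Cconj cp = cp) by apply Cconj_R. assert (Ecm : Cconj cm = cm) by apply Cconj_R.
  unfold conj_ker, ker_ii, K_formula_ii. simpl comb. fold s r.
  set (P := Cexp (RtoC ((2 - Delta) / 4) * Ci)) in *. set (Q := Cexp (RtoC (Delta / 4) * Ci)) in *.
  assert (NP : P <> 0) by apply Cexp_nz. assert (NQ : Q <> 0) by apply Cexp_nz.
  assert (NPQ : P * Q <> 0) by now apply Cmult_neq_0.
  set (A := A_ii Delta w). set (B := B_ii Delta w). set (D := D_ii Delta w).
  repeat (rewrite Cplus_conj || rewrite Cmult_conj || rewrite Copp_conj || (rewrite Cinv_conj by auto)).
  rewrite !Eb_conj, !Cconj_conj, !Cconj_R, Cconj_Ci, Cconj_piC, EP, EQ, Ecc, Ecm, !Ropp_involutive.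
  rewrite !Eb_off by auto. rewrite !Cexp_Csin.
  set (X := Cexp (Ci * RtoC s * z)). set (Y := Cexp (Ci * RtoC r * z)).
  set (Z1 := Cexp (Ci * RtoC s * (z - Cconj w))). set (Z2 := Cexp (Ci * RtoC r * (z - Cconj w))).
  assert (NX : X <> 0) by apply Cexp_nz. assert (NY : Y <> 0) by apply Cexp_nz.
  assert (NZ1 : Z1 <> 0) by apply Cexp_nz. assert (NZ2 : Z2 <> 0) by apply Cexp_nz.
  assert (Neg : forall k u, Cexp (Ci * RtoC (- k) * u) = / Cexp (Ci * RtoC k * u)).
  { intros k u. rewrite <- Cexp_opp. f_equal. rewrite RtoC_opp. ring. }
  assert (Diff : forall k u c, Cexp (Ci * RtoC k * (u - c)) = Cexp (Ci * RtoC k * u) * / Cexp (Ci * RtoC k * c)).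
  { intros k u c. rewrite <- Cexp_opp, <- Cexp_plus. f_equal. ring. }
  rewrite !Neg. fold Z1 Z2.
  rewrite (Diff s z cm), (Diff r z cm), (Diff s z cp), (Diff r z cp), S1, S2, Cs, Cr.
  replace (z - 0) with z by ring. fold X Y.
  assert (Es : RtoC s = piC * RtoC Delta) by (unfold s; now rewrite RtoC_mult).
  assert (Er : RtoC r = piC * (2 - RtoC Delta)) by (unfold r; now rewrite RtoC_mult, RtoC_minus).
  replace (Cexp (2 * piC * Ci * z)) with (X * Y)
    by (unfold X, Y; rewrite <- Cexp_plus; f_equal; rewrite Es, Er; ring).
  assert (Q4 : Q = Cexp (RtoC Delta * RtoC (1 / 4) * Ci)).
  { unfold Q. f_equal. f_equal. rewrite <- RtoC_mult. f_equal. field. }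
  assert (P4 : P = Cexp ((2 - RtoC Delta) * RtoC (1 / 4) * Ci)).
  { unfold P. f_equal. f_equal. rewrite <- RtoC_minus, <- RtoC_mult. f_equal. field. }
  replace (Cexp (- (RtoC Delta * (piC * Ci * z + Ci * RtoC (1 / 4))))) with (/ (X * Q))
    by (unfold X; rewrite Q4, <- Cexp_plus, <- Cexp_opp; f_equal; rewrite Es; ring).
  replace (Cexp (- ((2 - RtoC Delta) * (piC * Ci * z + Ci * RtoC (1 / 4))))) with (/ (Y * P))
    by (unfold Y; rewrite P4, <- Cexp_plus, <- Cexp_opp; f_equal; rewrite Er; ring).
  replace (Cexp (- (RtoC Delta * (piC * Ci * z - Ci * RtoC (1 / 4))))) with (/ X * Q)
    by (unfold X; rewrite Q4, <- Cexp_opp, <- Cexp_plus; f_equal; rewrite Es; ring).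
  replace (Cexp (- ((2 - RtoC Delta) * (piC * Ci * z - Ci * RtoC (1 / 4))))) with (/ Y * P)
    by (unfold Y; rewrite P4, <- Cexp_opp, <- Cexp_plus; f_equal; rewrite Er; ring).
  replace (piC * RtoC Delta * Ci * (z - Cconj w)) with (Ci * RtoC s * (z - Cconj w)) by (rewrite Es; ring).
  replace (piC * (2 - RtoC Delta) * Ci * (z - Cconj w)) with (Ci * RtoC r * (z - Cconj w)) by (rewrite Er; ring).
  replace (Ci * (piC * (2 - RtoC Delta) * (z - Cconj w))) with (Ci * RtoC r * (z - Cconj w)) by (rewrite Er; ring).
  replace (Ci * (piC * (2 - RtoC Delta) * z)) with (Ci * RtoC r * z) by (rewrite Er; ring).
  rewrite !Cexp_opp. fold Z1 Z2 Y.
  assert (Hzm' : z - cm <> 0) by now apply Cminus_eq_contra.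
  assert (Hzp' : z - cp <> 0) by now apply Cminus_eq_contra.
  assert (Hzw' : z - Cconj w <> 0) by now apply Cminus_eq_contra.
  replace (2 * piC * Ci * z + Ci / 2) with (2 * piC * Ci * (z - cm)) by (rewrite cm_eq; field; auto).
  replace (2 * piC * Ci * z - Ci / 2) with (2 * piC * Ci * (z - cp)) by (rewrite cp_eq; field; auto).
  set (u1 := z - cm) in *. set (u2 := z - cp) in *. set (u3 := z - Cconj w) in *.
  set (A' := Cconj A). set (B' := Cconj B). set (D' := Cconj D). set (C1 := C_ii (Cconj w)). set (C2 := Cconj (C_ii w)).
  (* From here on the exponentials and the linear factors are independent variables, and the
     identity is rational. *)
  clearbody u1 u2 u3 A' B' D' C1 C2 X Y Z1 Z2 P Q.
  field [Ci2]. repeat split; auto.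
Qed.

(** * Continuity and existence of the kernel at all points *)

Lemma bddI_weaken g B B' : bddI g B -> (B <= B')%R -> bddI g B'.
Proof. intros H HB a b Hab. specialize (H a b Hab). lra. Qed.

(** The integrand is nonnegative, so partial integrals increase with the interval and stay below the
    limit. *)
Lemma isI_sq_bddI w f v : weight w -> allc f ->
  isI (fun x => f x * Cconj (f x) * RtoC (w x)) v -> bddI (sqw w f) (Re v).
Proof.
  intros Hw Hf Hv a b Hab. assert (Cq := Rcont_sqw w f Hw Hf).
  apply le_epsilon. intros eps He.
  assert (Hv' : isI (fun x => RtoC (sqw w f x)) v).
  { revert Hv. apply isI_ext. intros x. unfold sqw. rewrite RtoC_mult, Cmod2_conj. reflexivity. }
  destruct (proj1 (isI_eps _ v (allc_RtoC _ Cq)) Hv' eps He) as [N HN].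
  set (a' := Rmin a (- N)). set (b' := Rmax b N).
  assert (A1 : (a' <= a)%R) by apply Rmin_l. assert (A2 : (a' <= - N)%R) by apply Rmin_r.
  assert (B1 : (b <= b')%R) by apply Rmax_l. assert (B2 : (N <= b')%R) by apply Rmax_r.
  specialize (HN a' b' A2 B2). rewrite CI_RtoC in HN by easy.
  assert (Q := re_le_Cmod (RtoC (RInt (sqw w f) a' b') - v)).
  change (Re (RtoC (RInt (sqw w f) a' b') - v)) with (RInt (sqw w f) a' b' - Re v)%R in Q.
  assert (T := Rle_abs (RInt (sqw w f) a' b' - Re v)).
  assert (W := RInt_widen (sqw w f) a b a' b' Cq (fun x => sqw_pos w f x Hw) A1 Hab B1). lra.
Qed.

(** A crude form of Fatou's lemma. The factor 2 comes from |f|^2 <= 2 |fn|^2 + 2 |f - fn|^2 and does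
    no harm, as only a finite bound is wanted. *)
Lemma bddI_limit w (fn : nat -> R -> C) f B : weight w -> (forall n, allc (fn n)) -> allc f ->
  (forall n, bddI (sqw w (fn n)) B) ->
  (forall r eps, (0 < eps)%R -> exists N, forall n x, (N <= n)%nat -> (Rabs x <= r)%R ->
     (Cmod (fn n x - f x) <= eps)%R) ->
  bddI (sqw w f) (2 * B).
Proof.
  intros Hw Hfn Hf HB Hun a b Hab. apply le_epsilon. intros eps He.
  set (W := RInt w a b). assert (HW : (0 <= W)%R) by (apply RInt_ge0; [apply Hw|apply Hw|easy]).
  set (d := Rmin 1 (eps / (2 * (W + 1)))).
  assert (Pd : (0 < d)%R) by (apply Rmin_pos; [lra|apply Rdiv_lt_0_compat; lra]).
  assert (D1 : (d <= 1)%R) by apply Rmin_l. assert (D2 : (d <= eps / (2 * (W + 1)))%R) by apply Rmin_r.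
  clearbody d. apply Rle_div_r in D2; [|lra].
  destruct (Hun (Rabs a + Rabs b)%R d Pd) as [N HN]. specialize (HB N a b Hab).
  eapply Rle_trans.
  - apply (RInt_le _ (fun x => 2 * sqw w (fn N) x + 2 * d * w x)%R); [easy| | |].
    + apply ex_RInt_allR. now apply Rcont_sqw.
    + apply ex_RInt_allR. apply Rcont_plus; apply Rcont_mult; try apply Rcont_const; [now apply Rcont_sqw|apply Hw].
    + intros x Hx. unfold sqw.
      assert (Hr : (Rabs x <= Rabs a + Rabs b)%R).
      { assert (T1 := Rle_abs b). assert (T2 := Rle_abs (- a)). rewrite Rabs_Ropp in T2.
        assert (T3 := Rabs_pos a). assert (T4 := Rabs_pos b). apply Rabs_le. lra. }
      specialize (HN N x (Nat.le_refl N) Hr).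
      assert (S := sq_sum_le (fn N x) (f x - fn N x)). replace (fn N x + (f x - fn N x)) with (f x) in S by ring.
      rewrite Cmod_sym in HN. assert (Z := Cmod_ge_0 (f x - fn N x)). assert (Wx := proj2 Hw x).
      assert (Cmod (f x - fn N x) ^ 2 <= d)%R by nra. nra.
  - rewrite (RInt_lin (sqw w (fn N)) w) by (try apply Hw; now apply Rcont_sqw). fold W. nra.
Qed.

Lemma C_cauchy_lim (u : nat -> C) :
  (forall eps, (0 < eps)%R -> exists N, forall n m, (N <= n)%nat -> (N <= m)%nat -> (Cmod (u n - u m) <= eps)%R) ->
  exists l, forall eps, (0 < eps)%R -> exists N, forall n, (N <= n)%nat -> (Cmod (u n - l) <= eps)%R.
Proof.
  intros H.
  assert (Cr : forall p : C -> R, (forall z, (Rabs (p z) <= Cmod z)%R) -> (forall x y, p (x - y) = (p x - p y)%R) ->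
    exists l, Un_cv (fun n => p (u n)) l).
  { intros p Hp Hm. destruct (Rcomplete.R_complete (fun n => p (u n))) as [l Hl]; [|now exists l].
    intros eps He. destruct (H (eps / 2)%R ltac:(lra)) as [N HN]. exists N. intros n m Hn Hm'.
    specialize (HN n m Hn Hm'). specialize (Hp (u n - u m)). rewrite Hm in Hp.
    change (Rabs (p (u n) - p (u m)) < eps)%R. lra. }
  destruct (Cr Re) as [l1 H1]; [apply re_le_Cmod|easy|].
  destruct (Cr Im) as [l2 H2]; [apply Im_le_Cmod|easy|].
  exists (l1, l2). intros eps He.
  destruct (H1 (eps / 2)%R ltac:(lra)) as [N1 K1]. destruct (H2 (eps / 2)%R ltac:(lra)) as [N2 K2].
  exists (N1 + N2)%nat. intros n Hn. specialize (K1 n ltac:(lia)). specialize (K2 n ltac:(lia)).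
  eapply Rle_trans; [apply Cmod_le_Re_Im|].
  change (Rabs (Re (u n) - l1) + Rabs (Im (u n) - l2) <= eps)%R.
  unfold R_dist, Rdist in *. lra.
Qed.

(** * Evaluation functionals, uniqueness and limits of kernels *)

Section Abstract.
Variable Delta : R.
Hypothesis HD : (0 < Delta)%R.
Let t : R := (PI * Delta)%R.

Lemma t_pos : (0 < t)%R.
Proof. unfold t. generalize PI_RGT_0. nra. Qed.

(** The unweighted kernel sin (t (z - w)) / (pi (z - w)), with [w] not conjugated so that it pairs
    with [F] without a conjugation. *)
Definition Sn (w z : C) : C := / (2 * piC * Ci) * Eb t w z + - / (2 * piC * Ci) * Eb (- t) w z.

Lemma pw_Sn w : pw t (Sn w).
Proof.
  assert (H := t_pos).
  apply (pw_plus t (fun z => / (2 * piC * Ci) * Eb t w z) (fun z => - / (2 * piC * Ci) * Eb (- t) w z));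
    apply pw_scal, pw_Eb; rewrite ?Rabs_Ropp, Rabs_pos_eq; lra.
Qed.

Lemma Sn_conj w (x : R) : Cconj (Sn w x) = Sn (Cconj w) x.
Proof.
  assert (Hp := piC_nz). assert (Hi := Ci_nz).
  assert (N2 : 2 * piC * Ci <> 0) by (repeat apply Cmult_neq_0; auto; apply RtoC_nz; lra).
  unfold Sn. rewrite Cplus_conj, !Cmult_conj, !Eb_conj, Copp_conj, Cinv_conj, !Cmult_conj, !Cconj_R, Cconj_Ci, Cconj_piC by easy.
  rewrite Ropp_involutive. field. auto.
Qed.

Lemma Sn_shift w z : Sn w z = Sn 0 (z - w).
Proof. unfold Sn, Eb. replace (z - w - 0) with (z - w) by ring. reflexivity. Qed.

Lemma eval_isI F w : pw t F -> isI (fun x => F (RtoC x) * Sn w (RtoC x)) (F w).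
Proof.
  intros HF. assert (Hp := piC_nz). assert (Hi := Ci_nz). assert (Ht := t_pos).
  assert (E := Jint_jump t F HF Ht t t w (Rle_refl _) (Rle_refl _)).
  replace (F w) with (/ (2 * piC * Ci) * Jint t F HF t w + - / (2 * piC * Ci) * Jint t F HF (- t) w).
  - apply isI_ext with (fun x => / (2 * piC * Ci) * (F (RtoC x) * Eb t w (RtoC x))
      + - / (2 * piC * Ci) * (F (RtoC x) * Eb (- t) w (RtoC x))); [intros x; unfold Sn; ring|].
    assert (Ac : forall k, allc (fun x => F (RtoC x) * Eb k w (RtoC x)))
      by (intros k; apply allc_mult; [apply (allc_pw _ _ HF)|apply allc_real, hentire_centire, hentire_Eb]).
    apply isI_plus; (apply isI_scal; [apply Ac|apply Jint_isI]).
  - transitivity (/ (2 * piC * Ci) * (Jint t F HF t w - Jint t F HF (- t) w)); [ring|]. rewrite E. field. auto.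
Qed.

(** The squared unweighted norm of [Sn w - Sn w'], expressed through values of [Sn] by its own
    reproducing property; [ssq w] is likewise the squared norm of [Sn w]. *)
Definition nsq (w w' : C) : R := Re (Sn w (Cconj w) - Sn w' (Cconj w) - (Sn w (Cconj w') - Sn w' (Cconj w'))).
Definition ssq (w : C) : R := Re (Sn w (Cconj w)).

Lemma Sn_diff_bddI w w' : bddI (sqw unitw (fun x => Sn w (RtoC x) - Sn w' (RtoC x))) (nsq w w').
Proof.
  set (G := fun z => Sn w z + RtoC (-1) * Sn w' z).
  assert (HG : pw t G) by (apply (pw_plus t (Sn w) (fun z => RtoC (-1) * Sn w' z)); [|apply pw_scal]; apply pw_Sn).
  assert (E1 := eval_isI G (Cconj w) HG). assert (E2 := eval_isI G (Cconj w') HG).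
  apply isI_sq_bddI; [apply weight_unitw| |].
  - intros x. apply econt_minus; apply (allc_pw _ _ (pw_Sn _)).
  - replace (Sn w (Cconj w) - Sn w' (Cconj w) - (Sn w (Cconj w') - Sn w' (Cconj w')))
      with (G (Cconj w) - G (Cconj w')) by (unfold G; ring).
    apply isI_ext with (fun x => G (RtoC x) * Sn (Cconj w) (RtoC x) - G (RtoC x) * Sn (Cconj w') (RtoC x)).
    + intros x. rewrite Cminus_conj, !Sn_conj. unfold G, unitw. ring.
    + apply isI_minus; [|easy|easy]. apply allc_mult; [apply (allc_pw _ _ HG)|apply (allc_pw _ _ (pw_Sn _))].
Qed.

Lemma Sn_bddI w : bddI (sqw unitw (fun x => Sn w (RtoC x))) (ssq w).
Proof.
  apply isI_sq_bddI; [apply weight_unitw|apply (allc_pw _ _ (pw_Sn _))|].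
  generalize (eval_isI (Sn w) (Cconj w) (pw_Sn w)). apply isI_ext. intros x. rewrite Sn_conj. unfold unitw. ring.
Qed.

(** Cauchy-Schwarz against the unweighted kernel; the factor 2 comes from the lower bound 1/2 of the
    weight. The weighted kernel, whose existence is not yet known everywhere, is not involved. *)
Lemma eval_diff_le F w w' X : pw t F -> bddI (sqw W_SOeven (fun x => F (RtoC x))) X ->
  (Cmod (F w - F w') ^ 2 <= 2 * X * nsq w w')%R.
Proof.
  intros HF HX. assert (AF := allc_pw _ _ HF).
  apply (cauchy_schwarz unitw (fun x => F (RtoC x)) (fun x => Sn w (RtoC x) - Sn w' (RtoC x))); auto.
  - apply weight_unitw.
  - intros x. apply econt_minus; apply (allc_pw _ _ (pw_Sn _)).
  - now apply bddI_W_unitw.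
  - apply Sn_diff_bddI.
  - apply isI_ext with (fun x => F (RtoC x) * Sn w (RtoC x) - F (RtoC x) * Sn w' (RtoC x)).
    + intros x. unfold unitw. ring.
    + apply isI_minus; [|now apply eval_isI|now apply eval_isI].
      apply allc_mult; [easy|apply (allc_pw _ _ (pw_Sn _))].
Qed.

Lemma eval_le F w X : pw t F -> bddI (sqw W_SOeven (fun x => F (RtoC x))) X ->
  (Cmod (F w) ^ 2 <= 2 * X * ssq w)%R.
Proof.
  intros HF HX. assert (AF := allc_pw _ _ HF).
  apply (cauchy_schwarz unitw (fun x => F (RtoC x)) (fun x => Sn w (RtoC x))); auto.
  - apply weight_unitw.
  - apply (allc_pw _ _ (pw_Sn _)).
  - now apply bddI_W_unitw.
  - apply Sn_bddI.
  - generalize (eval_isI F w HF). apply isI_ext. intros x. unfold unitw. ring.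
Qed.

Lemma ssq_pos w : (0 <= ssq w)%R.
Proof. apply (bddI_pos _ _ (Sn_bddI w)). Qed.
Lemma nsq_pos w w' : (0 <= nsq w w')%R.
Proof. apply (bddI_pos _ _ (Sn_diff_bddI w w')). Qed.

Lemma pw_of_reproduces w k : reproduces Delta w k -> pw t k.
Proof. intros [H _]. now apply in_H_pw. Qed.

(** Both sides are the inner product of [k] and [k']. Used with two candidates at the same [w], the
    symmetry also yields uniqueness. *)
Lemma reproduces_sym w z k k' : reproduces Delta w k -> reproduces Delta z k' -> k z = Cconj (k' w).
Proof.
  intros Hk Hk'. assert (P1 := pw_of_reproduces _ _ Hk). assert (P2 := pw_of_reproduces _ _ Hk').
  assert (I1 := proj2 Hk' k (proj1 Hk)). assert (I2 := proj2 Hk k' (proj1 Hk')).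
  assert (A1 := allc_pw _ _ P1). assert (A2 := allc_pw _ _ P2).
  assert (AW : allc (fun x => RtoC (W_SOeven x))) by apply allc_RtoC, Rcont_W.
  apply isI_conj in I2.
  - assert (I3 : isI (fun x => k (RtoC x) * Cconj (k' (RtoC x)) * RtoC (W_SOeven x)) (Cconj (k' w))).
    { revert I2. apply isI_ext. intros x. rewrite !Cmult_conj, Cconj_conj, Cconj_R. ring. }
    apply (isI_unique _ _ _ ltac:(apply allc_mult; [apply allc_mult; [exact A1|intros x; apply econt_conj, A2]|exact AW]) I1 I3).
  - apply allc_mult; [apply allc_mult; [easy|intros x; apply econt_conj, A1]|easy].
Qed.

(** Let X be the squared norm of H = k - k'. The reproducing property gives X = H(w) - H(w'), the
    evaluation estimate gives X^2 <= 2 X nsq, and one factor X is divided out. *)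
Lemma reproduces_diff_bddI w w' k k' : reproduces Delta w k -> reproduces Delta w' k' ->
  bddI (sqw W_SOeven (fun x => k (RtoC x) - k' (RtoC x))) (2 * nsq w w').
Proof.
  intros Hk Hk'. assert (P1 := pw_of_reproduces _ _ Hk). assert (P2 := pw_of_reproduces _ _ Hk').
  set (H := fun z => k z + RtoC (-1) * k' z).
  assert (PH : pw t H) by (apply (pw_plus t k (fun z => RtoC (-1) * k' z)); [easy|now apply pw_scal]).
  assert (IH : in_H_SOeven Delta H) by now apply in_H_pw.
  assert (AH := allc_pw _ _ PH). assert (A1 := allc_pw _ _ P1). assert (A2 := allc_pw _ _ P2).
  assert (AW : allc (fun x => RtoC (W_SOeven x))) by apply allc_RtoC, Rcont_W.
  assert (I1 := proj2 Hk H IH). assert (I2 := proj2 Hk' H IH).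
  assert (BH : bddI (sqw W_SOeven (fun x => H (RtoC x))) (Re (H w - H w'))).
  { apply isI_sq_bddI; [apply weight_W|easy|].
    apply isI_ext with (fun x => H (RtoC x) * Cconj (k (RtoC x)) * RtoC (W_SOeven x)
       - H (RtoC x) * Cconj (k' (RtoC x)) * RtoC (W_SOeven x)).
    - intros x. replace (Cconj (H (RtoC x))) with (Cconj (k (RtoC x)) - Cconj (k' (RtoC x)))
        by (unfold H; rewrite Cplus_conj, Cmult_conj, Cconj_R; ring). ring.
    - apply isI_minus; auto. apply allc_mult; [apply allc_mult; [easy|intros x; apply econt_conj, A2]|easy]. }
  assert (E := eval_diff_le H w w' _ PH BH).
  assert (Z := bddI_pos _ _ BH). assert (Q := re_le_Cmod (H w - H w')). rewrite Rabs_pos_eq in Q by easy.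
  assert (Nn := nsq_pos w w').
  assert (Le : (Re (H w - H w') <= 2 * nsq w w')%R).
  { set (X := Re (H w - H w')) in *. set (m := Cmod (H w - H w')) in *.
    assert (X ^ 2 <= m ^ 2)%R by (apply pow_incr; easy). nra. }
  intros a b Hab. rewrite (RInt_extR _ (sqw W_SOeven (fun x => H (RtoC x)))).
  - eapply Rle_trans; [now apply BH|easy].
  - intros x. unfold sqw, H. do 3 f_equal. ring.
Qed.

Lemma reproduces_bddI w k : reproduces Delta w k -> bddI (sqw W_SOeven (fun x => k (RtoC x))) (2 * ssq w).
Proof.
  intros Hk. assert (P1 := pw_of_reproduces _ _ Hk). assert (A1 := allc_pw _ _ P1).
  assert (BH := isI_sq_bddI _ _ _ weight_W A1 (proj2 Hk k (proj1 Hk))).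
  assert (E := eval_le k w _ P1 BH). assert (Z := bddI_pos _ _ BH).
  assert (Q := re_le_Cmod (k w)). rewrite Rabs_pos_eq in Q by easy. assert (Nn := ssq_pos w).
  apply (bddI_weaken _ _ _ BH). set (X := Re (k w)) in *. set (m := Cmod (k w)) in *.
  assert (X ^ 2 <= m ^ 2)%R by (apply pow_incr; easy). nra.
Qed.

Lemma ccont_Sn0 : centire (Sn 0).
Proof. apply hentire_centire, (pw_Sn 0). Qed.

Lemma conj_minus_near u v u' v' d : (Cmod (u - u') < d)%R -> (Cmod (v - v') < d)%R ->
  (Cmod ((Cconj u - v) - (Cconj u' - v')) < 2 * d)%R.
Proof.
  intros H1 H2. replace (Cconj u - v - (Cconj u' - v')) with (Cconj (u - u') - (v - v')) by (rewrite Cminus_conj; ring).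
  eapply Rle_lt_trans; [apply Cmod_minus_le|]. rewrite Cmod_conj. lra.
Qed.

(** The four values in [nsq] tend to a common limit, because [Sn w z] is a continuous function of
    [z - w]. *)
Lemma nsq_small w0 eps : (0 < eps)%R -> exists d, (0 < d)%R /\
  forall w w', (Cmod (w - w0) < d)%R -> (Cmod (w' - w0) < d)%R -> (nsq w w' <= eps)%R.
Proof.
  intros He. destruct (ccont_Sn0 (Cconj w0 - w0) (eps / 4)%R ltac:(lra)) as [d [Hd K]].
  exists (d / 2)%R. split; [lra|]. intros w w' Hw Hw'. unfold nsq.
  assert (Near : forall u v, (Cmod (u - w0) < d / 2)%R -> (Cmod (v - w0) < d / 2)%R ->
    (Cmod (Sn v (Cconj u) - Sn 0 (Cconj w0 - w0)) < eps / 4)%R).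
  { intros u v Hu Hv. rewrite Sn_shift. apply K. unfold Cgap.
    assert (Q := conj_minus_near u v w0 w0 (d / 2) Hu Hv). lra. }
  set (c := Sn 0 (Cconj w0 - w0)) in *.
  assert (N1 := Near w w Hw Hw). assert (N2 := Near w w' Hw Hw'). assert (N3 := Near w' w Hw' Hw). assert (N4 := Near w' w' Hw' Hw').
  set (a1 := Sn w (Cconj w)) in *. set (a2 := Sn w' (Cconj w)) in *. set (a3 := Sn w (Cconj w')) in *. set (a4 := Sn w' (Cconj w')) in *.
  replace (a1 - a2 - (a3 - a4)) with ((a1 - c) - (a2 - c) - ((a3 - c) - (a4 - c))) by ring.
  eapply Rle_trans; [apply Rle_abs|]. eapply Rle_trans; [apply re_le_Cmod|].
  eapply Rle_trans; [apply Cmod_minus_le|].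
  assert (T1 := Cmod_minus_le (a1 - c) (a2 - c)). assert (T2 := Cmod_minus_le (a3 - c) (a4 - c)). lra.
Qed.

(** The exponent 2 t |w| belongs to a squared value: through [eval_le] it yields exponential type
    exactly [t]. *)
Lemma ssq_bound w : (ssq w <= Delta * exp (2 * t * Cmod w))%R.
Proof.
  assert (Ht := t_pos). assert (Hp := piC_nz). assert (Hi := Ci_nz). assert (P := PI_RGT_0).
  assert (N2 : 2 * piC * Ci <> 0) by (repeat apply Cmult_neq_0; auto; apply RtoC_nz; lra).
  unfold ssq. eapply Rle_trans; [apply Rle_abs|]. eapply Rle_trans; [apply re_le_Cmod|].
  unfold Sn. eapply Rle_trans; [apply Cmod_triangle|].
  rewrite !Cmod_mult, Cmod_opp, Cmod_inv by easy. rewrite !Cmod_mult, Cmod_Ci.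
  unfold piC. rewrite !Cmod_R, !Rabs_pos_eq by lra.
  assert (B1 := Eb_bound t w (Cconj w)). assert (B2 := Eb_bound (- t) w (Cconj w)).
  rewrite Rabs_Ropp in B2. rewrite (Rabs_pos_eq t) in B1, B2 by lra.
  assert (Le : (exp (t * Rabs (Im (Cconj w - w))) <= exp (2 * t * Cmod w))%R).
  { apply exp_le. assert (Q := Im_le_Cmod (Cconj w - w)). assert (T := Cmod_minus_le (Cconj w) w).
    rewrite Cmod_conj in T. nra. }
  set (E := exp (2 * t * Cmod w)) in *.
  assert (B : forall m, (m <= t * exp (t * Rabs (Im (Cconj w - w))))%R -> (/ (2 * PI * 1) * m <= Delta * E / 2)%R).
  { intros m Hm. replace (Delta * E / 2)%R with (/ (2 * PI * 1) * (t * E))%R by (unfold t; field; lra).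
    apply Rmult_le_compat_l; [apply Rlt_le, Rinv_0_lt_compat; lra|]. nra. }
  assert (C1 := B _ B1). assert (C2 := B _ B2). lra.
Qed.

(** The kernels at the points [wn n] are Cauchy in norm, hence converge locally uniformly on the
    plane since evaluation is bounded. The limit is entire, inherits type and norm bound from
    uniform estimates, and the reproducing identity passes to it by weak convergence. *)
Lemma reproduces_limit (wn : nat -> C) (kn : nat -> C -> C) w0 :
  (forall n, reproduces Delta (wn n) (kn n)) ->
  (forall eps, (0 < eps)%R -> exists N, forall n, (N <= n)%nat -> (Cmod (wn n - w0) < eps)%R) ->
  (forall n, (Cmod (wn n - w0) <= 1)%R) ->
  exists k, reproduces Delta w0 k.
Proof.
  intros Hk Hlim H1. assert (Ht := t_pos).
  assert (Pk : forall n, pw t (kn n)) by (intros n; now apply (pw_of_reproduces (wn n))).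
  assert (Ak : forall n, allc (fun x => kn n (RtoC x))) by (intros n; apply (allc_pw _ _ (Pk n))).
  set (B := (2 * (Delta * exp (2 * t * (Cmod w0 + 1))))%R).
  assert (Bk : forall n, bddI (sqw W_SOeven (fun x => kn n (RtoC x))) B).
  { intros n. apply (bddI_weaken _ _ _ (reproduces_bddI (wn n) (kn n) (Hk n))). unfold B.
    apply Rmult_le_compat_l; [lra|]. eapply Rle_trans; [apply ssq_bound|].
    apply Rmult_le_compat_l; [lra|]. apply exp_le. apply Rmult_le_compat_l; [lra|].
    assert (T := Cmod_triangle_inv (wn n) w0). specialize (H1 n). lra. }
  assert (B0 : (0 <= B)%R) by apply (bddI_pos _ _ (Bk 0%nat)).
  assert (Unif : forall rad eps, (0 < eps)%R -> exists N, forall n m z, (N <= n)%nat -> (N <= m)%nat ->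
    (Cmod z <= rad)%R -> (Cmod (kn n z - kn m z) <= eps)%R).
  { intros rad eps He. set (S := (Delta * exp (2 * t * Rabs rad))%R).
    assert (PS : (0 < S)%R) by (apply Rmult_lt_0_compat; [easy|apply exp_pos]).
    destruct (nsq_small w0 (eps ^ 2 / (4 * S))%R) as [d [Hd K]]; [apply Rdiv_lt_0_compat; nra|].
    destruct (Hlim d Hd) as [N HN]. exists N. intros n m z Hn Hm Hz.
    specialize (K (wn n) (wn m) (HN n Hn) (HN m Hm)).
    set (G := fun z => kn n z + RtoC (-1) * kn m z).
    assert (PG : pw t G) by (apply (pw_plus t (kn n) (fun z => RtoC (-1) * kn m z)); [easy|now apply pw_scal]).
    assert (BG : bddI (sqw W_SOeven (fun x => G (RtoC x))) (2 * nsq (wn n) (wn m))).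
    { intros a b Hab. rewrite (RInt_extR _ (sqw W_SOeven (fun x => kn n (RtoC x) - kn m (RtoC x)))).
      - now apply reproduces_diff_bddI.
      - intros x. unfold sqw, G. do 3 f_equal. ring. }
    assert (E := eval_le G z _ PG BG). assert (Sz := ssq_bound z). assert (Sp := ssq_pos z).
    assert (Sz2 : (ssq z <= S)%R).
    { eapply Rle_trans; [exact Sz|]. unfold S. apply Rmult_le_compat_l; [lra|]. apply exp_le.
      generalize (Rle_abs rad). nra. }
    assert (Np := nsq_pos (wn n) (wn m)).
    replace (kn n z - kn m z) with (G z) by (unfold G; ring).
    assert (Fin : (Cmod (G z) ^ 2 <= eps ^ 2)%R).
    { eapply Rle_trans; [exact E|].
      apply Rle_trans with (4 * (eps ^ 2 / (4 * S)) * S)%R.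
      - replace (2 * (2 * nsq (wn n) (wn m)) * ssq z)%R with (4 * nsq (wn n) (wn m) * ssq z)%R by ring.
        apply Rmult_le_compat; lra.
      - right. field. lra. }
    apply Rsqr_incr_0_var; [|lra]. unfold Rsqr. nra. }
  assert (Ex : forall z, exists l, forall eps, (0 < eps)%R -> exists N, forall n, (N <= n)%nat -> (Cmod (kn n z - l) <= eps)%R).
  { intros z. apply C_cauchy_lim. intros eps He. destruct (Unif (Cmod z) eps He) as [N HN].
    exists N. intros n m Hn Hm. apply HN; auto. lra. }
  set (L := fun z => proj1_sig (constructive_indefinite_description _ (Ex z))).
  assert (HL : forall z eps, (0 < eps)%R -> exists N, forall n, (N <= n)%nat -> (Cmod (kn n z - L z) <= eps)%R)
    by (intros z; exact (proj2_sig (constructive_indefinite_description _ (Ex z)))).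
  assert (LU : lunif kn L).
  { intros rad eps He. destruct (Unif rad (eps / 2)%R ltac:(lra)) as [N HN]. exists N. intros n z Hn Hz.
    destruct (HL z (eps / 2)%R ltac:(lra)) as [M HM]. specialize (HM (N + M)%nat ltac:(lia)).
    specialize (HN n (N + M)%nat z Hn ltac:(lia) Hz).
    replace (kn n z - L z) with ((kn n z - kn (N + M)%nat z) + (kn (N + M)%nat z - L z)) by ring.
    eapply Rle_trans; [apply Cmod_triangle|]. lra. }
  assert (HLe : hentire L) by (apply (lunif_hentire kn); [intros n; apply (Pk n)|easy]).
  assert (AL : allc (fun x => L (RtoC x))) by now apply allc_real, hentire_centire.
  assert (UR : forall rad eps, (0 < eps)%R -> exists N, forall n x, (N <= n)%nat -> (Rabs x <= rad)%R ->
     (Cmod (kn n (RtoC x) - L (RtoC x)) <= eps)%R).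
  { intros rad eps He. destruct (LU rad eps He) as [N HN]. exists N. intros n x Hn Hx. apply HN; [easy|].
    now rewrite Cmod_R. }
  assert (BL : bddI (sqw W_SOeven (fun x => L (RtoC x))) (2 * B)).
  { apply (bddI_limit W_SOeven (fun n x => kn n (RtoC x))); auto. apply weight_W. }
  assert (PL : pw t L).
  { split; [easy|split].
    (* The estimate |kn(z)|^2 <= 2 B ssq(z) <= 2 B Delta exp (2 t |z|) is uniform in [n], so the
       limit keeps the type [t] without loss. *)
    - set (M := (1 + sqrt (2 * B * Delta))%R).
      apply pw_bound_type with M. intros z. apply le_epsilon. intros eps He.
      destruct (HL z eps He) as [N HN]. specialize (HN N (Nat.le_refl N)).
      assert (E := eval_le (kn N) z B (Pk N) (Bk N)). assert (Sz := ssq_bound z).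
      assert (Q : (Cmod (kn N z) <= M * exp (t * Cmod z))%R).
      { assert (Sq := sqrt_pos (2 * B * Delta)). assert (Ss := sqrt_sqrt (2 * B * Delta) ltac:(nra)).
        assert (Pe := exp_pos (t * Cmod z)).
        assert (Ee : exp (2 * t * Cmod z) = (exp (t * Cmod z) * exp (t * Cmod z))%R)
          by (rewrite <- exp_plus; f_equal; ring).
        rewrite Ee in Sz. set (e := exp (t * Cmod z)) in *.
        apply Rle_trans with (sqrt (2 * B * Delta) * e)%R; [|unfold M; nra].
        apply Rsqr_incr_0_var; [|nra]. unfold Rsqr.
        assert (2 * B * ssq z <= 2 * B * (Delta * (e * e)))%R by (apply Rmult_le_compat_l; lra).
        replace (sqrt (2 * B * Delta) * e * (sqrt (2 * B * Delta) * e))%R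
          with (sqrt (2 * B * Delta) * sqrt (2 * B * Delta) * (e * e))%R by ring. rewrite Ss. nra. }
      rewrite Cmod_sym in HN. assert (T := Cmod_triangle_inv (L z) (kn N z)). lra.
    - exists (2 * (2 * B))%R. now apply bddI_W_unitw. }
  exists L. split; [now apply in_H_pw|]. intros F HF.
  assert (PF : pw t F) by now apply in_H_pw. assert (AF := allc_pw _ _ PF).
  destruct (pw_bddI_W _ _ PF) as [Y HY].
  assert (Cb : forall f X, bddI (sqw W_SOeven f) X -> bddI (sqw W_SOeven (fun x => Cconj (f x))) X).
  { intros f X HX a b Hab. rewrite (RInt_extR _ (sqw W_SOeven f)); [now apply HX|].
    intros x. unfold sqw. now rewrite Cmod_conj. }
  assert (Ac : forall f, allc f -> allc (fun x => Cconj (f x))) by (intros f Hf x; apply econt_conj, Hf).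
  destruct (isI_prod_exists W_SOeven (fun x => Cconj (L (RtoC x))) (fun x => F (RtoC x)) (2 * B) Y
    weight_W (Ac _ AL) AF (Cb _ _ BL) HY) as [v Hv].
  assert (Wk := weak_limit W_SOeven (fun n x => Cconj (kn n (RtoC x))) (fun x => Cconj (L (RtoC x)))
    (fun x => F (RtoC x)) (2 * B) Y (fun n => F (wn n)) v weight_W).
  assert (Conv : forall eps, (0 < eps)%R -> exists N, forall n, (N <= n)%nat -> (Cmod (F (wn n) - v) <= eps)%R).
  { apply Wk.
    - intros n. apply (Ac _ (Ak n)).
    - apply (Ac _ AL).
    - exact AF.
    - intros n. apply (bddI_weaken _ B); [|lra]. apply (Cb _ _ (Bk n)).
    - apply (Cb _ _ BL).
    - exact HY.
    - intros rad eps He. destruct (UR rad eps He) as [N HN]. exists N. intros n x Hn Hx.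
      rewrite <- Cminus_conj, Cmod_conj. auto.
    - intros n. generalize (proj2 (Hk n) F HF). apply isI_ext. intros x. ring.
    - exact Hv. }
  assert (Ev : v = F w0).
  { apply Cmod_small_eq. intros eps He.
    destruct (Conv (eps / 2)%R ltac:(lra)) as [N1 K1].
    destruct (hentire_centire F (proj1 PF) w0 (eps / 2)%R ltac:(lra)) as [d [Hd Kd]].
    destruct (Hlim d Hd) as [N2 K2]. specialize (K1 (N1 + N2)%nat ltac:(lia)). specialize (K2 (N1 + N2)%nat ltac:(lia)).
    specialize (Kd (wn (N1 + N2)%nat) K2).
    replace (v - F w0) with ((F (wn (N1 + N2)%nat) - F w0) - (F (wn (N1 + N2)%nat) - v)) by ring.
    eapply Rle_trans; [apply Cmod_minus_le|]. lra. }
  rewrite <- Ev. revert Hv. apply isI_ext. intros x. ring.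
Qed.

(** The points excluded by the explicit kernel, 0 and +-1/(4 pi), are real. Every real point is
    approached vertically by nonreal ones, whose kernels converge. *)
Lemma reproduces_everywhere : (forall w, Im w <> 0%R -> exists k, reproduces Delta w k) ->
  forall w, exists k, reproduces Delta w k.
Proof.
  intros H w. destruct (Req_dec (Im w) 0) as [E|N]; [|auto].
  set (wn := fun n : nat => w + Ci * RtoC (/ (INR n + 1))).
  assert (Pn : forall n : nat, (0 < / (INR n + 1) <= 1)%R).
  { intros n. assert (Q := pos_INR n). split; [apply Rinv_0_lt_compat; lra|].
    rewrite <- Rinv_1. apply Rinv_le_contravar; lra. }
  assert (Dn : forall n, Cmod (wn n - w) = (/ (INR n + 1))%R).
  { intros n. unfold wn. replace (w + Ci * RtoC (/ (INR n + 1)) - w) with (Ci * RtoC (/ (INR n + 1))) by ring.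
    rewrite Cmod_mult, Cmod_Ci, Cmod_R, Rabs_pos_eq by (specialize (Pn n); lra). ring. }
  assert (Kn : forall n, exists k, reproduces Delta (wn n) k).
  { intros n. apply H. unfold wn. specialize (Pn n). destruct w as [a b]; simpl in E |- *. rewrite E. lra. }
  apply (reproduces_limit wn (fun n => proj1_sig (constructive_indefinite_description _ (Kn n))) w).
  - intros n. exact (proj2_sig (constructive_indefinite_description _ (Kn n))).
  - intros eps He. destruct (INR_unbounded (/ eps)) as [N HN]. exists N. intros n Hn. rewrite Dn.
    apply le_INR in Hn. assert (Pi : (0 < / eps)%R) by now apply Rinv_0_lt_compat.
    rewrite <- (Rinv_inv eps). apply Rinv_lt_contravar; [|lra]. apply Rmult_lt_0_compat; lra.
  - intros n. rewrite Dn. apply Pn.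
Qed.

(** Continuity in [z] is the evaluation estimate, with a constant that is locally bounded in [w].
    Continuity in [w] at the fixed point [z0] is the same estimate after Hermitian symmetry. *)
Lemma kernel_jointly_continuous K w0 z0 : (forall w, reproduces Delta w (K w)) ->
  forall eps, (0 < eps)%R -> exists d, (0 < d)%R /\
    forall w z, (Cmod (w - w0) < d)%R -> (Cmod (z - z0) < d)%R -> (Cmod (K w z - K w0 z0) <= eps)%R.
Proof.
  intros HK eps He. assert (Ht := t_pos).
  assert (Lip : forall w z z', (Cmod (K w z - K w z') ^ 2 <= 4 * ssq w * nsq z z')%R).
  { intros w z z'. eapply Rle_trans.
    - apply (eval_diff_le (K w) z z' (2 * ssq w)); [now apply (pw_of_reproduces w)|now apply reproduces_bddI].
    - right. ring. }
  set (S := (1 + Delta * exp (2 * t * (Cmod w0 + 1)) + ssq z0)%R).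
  assert (PS : (1 <= S)%R).
  { unfold S. assert (Q := ssq_pos z0). assert (0 < Delta * exp (2 * t * (Cmod w0 + 1)))%R
      by (apply Rmult_lt_0_compat; [easy|apply exp_pos]). lra. }
  set (q := ((eps / 2) ^ 2 / (4 * S))%R). assert (Pq : (0 < q)%R) by (apply Rdiv_lt_0_compat; nra).
  destruct (nsq_small w0 q Pq) as [d1 [D1 K1]]. destruct (nsq_small z0 q Pq) as [d2 [D2 K2]].
  exists (Rmin 1 (Rmin d1 d2)). split; [repeat apply Rmin_pos; lra|]. intros w z Hw Hz.
  assert (L0 := Rmin_l 1 (Rmin d1 d2)). assert (L1 : (Rmin 1 (Rmin d1 d2) <= d1)%R) by (eapply Rle_trans; [apply Rmin_r|apply Rmin_l]).
  assert (L2 : (Rmin 1 (Rmin d1 d2) <= d2)%R) by (eapply Rle_trans; [apply Rmin_r|apply Rmin_r]).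
  assert (Zw : (Cmod (w0 - w0) < d1)%R) by (replace (w0 - w0) with (RtoC 0) by ring; now rewrite Cmod_0).
  assert (Zz : (Cmod (z0 - z0) < d2)%R) by (replace (z0 - z0) with (RtoC 0) by ring; now rewrite Cmod_0).
  specialize (K1 w w0 ltac:(lra) Zw). specialize (K2 z z0 ltac:(lra) Zz).
  assert (Step : forall a b c, (0 <= a <= S)%R -> (0 <= b <= q)%R -> (Cmod c ^ 2 <= 4 * a * b)%R -> (Cmod c <= eps / 2)%R).
  { intros a b c Ha Hb Hc. apply Rsqr_incr_0_var; [|lra]. unfold Rsqr.
    assert (4 * a * b <= 4 * S * q)%R by (apply Rmult_le_compat; lra).
    assert (4 * S * q = (eps / 2) ^ 2)%R by (unfold q; field; lra). nra. }
  assert (E1 : (Cmod (K w z - K w z0) <= eps / 2)%R).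
  { apply (Step (ssq w) (nsq z z0)); [split; [apply ssq_pos|]|split; [apply nsq_pos|easy]|apply Lip].
    unfold S. assert (Q := ssq_pos z0). assert (Q2 := ssq_bound w).
    assert (exp (2 * t * Cmod w) <= exp (2 * t * (Cmod w0 + 1)))%R.
    { apply exp_le. apply Rmult_le_compat_l; [lra|]. assert (T := Cmod_triangle_inv w w0). lra. }
    assert (Delta * exp (2 * t * Cmod w) <= Delta * exp (2 * t * (Cmod w0 + 1)))%R by (apply Rmult_le_compat_l; lra). lra. }
  assert (E2 : (Cmod (K w z0 - K w0 z0) <= eps / 2)%R).
  { rewrite (reproduces_sym w z0 (K w) (K z0)), (reproduces_sym w0 z0 (K w0) (K z0)) by auto.
    rewrite <- Cminus_conj, Cmod_conj.
    apply (Step (ssq z0) (nsq w w0)); [split; [apply ssq_pos|]|split; [apply nsq_pos|easy]|apply Lip].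
    unfold S. assert (0 < Delta * exp (2 * t * (Cmod w0 + 1)))%R
      by (apply Rmult_lt_0_compat; [easy|apply exp_pos]). lra. }
  replace (K w z - K w0 z0) with ((K w z - K w z0) + (K w z0 - K w0 z0)) by ring.
  eapply Rle_trans; [apply Cmod_triangle|]. lra.
Qed.

(** Uniqueness identifies [K] with the explicit candidate at nonsingular points. The limit statement
    then concerns only [K], which is continuous, so no singularity of [f] has to be resolved by
    computation. *)
Lemma kernel_given_by_formula K f ns : is_repr_kernel_SOeven Delta K ->
  (forall w z, ns w z -> exists k, reproduces Delta w k /\ k z = f w z) -> kernel_given_by K f ns.
Proof.
  intros HK Hf.
  assert (HK' : forall w, reproduces Delta w (K w)) by exact HK.
  assert (Eq : forall w z, ns w z -> K w z = f w z).
  { intros w z Hns. destruct (Hf w z Hns) as [k [Hk <-]].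
    rewrite (reproduces_sym w z (K w) (K z)), (reproduces_sym w z k (K z)) by auto. reflexivity. }
  split; [easy|]. intros w z P [e He].
  destruct (kernel_jointly_continuous K w z HK' (e / 2)%R ltac:(generalize (cond_pos e); lra)) as [d [Hd Kd]].
  assert (Hd2 : (0 < d / 2)%R) by lra. exists (mkposreal _ Hd2).
  intros [w' z'] [[B1 B2] [B3 B4]] Hns. simpl in Hns |- *. rewrite <- (Eq w' z' Hns). apply He.
  simpl in B1, B2, B3, B4.
  assert (Dw : (Cmod (w' - w) < d)%R).
  { eapply Rle_lt_trans; [apply Cmod_le_Re_Im|].
    assert (B1' : (Rabs (Re (w' - w)) < d / 2)%R) by exact B1. assert (B2' : (Rabs (Im (w' - w)) < d / 2)%R) by exact B2. lra. }
  assert (Dz : (Cmod (z' - z) < d)%R).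
  { eapply Rle_lt_trans; [apply Cmod_le_Re_Im|].
    assert (B3' : (Rabs (Re (z' - z)) < d / 2)%R) by exact B3. assert (B4' : (Rabs (Im (z' - z)) < d / 2)%R) by exact B4. lra. }
  specialize (Kd w' z' Dw Dz). assert (Q := cond_pos e). split.
  - eapply Rle_lt_trans; [apply (re_le_Cmod (K w' z' - K w z))|]. lra.
  - eapply Rle_lt_trans; [apply (Im_le_Cmod (K w' z' - K w z))|]. lra.
Qed.
End Abstract.

Theorem theorem5 :
  (forall Delta : R, (0 < Delta <= 1)%R ->
     (exists K, is_repr_kernel_SOeven Delta K) /\
     forall K, is_repr_kernel_SOeven Delta K ->
       kernel_given_by K (K_formula_i Delta) nonsing_i) /\
  (forall Delta : R, (1 < Delta <= 2)%R ->
     (exists K, is_repr_kernel_SOeven Delta K) /\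
     forall K, is_repr_kernel_SOeven Delta K ->
       kernel_given_by K (K_formula_ii Delta) nonsing_ii).
Proof.
  split; intros Delta HD; split.
  - exists (fun w => conj_ker (comb (ker_i Delta w))). intros w. now apply ker_i_reproduces.
  - intros K HK. apply (kernel_given_by_formula Delta); [lra|easy|]. intros w z Hns.
    exists (conj_ker (comb (ker_i Delta w))). split; [now apply ker_i_reproduces|].
    apply ker_i_formula; [easy|lra].
  - assert (Ex : forall w, exists k, reproduces Delta w k).
    { apply reproduces_everywhere; [lra|]. intros w Hw.
      exists (conj_ker (comb (ker_ii Delta w))).
      (* A nonreal [w] differs from 0 and from both poles. *)
      apply ker_ii_reproduces; [easy| | |]; intros E; apply Hw; rewrite E; reflexivity. }
    exists (fun w => proj1_sig (constructive_indefinite_description _ (Ex w))). intros w.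
    exact (proj2_sig (constructive_indefinite_description _ (Ex w))).
  - intros K HK. apply (kernel_given_by_formula Delta); [lra|easy|]. intros w z Hns.
    exists (conj_ker (comb (ker_ii Delta w))). split; [|now apply ker_ii_formula].
    destruct Hns as [H0 [H1 [H2 _]]]. now apply ker_ii_reproduces.
Qed.
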